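(* Let $\lambda$ be a shape with interior vertices $v_1,\dots,v_r$ ($r=|V^o|$). Let $\widetilde\Delta^{NK}(\lambda)$ be the reduced nonkissing complex, $\Gamma^{NF}(\lambda)$ the nonfriendly complex, and let $$F(x,y_1,\ldots,y_r)=\sum_{F\in\widetilde\Delta^{NK}(\lambda)}x^{|F\setminus F_0|}\prod_{i:\,q_i\in F}y_i,\qquad H(x,y_1,\ldots,y_r)=\sum_{F\in\Gamma^{NF}(\lambda)}x^{|F|}\prod_{i:\,t_i\in\epsilon(F)}y_i .$$ Then $$H(x+1,\,y_1+1,\ldots,y_r+1)=x^r\,F\!\left(\frac1x,\ \frac{1+y_1(x+1)}{x},\ \ldots,\ \frac{1+y_r(x+1)}{x}\right)$$ as an identity of rational functions in $x,y_1,\dots,y_r$.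
   Context: A shape is a finite vertex-induced subgraph $\lambda$ of the square grid $\mathbb{Z}^2$ (two points are adjacent iff they differ by 1 in exactly one coordinate and agree in the other). $(a,b)$ is immediately South of $(a,b+1)$ and immediately East of $(a-1,b)$; North and West are the reverse relations. A vertex of $\lambda$ is interior if all four of its grid neighbors are in $\lambda$, and a boundary vertex otherwise; $V^o$ is the set of interior vertices. A (boundary) path is a sequence of vertices $(v_0,\ldots,v_l)$ of $\lambda$, $l>0$, with $v_0,v_l$ boundary vertices, $v_1,\dots,v_{l-1}$ interior vertices, and each $v_i$ immediately South or East of $v_{i-1}$. A segment is a sequence of interior vertices $(v_0,\ldots,v_l)$, $l\ge 0$, with each $v_i$ immediately South or East of $v_{i-1}$; it is lazy if it has only one vertex. If $t=(v_i,\dots,v_j)$ is a contiguous subsequence of a path or segment $p=(v_0,\dots,v_l)$, then $p$ starts with $t$ if $i=0$ and otherwise enters $t$ from the West (resp. North) if $v_{i-1}$ is immediately West (resp. North) of $v_i$; $p$ ends with $t$ if $j=l$ and otherwise leaves $t$ to the East (resp. South) if $v_{j+1}$ is immediately East (resp. South) of $v_j$. The same language is used for a single vertex $t=(v)$. Nonkissing complex: two paths $p,q$ kiss along a common segment $s$ if (up to exchanging $p$ and $q$) $p$ enters $s$ from the West and leaves $s$ to the South, while $q$ enters $s$ from the North and leaves $s$ to the East. They are nonkissing if they kiss along no segment. The reduced nonkissing complex $\widetilde\Delta^{NK}(\lambda)$ is the simplicial complex whose faces are the sets (including $\emptyset$) of pairwise nonkissing paths, none of which is horizontal (only East steps) or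 vertical (only South steps). For each $i$, $q_i$ is the initial path at $v_i$: the path which turns only at $v_i$, entering $v_i$ from the West and leaving to the South. $F_0=\{q_1,\dots,q_r\}$. Nonfriendly complex: two segments $s,t$ are friendly along a common (contiguous) subsegment $u$ if, up to exchanging $s$ and $t$: $s$ starts with $u$ or enters $u$ from the West, and $s$ ends with $u$ or leaves $u$ to the South; and $t$ starts with $u$ or enters $u$ from the North, and $t$ ends with $u$ or leaves $u$ to the East. They are nonfriendly if they are friendly along no segment. $\Gamma^{NF}(\lambda)$ is the simplicial complex whose faces are the sets of segments (including $\emptyset$) whose distinct members are pairwise nonfriendly. $t_i=(v_i)$ is the lazy segment at $v_i$. For a set $S$ of segments, $\epsilon(S)$ is the set of lazy segments in $S$ that are not contained in any other member of $S$. *)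

(* Defs.v *)
From HB Require Import structures.
From mathcomp Require Import all_boot all_order all_algebra.
From mathcomp Require Import finmap mpoly zify.

Set Implicit Arguments.
Unset Strict Implicit.
Unset Printing Implicit Defensive.

Import Order.TTheory GRing.Theory Num.Theory.
Local Open Scope fset_scope.
Local Open Scope ring_scope.

Notation point := (int * int)%type.

Definition east (v : point) : point := (v.1 + 1, v.2).
Definition west (v : point) : point := (v.1 - 1, v.2).
Definition north (v : point) : point := (v.1, v.2 + 1).
Definition south (v : point) : point := (v.1, v.2 - 1).

Definition step (v w : point) : bool := (w == south v) || (w == east v).

(* A vertex-induced subgraph is given by its vertex set. *)
Notation grid_shape := {fset point}.

Definition interior (L : grid_shape) (v : point) : bool :=
  [&& v \in L, north v \in L, south v \in L, east v \in L & west v \in L].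

Definition boundary (L : grid_shape) (v : point) : bool :=
  (v \in L) && ~~ interior L v.

Definition is_path (L : grid_shape) (p : seq point) : bool :=
  if p is v0 :: p' then
    [&& p' != [::], sorted step p, boundary L v0, boundary L (last v0 p')
      & all (interior L) (behead (belast v0 p'))]
  else false.

Definition is_segment (L : grid_shape) (s : seq point) : bool :=
  [&& s != [::], sorted step s & all (interior L) s].

Definition horizontal (p : seq point) : bool :=
  sorted (fun v w => w == east v) p.
Definition vertical (p : seq point) : bool :=
  sorted (fun v w => w == south v) p.

(* Below, t is a nonempty contiguous subsequence of p.  Paths and segments have
   no repeated vertex, so t occurs at a single place in p; p starts (ends) with
   t exactly when [prefix t p] ([suffix t p]). *)
Definition enters_west (t p : seq point) : bool :=
  if t is v :: _ then infix (west v :: t) p else false.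
Definition enters_north (t p : seq point) : bool :=
  if t is v :: _ then infix (north v :: t) p else false.
Definition leaves_east (t p : seq point) : bool :=
  if t is v :: t' then infix (rcons t (east (last v t'))) p else false.
Definition leaves_south (t p : seq point) : bool :=
  if t is v :: t' then infix (rcons t (south (last v t'))) p else false.

(* Paths and segments of L are represented in a finite type: a sequence making
   only South and East steps has no repetition, so the length bound is
   harmless (lemma [word_ex]). *)
Notation word L := (#|` L|.-bseq L).

Definition pts (L : grid_shape) (w : word L) : seq point := [seq val v | v <- w].

Definition kiss_along (s p q : seq point) : bool :=
  [&& enters_west s p, leaves_south s p, enters_north s q & leaves_east s q].

Definition kiss (L : grid_shape) (p q : seq point) : bool :=
  [exists s : word L, is_segment L (pts s) &&
     (kiss_along (pts s) p q || kiss_along (pts s) q p)].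

Definition friendly_along (u s t : seq point) : bool :=
  [&& prefix u s || enters_west u s, suffix u s || leaves_south u s,
      prefix u t || enters_north u t & suffix u t || leaves_east u t].

Definition friendly (L : grid_shape) (s t : seq point) : bool :=
  [exists u : word L, is_segment L (pts u) &&
     (friendly_along (pts u) s t || friendly_along (pts u) t s)].

Definition reduced_nonkissing_complex (L : grid_shape) : {set {set word L}} :=
  [set F : {set word L} |
     [forall p in F, [&& is_path L (pts p), ~~ horizontal (pts p)
                       & ~~ vertical (pts p)]] &&
     [forall p in F, forall q in F, (p != q) ==> ~~ kiss L (pts p) (pts q)]].

Definition nonfriendly_complex (L : grid_shape) : {set {set word L}} :=
  [set F : {set word L} |
     [forall s in F, is_segment L (pts s)] &&
     [forall s in F, forall t in F, (s != t) ==> ~~ friendly L (pts s) (pts t)]].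

Definition turns_at (v : point) (p : seq point) : bool :=
  (enters_west [:: v] p && leaves_south [:: v] p) ||
  (enters_north [:: v] p && leaves_east [:: v] p).

Definition is_initial_path (L : grid_shape) (v : point) (p : seq point) : bool :=
  [&& is_path L p, enters_west [:: v] p, leaves_south [:: v] p
    & [forall w : L, turns_at (val w) p ==> (val w == v)]].

(* Well defined at interior vertices: [initial_pathP], [initial_path_unique]. *)
Definition initial_path (L : grid_shape) (v : L) : word L :=
  odflt [bseq] [pick p : word L | is_initial_path L (val v) (pts p)].

Lemma lazy_subproof (L : grid_shape) (v : L) : (size [:: v] <= #|` L|)%N.
Proof. by rewrite cardfs_gt0; apply/fset0Pn; exists (val v); apply: valP. Qed.

Definition lazy (L : grid_shape) (v : L) : word L := Bseq (lazy_subproof v).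

Definition epsilon (L : grid_shape) (S : {set word L}) : {set word L} :=
  [set t in S | (size t == 1%N) &&
     [forall s in S, (s != t) ==> ~~ infix (pts t) (pts s)]].

Definition NKpoly (L : grid_shape) (r : nat) (v : 'I_r -> L) (K : comNzRingType)
    (x : K) (y : 'I_r -> K) : K :=
  \sum_(F in reduced_nonkissing_complex L)
    x ^+ #|F :\: [set initial_path (v i) | i : 'I_r]| *
    \prod_(i < r | initial_path (v i) \in F) y i.

Definition NFpoly (L : grid_shape) (r : nat) (v : 'I_r -> L) (K : comNzRingType)
    (x : K) (y : 'I_r -> K) : K :=
  \sum_(F in nonfriendly_complex L)
    x ^+ #|F| * \prod_(i < r | lazy (v i) \in epsilon F) y i.

(* The field Q(x, y_1, ..., y_r) and its indeterminates. *)
Notation ratfun r := {fraction {mpoly rat[r.+1]}}.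
Definition varx (r : nat) : ratfun r := tofrac 'X_ord0.
Definition vary (r : nat) (i : 'I_r) : ratfun r := tofrac 'X_(lift ord0 i).

Section Words.
Variable L : grid_shape.

Lemma step_uniq (p : seq point) : sorted step p -> uniq p.
Proof.
move=> sp; apply: (@map_uniq _ _ (fun v : point => v.1 - v.2)).
apply: (@sorted_uniq _ <%R); [exact: lt_trans | exact: ltxx|].
rewrite sorted_map; apply: sub_sorted sp => -[a b] [c d].
by rewrite /step /= => /orP[] /eqP[-> ->]; lia.
Qed.

Lemma word_ex (p : seq point) : sorted step p -> {subset p <= L} ->
  exists w : word L, pts w = p.
Proof.
move=> /step_uniq up pL.
have [s sE] : exists s : seq L, [seq val x | x <- s] = p.
  elim: p {up} pL => [|v p IH] pL; first by exists [::].
  have [|s <-] := IH; first by move=> z zp; apply: pL; rewrite inE zp orbT.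
  have vL : v \in L by apply: pL; rewrite mem_head.
  by exists ([` vL] :: s).
have ss : (size s <= #|` L|)%N.
  by rewrite -(size_map val) sE; apply: uniq_leq_size.
by exists (Bseq ss).
Qed.

Lemma pts_inj : injective (@pts L).
Proof. by move=> w w' /(inj_map val_inj) /val_inj. Qed.

Lemma infix2P (z a b : point) (p : seq point) :
  reflect (exists i, [/\ (i.+1 < size p)%N, nth z p i = a & nth z p i.+1 = b])
          (infix [:: a; b] p).
Proof.
apply: (iffP idP) => [/infixP[s [s' ->]]|[i [ip <- <-]]].
  exists (size s); rewrite !size_cat /= !nth_cat ltnn subnn.
  by rewrite subSnn ifF; [split=> //; lia | lia].
apply/infixP; exists (take i p), (drop i.+2 p).
by rewrite /= -!drop_nth ?cat_take_drop //; lia.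
Qed.

Lemma is_pathP (z : point) (p : seq point) :
  reflect [/\ (1 < size p)%N, sorted step p,
     (forall i, (i < size p)%N -> nth z p i \in L) &
     (forall i, (i < size p)%N ->
       interior L (nth z p i) = (0 < i)%N && (i.+1 < size p)%N)]
  (is_path L p).
Proof.
case/lastP: p => [|p b]; first by right; case.
case: p => [|a p]; first by right; case.
rewrite rcons_cons /is_path last_rcons belast_rcons [behead _]/=.
rewrite -size_eq0 size_rcons.
apply: (iffP and5P) => [[_ sp]|[_ sp pL pI]].
  move=> /andP[aL aI] /andP[bL bI] /(all_nthP z) pI.
  have iL i : (i < size p)%N -> nth z p i \in L by move/pI; case/and5P.
  split; rewrite /= ?size_rcons // => -[|i] //=; rewrite ?(negPf aI) // !ltnS.
    by rewrite nth_rcons; case: ltngtP => // /iL.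
  by rewrite nth_rcons; case: ltngtP => // [/pI //|_ _]; apply: negPf.
split=> //.
- by rewrite /boundary (pL 0%N) //= (pI 0%N).
- have := pL (size p).+1; have := pI (size p).+1.
  rewrite /= size_rcons nth_rcons ltnn eqxx /boundary ltnSn.
  by rewrite ltnn => -> // ->.
apply/(all_nthP z) => i ip.
have /= := pI i.+1; rewrite size_rcons nth_rcons ip !ltnS => -> //; lia.
Qed.

Lemma run_ex (f : nat -> point) : injective f -> interior L (f 0%N) ->
  exists k, [/\ (0 < k)%N, ~~ interior L (f k)
              & forall j, (j < k)%N -> interior L (f j)].
Proof.
move=> fI f0; have ex : exists k, ~~ interior L (f k).
  have [/allP iP|/allPn[_ /mapP[k _ ->] ?]] :=
    boolP (all (interior L) (mkseq f #|` L|.+1)); last by exists k.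
  have: (size (mkseq f #|` L|.+1) <= #|` L|)%N.
    apply: uniq_leq_size; first exact: mkseq_uniq.
    by move=> z /iP /and5P[].
  by rewrite size_mkseq ltnn.
case: (ex_minnP ex) => k kI km; exists k; split=> //.
  by case: k kI {km} => //; rewrite f0.
by move=> j jk; apply: contraTT jk => /km; rewrite -leqNgt.
Qed.

Lemma initial_path_ex (v : point) : interior L v ->
  exists w : word L, is_initial_path L v (pts w).
Proof.
case: v => a b vI.
have [|//=|k [k0 kN kI]] := @run_ex (fun i => (a - i%:Z, b)) _ _.
- by move=> i j [] /=; lia.
- by rewrite subr0.
have [|//=|m [m0 mN mI]] := @run_ex (fun i => (a, b - i%:Z)) _ _.
- by move=> i j [] /=; lia.
- by rewrite subr0.
pose f i : point := if (i <= k)%N then (a - (k - i)%N%:Z, b)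
                    else (a, b - (i - k)%N%:Z).
pose p := mkseq f (k + m).+1; pose z : point := (0, 0).
have sp : size p = (k + m).+1 by rewrite size_mkseq.
have np i : (i < (k + m).+1)%N -> nth z p i = f i by apply: nth_mkseq.
have stp : sorted step p.
  apply/(sortedP z) => i; rewrite sp => ip; rewrite !np //; last by lia.
  rewrite /f /step /south /east; case: (ltngtP i k) => ik /=.
  - by apply/orP; right; rewrite xpair_eqE /=; lia.
  - by rewrite xpair_eqE /=; lia.
  - by rewrite xpair_eqE /=; lia.
have fI i : (0 < i < k + m)%N -> interior L (f i).
  by rewrite /f => im; case: leqP => ik; [apply: kI | apply: mI]; lia.
have fL i : (i < (k + m).+1)%N -> f i \in L.
  move=> im; case: (posnP i) => [-> | i0].
    have := kI k.-1; rewrite prednK // leqnn => /(_ isT) /and5P[_ _ _ _].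
    by rewrite /f /west /= subn0; congr (_ \in L); congr pair; lia.
  have [ikm|ikm] := ltnP i (k + m); first by have/and5P[] := fI _ (introT andP (conj i0 ikm)).
  have := mI m.-1; rewrite prednK // leqnn => /(_ isT) /and5P[_ _ + _ _].
  rewrite /f /south /= ifF; last by lia.
  by congr (_ \in L); congr pair; lia.
have pP : is_path L p.
  apply/(is_pathP z); rewrite sp; split=> //; first by lia.
    by move=> i ip; rewrite np //; apply: fL.
  move=> i ip; rewrite np //; have [ikm|ikm] := boolP (0 < i < k + m)%N.
    by rewrite fI //; lia.
  apply: negbTE; have [->|->] : i = 0%N \/ i = (k + m)%N by lia.
    by rewrite /f subn0.
  by rewrite /f ifF ?addKn //; lia.
have [|w wE] := word_ex stp.
  by move=> y /(nthP z)[i]; rewrite sp => ip <-; rewrite np ?fL.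
exists w; rewrite wE /is_initial_path pP andTb; apply/and3P; split.
- apply/(infix2P z); exists k.-1; rewrite sp prednK // !np; [|lia..].
  by rewrite /f leq_pred leqnn /west /=; split; [lia|congr pair; lia|congr pair; lia].
- apply/(infix2P z); exists k; rewrite sp !np; [|lia..].
  by rewrite /f leqnn ltnn /south /=; split; [lia|congr pair; lia|congr pair; lia].
apply/forallP => -[[c d] /= cdL]; apply/implyP; rewrite /turns_at.
by case/orP => /andP[] /(infix2P z)[i [ip iE iE1]] /(infix2P z)[j [jp jE jE1]];
  rewrite sp in ip jp; move: iE iE1 jE jE1;
  rewrite (np _ ip) (np _ jp) (np _ (ltnW ip)) (np _ (ltnW jp));
  rewrite /f /west /south /north /east /= xpair_eqE;
  do 4! case: ifP => ?; case=> ? ?; case=> ? ?; case=> ? ?; case=> ? ?; lia.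
Qed.

Lemma initial_path_nth (z v : point) (p : seq point) :
  is_initial_path L v p -> exists c, [/\ (0 < c)%N, (c.+1 < size p)%N,
    forall i, (i <= c)%N -> nth z p (c - i) = (v.1 - i%:Z, v.2) &
    forall i, (c + i < size p)%N -> nth z p (c + i) = (v.1, v.2 - i%:Z)].
Proof.
case/and4P => /(is_pathP z)[p1 sp pL _] /(infix2P z)[d [dp dE dE1]].
move=> /(infix2P z)[c [cp cE cE1]] /forallP tP.
have up := step_uniq sp.
have cd : c = d.+1.
  apply/eqP; rewrite -(nth_uniq z (ltnW cp) dp up) cE dE1 //.
have turnP j a b : (j.+2 < size p)%N -> nth z p j.+1 = (a, b) ->
    nth z p j = (a - 1, b) /\ nth z p j.+2 = (a, b - 1) \/
    nth z p j = (a, b + 1) /\ nth z p j.+2 = (a + 1, b) -> j.+1 = c.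
  move=> jp jE h; have jL := pL j.+1 (ltnW jp).
  have := tP [` jL]; rewrite /= -cE (nth_uniq z (ltnW jp) (ltnW cp) up).
  suff -> : turns_at (nth z p j.+1) p by move/eqP.
  rewrite jE /turns_at; case: h => -[h h'].
    by apply/orP; left; apply/andP; split; apply/(infix2P z);
      [exists j | exists j.+1]; split=> //; lia.
  by apply/orP; right; apply/andP; split; apply/(infix2P z);
    [exists j | exists j.+1]; split=> //; lia.
have stepP j a b : (j.+1 < size p)%N -> 
    nth z p j.+1 = (a, b) -> nth z p j = (a - 1, b) \/ nth z p j = (a, b + 1).
  move=> jp jE; have := sortedP z sp _ jp; rewrite /step jE.
  case: (nth z p j) => a' b'; rewrite /south /east /= => /orP[]/eqP[-> ->].
    by right; congr pair; lia.
  by left; congr pair; lia.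
case: v cE cE1 dE dE1 {tP} => a b cE cE1 dE dE1.
exists c; split; [by rewrite cd | by []| |].
  suff H i : (i < c)%N ->
    nth z p (c - i.+1) = (a - i.+1%:Z, b) /\ nth z p (c - i) = (a - i%:Z, b).
    by case=> [|i] ic; [rewrite subn0 cE subr0 | have [] := H _ ic].
  elim: i => [|i IH] ic.
    by rewrite cd subn1 subn0 /= dE dE1 subr0.
  have [E1 E2] := IH (ltnW ic); split=> //.
  have [j jE] : exists j, j.+1 = (c - i.+1)%N by exists (c - i.+2)%N; lia.
  have E : (c - i.+2)%N = j by lia.
  have E' : (c - i)%N = j.+2 by lia.
  rewrite -jE E' in E1 E2; rewrite E.
  have jp : (j.+2 < size p)%N by lia.
  case: (stepP _ _ _ (ltnW jp) E1) => jE'; first by rewrite jE'; congr pair; lia.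
  suff : j.+1 = c by lia.
  apply: (turnP _ _ _ jp E1); right; split=> //.
  by rewrite E2; congr pair; lia.
suff H i : (c + i.+1 < size p)%N ->
  nth z p (c + i) = (a, b - i%:Z) /\ nth z p (c + i.+1) = (a, b - i.+1%:Z).
  by case=> [|i] ic; [rewrite addn0 cE subr0 | have [] := H _ ic].
elim: i => [|i IH] ic; first by rewrite addn0 addn1 cE cE1 subr0.
have [] := IH (ltn_trans (_ : c + i.+1 < c + i.+2)%N ic); first by lia.
have -> : (c + i.+2 = (c + i).+2)%N by lia.
have E : (c + i.+1 = (c + i).+1)%N by lia.
rewrite E => E1 E2; split=> //.
have jp : ((c + i).+2 < size p)%N by lia.
have := sortedP z sp _ jp; rewrite /step E2 => /orP[]/eqP jE.
  by rewrite jE /south; congr pair => /=; lia.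
suff : (c + i).+1 = c by lia.
apply: (turnP _ _ _ jp E2); right; split; last by rewrite jE.
by rewrite E1; congr pair; lia.
Qed.

Lemma initial_path_unique (v : point) (w w' : word L) :
  is_initial_path L v (pts w) -> is_initial_path L v (pts w') -> w = w'.
Proof.
pose z : point := (0, 0).
have le (p q : seq point) c d : is_path L p -> is_path L q ->
  (0 < c)%N -> (c.+1 < size p)%N ->
  (forall i, (i <= c)%N -> nth z p (c - i) = (v.1 - i%:Z, v.2)) ->
  (forall i, (c + i < size p)%N -> nth z p (c + i) = (v.1, v.2 - i%:Z)) ->
  (0 < d)%N -> (d.+1 < size q)%N ->
  (forall i, (i <= d)%N -> nth z q (d - i) = (v.1 - i%:Z, v.2)) ->
  (forall i, (d + i < size q)%N -> nth z q (d + i) = (v.1, v.2 - i%:Z)) ->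
  (c <= d)%N /\ (size p - c <= size q - d)%N.
  move=> /(is_pathP z)[_ _ _ pI] /(is_pathP z)[_ _ _ qI].
  move=> c0 cp p1 p2 d0 dq q1 q2; split; rewrite leqNgt; apply/negP => lt.
    have := p1 d (ltnW lt); rewrite -q1 // subnn => E.
    have := pI (c - d)%N; rewrite E qI; lia.
  set n := (size q - d).-1; have := p2 n.
  rewrite -q2; last by rewrite /n; lia.
  have -> : (c + n < size p)%N by rewrite /n; lia.
  move=> /(_ isT) E.
  by have := pI (c + n)%N; rewrite E qI /n; lia.
move=> wI w'I; have [wP w'P] := (andP wI, andP w'I).
case: wP w'P => wP _ [w'P _].
have [c [c0 cp p1 p2]] := initial_path_nth z wI.
have [d [d0 dp q1 q2]] := initial_path_nth z w'I.
have [le1 le2] := le _ _ _ _ wP w'P c0 cp p1 p2 d0 dp q1 q2.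
have [ge1 ge2] := le _ _ _ _ w'P wP d0 dp q1 q2 c0 cp p1 p2.
have cd : c = d by lia.
subst d; apply: pts_inj; apply: (@eq_from_nth _ z); first by lia.
move=> i ip; have [ic|ci] := leqP i c.
  by rewrite -(subKn ic) p1 ?q1 ?leq_subr.
rewrite -(subnKC (ltnW ci)) p2 ?q2 //; lia.
Qed.


Lemma initial_pathP (v : L) : interior L (val v) ->
  is_initial_path L (val v) (pts (initial_path v)).
Proof.
move=> /initial_path_ex[w wI]; rewrite /initial_path.
by case: pickP => //= /(_ w); rewrite wI.
Qed.

End Words.

(* Main.v *)
Require Import Defs.
From HB Require Import structures.
From mathcomp Require Import all_boot all_order all_algebra.
From mathcomp Require Import finmap mpoly zify ring.

(* Fix a set I of interior vertices, and call paths and segments of I those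
   whose inner vertices, resp. vertices, lie in I.

   Let v be a vertex of I whose East and South neighbours are not in I.  The
   walks of I - v that arrive at v are totally ordered by the way they enter
   their common suffixes, and a face for I amounts to a face for I - v and a way
   to cut the chain of its walks arriving at v into those leaving to the South
   and those leaving to the East, where one walk at the cut may be extended both
   ways (paths) or stop at v (segments); for segments, the lazy one at v may be
   inserted into the chain.  Record by a variable A_e the number of walks whose
   last edge e leaves I.  Adding v then acts on the generating polynomials of
   the two complexes by two linear operators, which are conjugate: substituting
   A_e - 1 for A_e in the one for segments, and multiplying it by the product
   of the 1 + u A_e, gives the one for paths up to a power of u, where the
   weight X of a closed segment satisfies X u = 1 + u.  At A = 1, and after
   division by the contribution (1 + u)^k of the horizontal and vertical paths,
   which kiss no path, this is the identity without the y_i.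

   The y_i are reduced to this case for a smaller set.  If a path does not kiss
   the initial path at a and passes through a, then it is horizontal before a or
   vertical after a, so it is determined by its remaining half.  Hence the faces
   containing the initial paths at the points of A correspond to the faces for
   I - A.  Similarly, a face whose epsilon contains the lazy segments at A is a
   face for I - A to which these lazy segments are added. *)

(** The size of a face does not tell how many of its walks arrive at v, and the number of ways to
    cut the chain there depends on exactly that; hence the induction carries one variable per edge.
    As neither the East nor the South neighbour of v is in I, a walk through v ends one step later,
    so adding v consumes the variables of the two edges into v and produces those of the two edges
    out of it. The edges into v may share one variable, since only the total number of arrivals
    matters.

    For I empty there are no segments, and the paths are single edges that never kiss: this is where
    the product of the 1 + u A_e comes from.

    In the final substitution u = 1/x and X = x + 1, whence X u = 1 + u. An initial path then weighs
    u (1 + y_i X), where u is the weight of every other path. Choosing the term y_i X removes the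
    vertex from I on both sides, and its X is the weight of the lazy segment that corresponds to the
    initial path. The remaining powers of u add up to u^r, which x^r cancels. *)

Set Implicit Arguments.
Unset Strict Implicit.
Unset Printing Implicit Defensive.

Import Order.TTheory GRing.Theory.
Local Open Scope ring_scope.

(** * Cutting a chain *)

Section ChainPolynomials.
Variable K : comNzRingType.

(** With [h_m] the complete homogeneous symmetric polynomial, this is
    [h_m(a, b) + c * h_(m-1)(a, b)]: the sum over the cuts of a chain of [m] elements, with [a]
    above, [b] below and [c] for an element on both sides. *)
Fixpoint chain_poly (a b c : K) (m : nat) : K :=
  if m is m'.+1 then a * chain_poly a b c m' + (b + c) * b ^+ m' else 1.

Lemma chain_poly_scale (u a b c : K) (m : nat) :
  chain_poly (u * a) (u * b) (u * c) m = u ^+ m * chain_poly a b c m.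
Proof.
elim: m => [|m IH] /=; first by rewrite mulr1.
by rewrite IH exprMn exprS; ring.
Qed.

(** The operator of adding a vertex: the exponent counts the walks arriving there, and each power is
    replaced by the sum over the cuts of a chain of that length. *)
Definition chain_functional (a b c : K) (p : {poly K}) : K :=
  \sum_(i < size p) p`_i * chain_poly a b c i.

Lemma chain_functionalE a b c n (p : {poly K}) : (size p <= n)%N ->
  chain_functional a b c p = \sum_(i < n) p`_i * chain_poly a b c i.
Proof.
move=> pn; rewrite /chain_functional.
rewrite (big_ord_widen n (fun i => p`_i * chain_poly a b c i)) //.
rewrite [RHS](bigID (fun i : 'I_n => (i < size p)%N)) /= [X in _ = _ + X]big1 ?addr0 //.
by move=> i; rewrite -leqNgt => /(nth_default 0) ->; rewrite mul0r.
Qed.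

Lemma chain_functional_is_linear a b c : scalar (chain_functional a b c).
Proof.
move=> k p q; pose n := (maxn (size p) (size q)).
have kpn : (size (k *: p) <= n)%N by rewrite (leq_trans (size_scale_leq _ _)) ?leq_maxl.
have le : (size (k *: p + q)%R <= n)%N.
  by rewrite (leq_trans (size_polyD _ _)) // geq_max kpn leq_maxr.
rewrite !(@chain_functionalE a b c n) ?leq_maxl ?leq_maxr //.
rewrite mulr_sumr -big_split /=; apply: eq_bigr => i _.
by rewrite coefD coefZ mulrDl mulrA.
Qed.

HB.instance Definition _ a b c :=
  GRing.isLinear.Build K {poly K} K _ (chain_functional a b c)
    (chain_functional_is_linear a b c).

Lemma chain_functionalXn a b c m : chain_functional a b c 'X^m = chain_poly a b c m.
Proof.
rewrite (@chain_functionalE a b c m.+1) ?size_polyXn //.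
rewrite big_ord_recr /= coefXn eqxx mul1r big1 ?add0r // => i _.
by rewrite coefXn ltn_eqF // mul0r.
Qed.

(** The recursion of [chain_poly] on monomials, where [b ^+ m] becomes evaluation at [b]. In this
    form it applies to powers of ['X - 1]. *)
Lemma chain_functionalMX a b c p :
  chain_functional a b c (p * 'X) = a * chain_functional a b c p + (b + c) * p.[b].
Proof.
elim/poly_ind: p => [|p k _]; first by rewrite mul0r !linear0 horner0 !mulr0 addr0.
rewrite -[p * 'X + _]coefK poly_def mulr_suml !linear_sum /= mulr_sumr.
rewrite horner_sum mulr_sumr -big_split /=; apply: eq_bigr => i _.
rewrite -scalerAl -exprSr !linearZ /= !chain_functionalXn hornerZ hornerXn /=.
by ring.
Qed.

(* The substitution that turns the extension of segments at a vertex (right)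
   into the extension of paths (left). *)
Lemma chain_functional_substitution (u X A B : K) m : X * u = 1 + u ->
  chain_functional A B (u * A * B) ((1 + u *: 'X) ^+ 2 * ('X - 1) ^+ m) =
  u * (1 + u * A) * (1 + u * B) *
    (chain_poly (A - 1) (B - 1) X m + chain_poly (A - 1) (B - 1) X m.+1).
Proof.
move=> Xu; elim: m => [|m IH].
  have -> : (1 + u *: 'X) ^+ 2 * ('X - 1) ^+ 0 =
      'X^0 + (u *+ 2) *: 'X^1 + (u ^+ 2) *: 'X^2 :> {poly K}.
    by rewrite -!mul_polyC polyCMn polyC_exp !expr0 expr1; ring.
  rewrite !linearD !linearZ /= !chain_functionalXn /=.
  have -> : u * (1 + u * A) * (1 + u * B) *
     (1 + ((A - 1) * 1 + (B - 1 + X) * (B - 1) ^+ 0)) =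
     (1 + u * A) * (1 + u * B) * (u * (A + B - 1) + X * u) by rewrite expr0; ring.
  by rewrite Xu expr0 expr1; ring.
rewrite [_ ^+ m.+1]exprSr mulrA mulrBr mulr1 linearB /= chain_functionalMX IH.
rewrite !(hornerM, horner_exp, hornerD, hornerZ, hornerN, hornerX, hornerC) /=.
set k := chain_poly (A - 1) (B - 1) X m.
(* The last factor is [B * (1 + u * B)], written so that [1 + u] can be exchanged for [X * u]. *)
have -> : (B + u * A * B) * ((1 + u * B) ^+ 2 * (B - 1) ^+ m) =
  (1 + u * A) * (1 + u * B) * (B - 1) ^+ m * (B * (u * B - u + (1 + u))) by ring.
by rewrite -Xu exprS; ring.
Qed.

End ChainPolynomials.

Section ChainSum.
Variables (T : finType) (disp : Order.disp_t) (O : orderType disp) (key : T -> O).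

Definition cut (P Q : {set T}) : bool :=
  [forall p in P, forall q in Q, (key q <= key p)%O].

Lemma cutP (P Q : {set T}) :
  reflect {in P & Q, forall p q, (key q <= key p)%O} (cut P Q).
Proof.
apply: (iffP forall_inP) => [h p q /h /forall_inP|h p pP]; first exact.
by apply/forall_inP => q; apply: h.
Qed.

Variables (K : comNzRingType) (a b c : K).

Definition cut_weight (x : {set T} * {set T}) : K :=
  a ^+ #|x.1 :\: x.2| * b ^+ #|x.2 :\: x.1| * c ^+ #|x.1 :&: x.2|.

(** Induction on the largest element [p0]. If it is not in [Q], it lies in [P] only and the rest of
    the cut is arbitrary. If it is in [Q], every element of [P] is at least [p0], so [Q] is all of
    [S] and [P] is empty or [[set p0]]. *)
Lemma chain_sum (S : {set T}) : {in S &, injective key} ->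
  \sum_(x : {set T} * {set T} | (x.1 :|: x.2 == S) && cut x.1 x.2) cut_weight x =
  chain_poly a b c #|S|.
Proof.
move: {2}#|S| (erefl #|S|) => m; elim: m S => [|m IH] S Sm inj.
  have /eqP S0 : S == set0 by rewrite -cards_eq0 Sm.
  rewrite Sm S0 (big_pred1 (set0, set0)) => [|[P Q]] /=.
    by rewrite /cut_weight /= !(setD0, setI0) cards0 !expr0 !mulr1.
  rewrite setU_eq0 xpair_eqE andb_idr //; case/andP => /eqP-> /eqP->.
  by apply/cutP => p q; rewrite inE.
have [s0 s0S] : exists s, s \in S by apply/card_gt0P; rewrite Sm.
pose p0 := [arg max_(p > s0 in S) key p]%O.
have [p0S p0max] : p0 \in S /\ forall q, q \in S -> (key q <= key p0)%O.
  by rewrite /p0; case: arg_maxP.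
have S'm : #|S :\ p0| = m by move: (cardsD1 p0 S); rewrite Sm p0S => -[].
have inj' : {in S :\ p0 &, injective key}.
  by move=> x y /setD1P[_ xS] /setD1P[_ yS]; apply: inj.
rewrite (bigID (fun x : {set T} * {set T} => p0 \in x.2)) /= addrC Sm /= -{1}S'm -(IH _ S'm inj').
congr (_ + _).
  rewrite mulr_sumr.
  rewrite (reindex_onto (fun x : {set T} * {set T} => (p0 |: x.1, x.2))
    (fun x : {set T} * {set T} => (x.1 :\ p0, x.2))) /=.
    apply: eq_big => [[P Q] | [P Q]] /=.
      rewrite xpair_eqE eqxx andbT; apply/idP/idP.
        case/andP => /andP[/andP[/eqP PQ /cutP pq] p0Q] /eqP PE.
        apply/andP; split; last first.
          by apply/cutP => p q pP qQ; apply: pq => //; rewrite inE pP orbT.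
        rewrite -PQ -setUA setDUl; apply/eqP/setP => z; rewrite -{1}PE !inE.
        by case: eqVneq => [->|] //=; rewrite (negPf p0Q).
      case/andP => /eqP PQ /cutP pq.
      have p0n : p0 \notin P :|: Q by rewrite PQ !inE eqxx.
      move: p0n; rewrite inE negb_or => /andP[p0P p0Q].
      rewrite -setUA PQ setD1K // eqxx /= p0Q andbT setU1K // eqxx andbT.
      apply/cutP => p q; rewrite inE in_set1 => /orP[/eqP->|pP] qQ; last exact: pq.
      by apply: p0max; move: (in_setU q P Q); rewrite PQ qQ orbT => /setD1P[].
    case/andP => /andP[_ p0Q]; rewrite xpair_eqE eqxx andbT => /eqP PE.
    have p0P : p0 \notin P by rewrite -PE !inE eqxx.
    rewrite /cut_weight /=.
    have -> : (p0 |: P) :\: Q = p0 |: (P :\: Q).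
      by apply/setP => z; rewrite !inE; case: eqVneq => [->|] //=; rewrite p0Q.
    have -> : Q :\: (p0 |: P) = Q :\: P.
      apply/setP => z; rewrite !inE; case: eqVneq => [->|] //=.
      by rewrite (negPf p0Q) andbF.
    have -> : (p0 |: P) :&: Q = P :&: Q.
      apply/setP => z; rewrite !inE; case: eqVneq => [->|] //=.
      by rewrite (negPf p0Q) andbF.
    by rewrite cardsU1 !inE (negPf p0P) andbF /= exprS !mulrA.
  move=> [P Q] /= /andP[/andP[/eqP PQ _] p0Q]; rewrite setD1K //.
  by move: p0S; rewrite -PQ inE (negPf p0Q) orbF.
have two (P Q : {set T}) :
    ((P :|: Q == S) && cut P Q) && (p0 \in Q) =
    ((P, Q) == (set0, S)) || ((P, Q) == ([set p0], S)).
  apply/idP/idP => [/andP[/andP[/eqP PQ /cutP pq] p0Q]|].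
    have Psub : P \subset [set p0].
      apply/subsetP => p pP; have pS : p \in S by rewrite -PQ inE pP.
      rewrite inE; apply/eqP/inj => //.
      by apply/eqP; rewrite eq_le p0max // pq.
    have QS : Q = S.
      rewrite -PQ; apply/esym/setUidPr/(subset_trans Psub).
      by rewrite sub1set.
    by rewrite !xpair_eqE QS eqxx !andbT orbC -subset1.
  by case/orP => /eqP[-> ->]; rewrite ?set0U p0S ?eqxx ?andbT /=; [|
    rewrite (setUidPr _) ?sub1set // eqxx /=];
    apply/cutP => p q; rewrite inE // => /eqP-> /p0max.
have neq : (set0, S) != ([set p0], S) :> {set T} * {set T}.
  by rewrite xpair_eqE eqxx andbT eq_sym -cards_eq0 cards1.
rewrite (eq_bigl (fun x : {set T} * {set T} => (x == (set0, S)) || (x == ([set p0], S)))); last first.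
  by move=> [P Q]; rewrite /= two.
rewrite (bigD1 (set0, S)) ?eqxx //= (big_pred1 ([set p0], S)); last first.
  move=> x /=; case: (eqVneq x (set0, S)) => [->|] /=; first by rewrite (negPf neq).
  by rewrite andbT.
rewrite /cut_weight /= !(set0D, setD0, set0I, cards0).
have -> : [set p0] :\: S = set0 by apply/eqP; rewrite setD_eq0 sub1set.
have -> : [set p0] :&: S = [set p0] by apply/setIidPl; rewrite sub1set.
by rewrite S'm Sm cards0 cards1 !expr0 exprS; ring.
Qed.

End ChainSum.

(** * Friendly walks *)

Local Notation z0 := ((0, 0) : point).

Section Walks.

Lemma east_west (v w : point) : (w == east v) = (v == west w).
Proof. by case: v w => [a b] [c d]; rewrite /east /west !xpair_eqE /=; lia. Qed.

Lemma south_north (v w : point) : (w == south v) = (v == north w).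
Proof. by case: v w => [a b] [c d]; rewrite /south /north !xpair_eqE /=; lia. Qed.

Lemma north_neq_west (v : point) : north v != west v.
Proof. by case: v => a b; rewrite /north /west !xpair_eqE /=; lia. Qed.

Lemma south_neq_east (v : point) : south v != east v.
Proof. by case: v => a b; rewrite /south /east !xpair_eqE /=; lia. Qed.

Lemma stepE (v w : point) : step v w = (v == north w) || (v == west w).
Proof. by rewrite /step south_north east_west. Qed.

(* How a walk [p1 ++ u ++ p2] enters and leaves [u]: North = 0 < start = 1 <
   West = 2 and South = 0 < end = 1 < East = 2.  Two walks are friendly along
   [u] iff one of them is weakly larger on entering and weakly smaller on
   leaving, with opposite sides of 1. *)
Definition in_code (p u : seq point) : nat :=
  if p == [::] then 1%N else if last z0 p == west (head z0 u) then 2 else 0%N.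

Definition out_code (u p : seq point) : nat :=
  if p == [::] then 1%N else if head z0 p == south (last z0 u) then 0%N else 2.

Lemma cat_uniq_cons (x : point) (p1 p2 q1 q2 : seq point) :
  uniq (p1 ++ x :: p2) -> p1 ++ x :: p2 = q1 ++ x :: q2 -> p1 = q1 /\ p2 = q2.
Proof.
elim: p1 q1 => [|y p1 IH] [|z q1] //=.
- by move=> _ [].
- case/andP => xp _ [xz E]; move: xp.
  by rewrite E mem_cat mem_head orbT.
- by case/andP => yp _ [yx E]; move: yp; rewrite yx mem_cat mem_head orbT.
by case/andP => _ up [-> /(IH _ up)[-> ->]].
Qed.

(** A walk without repetition contains [u] in one place only, so the codes of [u] depend on the walk
    and [u] alone. *)
Lemma cat_uniq_split (u p1 p2 q1 q2 : seq point) :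
  u != [::] -> uniq (p1 ++ u ++ p2) -> p1 ++ u ++ p2 = q1 ++ u ++ q2 ->
  p1 = q1 /\ p2 = q2.
Proof.
case: u => // x u _ up /(cat_uniq_cons up)[-> /eqP].
by rewrite eqseq_cat // eqxx => /eqP->.
Qed.

Section FriendlyCodes.
Variables (u p1 p2 : seq point).
Hypotheses (u0 : u != [::]) (sp : sorted step (p1 ++ u ++ p2)).
Let up := step_uniq sp.

Lemma prefix_in_code : prefix u (p1 ++ u ++ p2) = (in_code p1 u == 1%N).
Proof.
rewrite /in_code; case: (eqVneq p1 [::]) => [->|p1n]; first exact: prefix_prefix.
rewrite [RHS](_ : _ = false); last by case: ifP.
apply/negbTE/negP => /prefixP[r E]; move: p1n.
by have [->] := @cat_uniq_split u p1 p2 [::] r u0 up E.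
Qed.

Lemma suffix_out_code : suffix u (p1 ++ u ++ p2) = (out_code u p2 == 1%N).
Proof.
rewrite /out_code; case: (eqVneq p2 [::]) => [->|p2n]; first by rewrite cats0 suffix_suffix.
rewrite [RHS](_ : _ = false); last by case: ifP.
apply/negbTE/negP => /suffixP[r E]; move: p2n.
by have [|_ ->] := @cat_uniq_split u p1 p2 r [::] u0 up; first rewrite cats0.
Qed.

Lemma infix_cons_last x :
  infix (x :: u) (p1 ++ u ++ p2) = (p1 != [::]) && (last z0 p1 == x).
Proof.
apply/idP/idP => [/infixP[r [r' E]]|].
  have [|-> _] := @cat_uniq_split u p1 p2 (rcons r x) r' u0 up.
    by rewrite E cat_rcons.
  by rewrite last_rcons eqxx andbT -size_eq0 size_rcons.
case/lastP: (p1) => // r y /=; rewrite last_rcons => /andP[_ /eqP->].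
by rewrite cat_rcons -cat_cons infix_infix.
Qed.

Lemma infix_rcons_head x :
  infix (rcons u x) (p1 ++ u ++ p2) = (p2 != [::]) && (head z0 p2 == x).
Proof.
apply/idP/idP => [/infixP[r [r' E]]|].
  have [|_ ->] := @cat_uniq_split u p1 p2 r (x :: r') u0 up.
    by rewrite E cat_rcons.
  by rewrite eqxx.
case: (p2) => // y r /= /eqP->.
by rewrite -cat_rcons infix_infix.
Qed.

Lemma enters_west_in_code : enters_west u (p1 ++ u ++ p2) = (in_code p1 u == 2).
Proof.
have -> : enters_west u (p1 ++ u ++ p2) =
    infix (west (head z0 u) :: u) (p1 ++ u ++ p2) by case: (u) u0.
by rewrite infix_cons_last /in_code; case: (eqVneq p1 [::]) => //= _; case: eqP.
Qed.

(** [in_code] is 0 for every entry that is not from the West; that such an entry is from the North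
    holds because the walk is made of steps. *)
Lemma enters_north_in_code : enters_north u (p1 ++ u ++ p2) = (in_code p1 u == 0%N).
Proof.
have -> : enters_north u (p1 ++ u ++ p2) =
    infix (north (head z0 u) :: u) (p1 ++ u ++ p2) by case: (u) u0.
rewrite infix_cons_last /in_code; case/lastP: p1 sp => //= r y.
rewrite cat_rcons last_rcons -size_eq0 size_rcons /=.
case: (u) u0 => // v u' _ /cat_sorted2[_] /= /andP[+ _].
have wn : west v != north v by rewrite eq_sym north_neq_west.
by rewrite stepE => /orP[] /eqP->; rewrite ?eqxx ?(negPf (north_neq_west _)) ?(negPf wn).
Qed.

Lemma leaves_south_out_code : leaves_south u (p1 ++ u ++ p2) = (out_code u p2 == 0%N).
Proof.
have -> : leaves_south u (p1 ++ u ++ p2) =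
    infix (rcons u (south (last z0 u))) (p1 ++ u ++ p2) by case: (u) u0.
by rewrite infix_rcons_head /out_code; case: (eqVneq p2 [::]) => //= _; case: eqP.
Qed.

Lemma leaves_east_out_code : leaves_east u (p1 ++ u ++ p2) = (out_code u p2 == 2).
Proof.
have -> : leaves_east u (p1 ++ u ++ p2) =
    infix (rcons u (east (last z0 u))) (p1 ++ u ++ p2) by case: (u) u0.
rewrite infix_rcons_head /out_code; case: p2 sp => //= y r.
case/cat_sorted2 => _; case/lastP: u u0 => // u' v _.
rewrite cat_rcons last_rcons => /cat_sorted2[_] /= /andP[+ _].
have es : east v != south v by rewrite eq_sym south_neq_east.
by case/orP => /eqP->; rewrite ?last_rcons ?eqxx ?(negPf (south_neq_east _)) ?(negPf es).
Qed.

End FriendlyCodes.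

Lemma in_code_le2 (p u : seq point) : (in_code p u <= 2)%N.
Proof. by rewrite /in_code; case: ifP => // _; case: ifP. Qed.

Lemma out_code_le2 (u p : seq point) : (out_code u p <= 2)%N.
Proof. by rewrite /out_code; case: ifP => // _; case: ifP. Qed.

Definition friendly_codes (I : {fset point}) (p q : seq point) : Prop :=
  exists u p1 p2 q1 q2 : seq point,
  [/\ u != [::], {subset u <= I}, p = p1 ++ u ++ p2, q = q1 ++ u ++ q2 &
      [/\ (1 <= in_code p1 u)%N, (out_code u p2 <= 1)%N,
          (in_code q1 u <= 1)%N & (1 <= out_code u q2)%N]].

Lemma friendly_alongP (u p q : seq point) :
  u != [::] -> sorted step p -> sorted step q ->
  reflect (exists p1 p2 q1 q2, [/\ p = p1 ++ u ++ p2, q = q1 ++ u ++ q2 &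
      [/\ (1 <= in_code p1 u)%N, (out_code u p2 <= 1)%N,
          (in_code q1 u <= 1)%N & (1 <= out_code u q2)%N]])
    (friendly_along u p q).
Proof.
move=> u0 sp sq.
have inP r : prefix u r || enters_west u r || enters_north u r -> infix u r.
  case/orP => [/orP[/prefixW // |]|].
    by case: u u0 => // a u' _ /infixP[r1 [r2 ->]]; rewrite -cat_rcons infix_infix.
  by case: u u0 => // a u' _ /infixP[r1 [r2 ->]]; rewrite -cat_rcons infix_infix.
have cE (c : nat) : (c <= 2)%N -> ((c == 1%N) || (c == 2) = (1 <= c)%N) /\ ((c == 1%N) || (c == 0%N) = (c <= 1)%N) by case: c => [|[|[|]]].
apply: (iffP idP) => [fr|[p1 [p2 [q1 [q2 [pE qE]]]]]]; last first.
  rewrite /friendly_along pE qE; rewrite pE in sp; rewrite qE in sq.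
  rewrite !prefix_in_code // !suffix_out_code // enters_west_in_code //.
  rewrite enters_north_in_code // leaves_east_out_code // leaves_south_out_code //.
  have [-> _] := cE _ (in_code_le2 p1 u); have [_ ->] := cE _ (in_code_le2 q1 u).
  have [-> _] := cE _ (out_code_le2 u q2); have [_ ->] := cE _ (out_code_le2 u p2).
  by case=> -> -> -> ->.
have /infixP[p1 [p2 pE]] : infix u p.
  by apply: inP; case/and4P: fr => -> _ _ _.
have /infixP[q1 [q2 qE]] : infix u q.
  by apply: inP; case/and4P: fr => _ _ /orP[] -> _; rewrite ?orbT.
exists p1, p2, q1, q2; split=> //; move: fr.
rewrite /friendly_along pE qE; rewrite pE in sp; rewrite qE in sq.
rewrite !prefix_in_code // !suffix_out_code // enters_west_in_code //.
rewrite enters_north_in_code // leaves_east_out_code // leaves_south_out_code //.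
have [-> _] := cE _ (in_code_le2 p1 u); have [_ ->] := cE _ (in_code_le2 q1 u).
have [-> _] := cE _ (out_code_le2 u q2); have [_ ->] := cE _ (out_code_le2 u p2).
by case/and4P.
Qed.

Section Friend.
Variable L : grid_shape.

(* Kissing and friendliness are the same relation: a path has its ends outside
   [I], so it neither starts nor ends with a segment of [I]. *)
Definition friend (I : {fset point}) (p q : seq point) : bool :=
  [exists u : word L, [&& pts u != [::], all (mem I) (pts u) &
     friendly_along (pts u) p q || friendly_along (pts u) q p]].

Lemma friend_sym I p q : friend I p q = friend I q p.
Proof. by apply: eq_existsb => u; rewrite orbC. Qed.

(** The common part is a piece of a walk in [L], hence a word, so the quantifier over a finite type
    loses nothing. *)
Lemma friendP I p q : sorted step p -> sorted step q ->
  {subset p <= L} -> {subset q <= L} ->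
  reflect (friendly_codes I p q \/ friendly_codes I q p) (friend I p q).
Proof.
move=> sp sq pL qL; apply: (iffP existsP).
  case=> u /and3P[u0 /allP uI /orP[]] /friendly_alongP-/(_ u0).
    by case/(_ sp sq) => p1 [p2 [q1 [q2 [? ? ?]]]]; left; exists (pts u), p1, p2, q1, q2.
  by case/(_ sq sp) => p1 [p2 [q1 [q2 [? ? ?]]]]; right; exists (pts u), p1, p2, q1, q2.
have main p' q' : sorted step p' -> sorted step q' -> {subset p' <= L} ->
    friendly_codes I p' q' -> exists u : word L, [&& pts u != [::],
      all (mem I) (pts u) & friendly_along (pts u) p' q'].
  move=> sp' sq' p'L [u [p1 [p2 [q1 [q2 [u0 uI pE qE codes]]]]]].
  have [|z zu|w wE] := @word_ex L u.
  - by move: sp'; rewrite pE => /cat_sorted2[_ /cat_sorted2[]].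
  - by apply: p'L; rewrite pE !mem_cat zu orbT.
  exists w; rewrite wE u0 /=; apply/andP; split; first exact/allP.
  by apply/friendly_alongP => //; exists p1, p2, q1, q2.
case=> [/(main _ _ sp sq pL)|/(main _ _ sq sp qL)] [u /and3P[u0 uI uf]];
  by exists u; rewrite u0 uI uf ?orbT.
Qed.

End Friend.
End Walks.

(** * The order on the walks that arrive at one point *)

Section ReversedCodes.

Let back : rel point := fun w v => step v w.

Definition back_code (w r : seq point) : nat :=
  if r is y :: _ then if y == west (last z0 w) then 2 else 0%N else 1%N.

(** The last entry is always 1, the code of the start, and all earlier ones are 0 or 2. Hence no
    such sequence is a proper prefix of another, and lengths never decide the lexicographic
    order. *)
Fixpoint back_codes (r : seq point) : seq nat :=
  if r is x :: r' then back_code [:: x] r' :: back_codes r' else [::].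

Lemma back_code_inj (x y y' : point) (r r' : seq point) :
  back x y -> back x y' -> back_code [:: x] (y :: r) = back_code [:: x] (y' :: r') -> y = y'.
Proof.
rewrite /back !stepE /back_code /= => /orP[]/eqP-> /orP[]/eqP->;
  rewrite ?eqxx ?(negPf (north_neq_west _)) //.
Qed.

Lemma back_codes_inj (x : point) (r s : seq point) :
  path back x r -> path back x s -> back_codes (x :: r) = back_codes (x :: s) -> r = s.
Proof.
elim: r x s => [|y r IH] x [|y' s] //=.
move=> /andP[xy pr] /andP[xy' ps] [cE c'E rsE].
have yy' := back_code_inj (r := r) (r' := s) xy xy' cE; subst y'.
by rewrite (IH y s pr ps) //= c'E rsE.
Qed.

(** As long as the codes agree the walks agree ([back_code_inj]), so the first code that differs is
    met at the end of the longest common beginning [w]. *)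
Lemma back_codes_ltP (x : point) (r s : seq point) :
  path back x r -> path back x s ->
  ((back_codes (x :: r) : seqlexi nat) < (back_codes (x :: s) : seqlexi nat))%O <->
  exists w r1 s1, [/\ w != [::], x :: r = w ++ r1, x :: s = w ++ s1 &
                      (back_code w r1 < back_code w s1)%N].
Proof.
elim: r x s => [|y r IH] x s.
  move=> _; case: s => [_|y' s /= /andP[xy' ps]].
    rewrite ltxx; split=> // -[w [r1 [s1 [w0 E1 E2 lt]]]].
    case: w w0 E1 E2 lt => //= z w _ [_ E1] [_ E2].
    by move: E1; rewrite E2; case: w E2 => //= -> <-; rewrite ltnn.
  rewrite ltxi_cons !leEnat; split.
    case/andP => le _; exists [:: x], [::], (y' :: s); split=> //.
    by move: le; rewrite /back_code /=; case: ifP.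
  case=> -[|z w] [r1 [s1 [//= _ [<- E1] E2 lt]]].
  case: w E1 E2 lt => //= <- [<-] /=; case: ifP => // _ _.
move=> /= /andP[xy pr]; case: s => [_|y' s /andP[xy' ps]].
  rewrite ltxi_cons !leEnat; split.
    case/andP => le _; exists [:: x], (y :: r), [::]; split=> //.
    by move: le; rewrite /back_code /=; case: ifP.
  case=> -[|z w] [r1 [s1 [//= _ [<- E1] [E2] lt]]].
  case: w E1 E2 lt => //= <- <- /=; case: ifP => // _ _.
rewrite ltxi_cons !leEnat; case: (ltngtP (back_code [:: x] (y :: r)) (back_code [:: x] (y' :: s))).
- move=> lt; split=> [_|_] //.
  by exists [:: x], (y :: r), (y' :: s).
- move=> gt; split=> // -[[|z w] [r1 [s1 [//= _ [<- E1] [E2] lt]]]].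
  case: w E1 E2 lt => [|z' w] /=.
    by move=> <- <- /=; move=> /(ltn_trans gt); rewrite ltnn.
  by move=> [E _] [E' _]; move: gt; rewrite /= E E' ltnn.
move=> cE; have yy' := back_code_inj xy xy' cE; subst y'.
rewrite /=.
have IH' := IH y s pr ps; split.
  move/IH' => -[w [r1 [s1 [w0 E1 E2 lt]]]].
  exists (x :: w), r1, s1; rewrite /= E1 E2; split=> //.
  by case: w w0 {E1 E2} lt.
case=> -[|z w] [r1 [s1 [//= _ [<- E1] [E2] lt]]]; apply/IH'.
case: w E1 E2 lt => [|z' w] /=.
  by move=> <- <- /=; rewrite ltnn.
by move=> E1 E2 lt; exists (z' :: w), r1, s1.
Qed.

(* The lexicographic order on keys compares two walks with the same end by the
   way they enter their longest common suffix. *)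
Definition key (p : seq point) : seqlexi nat := back_codes (rev p).

Lemma rev_walk (p : seq point) (v : point) :
  sorted step p -> p != [::] -> last z0 p = v ->
  exists2 r, rev p = v :: r & path back v r.
Proof.
case/lastP: p => // p y; rewrite last_rcons => sp _ yv; subst y.
exists (rev p); first by rewrite rev_rcons.
by move: sp; rewrite -[rcons p v]revK rev_sorted rev_rcons.
Qed.

Lemma key_inj (v : point) (p q : seq point) : p != [::] -> q != [::] ->
  sorted step p -> sorted step q -> last z0 p = v -> last z0 q = v ->
  key p = key q -> p = q.
Proof.
move=> p0 q0 sp sq pv qv.
have [r rE pr] := rev_walk sp p0 pv; have [s sE ps] := rev_walk sq q0 qv.
rewrite /key rE sE => /(back_codes_inj pr ps) rs.
by rewrite -[p]revK rE rs -sE revK.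
Qed.

Lemma back_code_rev (w r : seq point) : w != [::] -> back_code w r = in_code (rev r) (rev w).
Proof.
case: w r => // a w [|y r] _ //=.
rewrite /in_code rev_cons last_rcons -size_eq0 size_rcons /=.
by case/lastP: w => // w b; rewrite last_rcons rev_cons rev_rcons.
Qed.

Lemma key_ltP (v : point) (p q : seq point) : p != [::] -> q != [::] ->
  sorted step p -> sorted step q -> last z0 p = v -> last z0 q = v ->
  (key p < key q)%O <->
  exists u p1 q1, [/\ u != [::], p = p1 ++ u, q = q1 ++ u & (in_code p1 u < in_code q1 u)%N].
Proof.
move=> p0 q0 sp sq pv qv.
have [r rE pr] := rev_walk sp p0 pv; have [s sE ps] := rev_walk sq q0 qv.
have key0 := back_codes_ltP pr ps; rewrite /key rE sE key0; split.
  case=> w [r1 [s1 [w0 E1 E2 lt]]]; exists (rev w), (rev r1), (rev s1).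
  rewrite -!rev_cat -E1 -E2 -rE -sE !revK -!back_code_rev //; split=> //.
  by rewrite -size_eq0 size_rev size_eq0.
case=> u [p1 [q1 [u0 pE qE lt]]]; exists (rev u), (rev p1), (rev q1).
rewrite -rE -sE pE qE -!rev_cat; have ru0 : rev u != [::] by rewrite -size_eq0 size_rev size_eq0.
by rewrite !back_code_rev // !revK.
Qed.

End ReversedCodes.

(** * Walks extended by one step *)

Lemma in_code_eq1 (p u : seq point) : (in_code p u == 1%N) = (p == [::]).
Proof. by rewrite /in_code; case: (eqVneq p [::]) => //= _; case: ifP. Qed.

Lemma out_code_rcons (u r : seq point) (z : point) :
  r != [::] -> out_code u (rcons r z) = out_code u r.
Proof. by case: r. Qed.

(** Indexed by the [out_code] it produces, so that [x <= 1] and [1 <= x] are the leaving conditions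
    of [friendly_codes]. *)
Definition tail (v : point) (x : nat) : seq point :=
  if x == 0%N then [:: south v] else if x == 1%N then [::] else [:: east v].

Lemma step_neq (v z : point) : step v z -> z != v.
Proof.
by case: v z => a b [c d]; rewrite /step /south /east !xpair_eqE /=; lia.
Qed.

Section Extension.
Variables (J I : {fset point}) (v : point).
Hypotheses (IE : I = (v |` J)%fset) (vJ : v \notin J).
Hypotheses (eJ : east v \notin J) (sJ : south v \notin J).

Lemma in_larger z : (z \in I) = (z == v) || (z \in J).
Proof. by rewrite IE in_fset1U. Qed.

Lemma tail_step x z : z \in tail v x -> step v z.
Proof.
rewrite /tail; case: ifP => _; last case: ifP => _; rewrite // inE => /eqP->.
  by rewrite /step eqxx.
by rewrite /step eqxx orbT.
Qed.

Lemma tail_notinI x z : z \in tail v x -> z \notin I.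
Proof.
move=> zx; rewrite in_larger negb_or (step_neq (tail_step zx)) /=.
by case/orP: (tail_step zx) => /eqP->.
Qed.

Lemma tail_cases x : tail v x = [::] \/ exists z, tail v x = [:: z].
Proof. by rewrite /tail; case: ifP => _; [right|case: ifP => _; [left|right]] => //; eexists. Qed.

Lemma out_code_tail (u : seq point) x : (x <= 2)%N -> last z0 u = v -> out_code u (tail v x) = x.
Proof.
rewrite /out_code /tail => x2 ->; case: x x2 => [|[|[|]]] //= _; first by rewrite eqxx.
by rewrite eq_sym (negPf (south_neq_east v)).
Qed.

Definition extends (p p' : seq point) : Prop :=
  (v \notin p /\ p' = p) \/
  [/\ p != [::], last z0 p = v & exists2 x, (x <= 2)%N & p' = p ++ tail v x].

(** A part [u] inside [J] does not end at [v]. So in a walk arriving at [v] some vertex already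
    follows [u], and what is appended after [v] does not change how [u] is left. *)
Lemma extends_inner p p' u p1 p2 : extends p p' -> u != [::] -> {subset u <= J} ->
  p' = p1 ++ u ++ p2 ->
  exists2 r, p = p1 ++ u ++ r & out_code u r = out_code u p2.
Proof.
move=> + u0 uJ; case=> [[_ ->]|[p0 pv [x x2 ->]]]; first by exists p2.
case: (tail_cases x) => [->|[z zE]]; first by rewrite cats0 => ->; exists p2.
have lu : last z0 u \in J by apply: uJ; case: (u) u0 => //= a u' _; apply: mem_last.
have lu' (r : seq point) : last z0 (r ++ u) = last z0 u.
  by case: u u0 {uJ lu} => //= a u _; rewrite last_cat.
have zI : z \notin I by apply: (@tail_notinI x); rewrite zE inE.
rewrite zE cats1; case/lastP: p2 => [|r w].
  rewrite cats0 => /(congr1 (last z0)); rewrite last_rcons lu' => zu.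
  by move: zI; rewrite zu in_larger lu orbT.
rewrite -!rcons_cat => /rcons_inj[pE zw]; exists r => //.
rewrite out_code_rcons //; apply: contraTneq lu => r0.
by move: pv; rewrite pE r0 cats0 lu' => ->.
Qed.

Lemma extends_inner_inv p p' u p1 p2 : extends p p' -> u != [::] -> {subset u <= J} ->
  p = p1 ++ u ++ p2 ->
  exists2 r, p' = p1 ++ u ++ r & out_code u r = out_code u p2.
Proof.
move=> + u0 uJ; case=> [[_ ->]|[p0 pv [x x2 ->]]]; first by exists p2.
have lu : last z0 u \in J by apply: uJ; case: (u) u0 => //= a u' _; apply: mem_last.
have lu' (r : seq point) : last z0 (r ++ u) = last z0 u.
  by case: u u0 {uJ lu} => //= a u _; rewrite last_cat.
move=> pE; exists (p2 ++ tail v x); first by rewrite pE -!catA.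
case: (tail_cases x) => [->|[z ->]]; first by rewrite cats0.
rewrite cats1 out_code_rcons //; apply: contraTneq lu => r0.
by move: pv; rewrite pE r0 cats0 lu' => ->.
Qed.

(** The step after [v] leaves [I], so a part inside [I] that contains [v] ends there. *)
Lemma extends_end p p' u p1 p2 : sorted step p' -> extends p p' -> {subset u <= I} ->
  v \in u -> p' = p1 ++ u ++ p2 ->
  [/\ p != [::], last z0 p = v, p = p1 ++ u, last z0 u = v &
      exists x, [/\ (x <= 2)%N, p' = p ++ tail v x & p2 = tail v x]].
Proof.
move=> sp' + uI vu pE; case=> [[vp p'E]|[p0 pv [x x2 p'E]]].
  by move: vp; rewrite -p'E pE !mem_cat vu orbT.
case/splitPr: vu uI pE => u1 u2 uI pE.
have up := step_uniq sp'.
case/lastP: p p0 pv p'E => // p w _; rewrite last_rcons => -> p'E; rewrite {w}.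
have E : p ++ v :: tail v x = (p1 ++ u1) ++ v :: u2 ++ p2.
  by move: p'E; rewrite pE cat_rcons -!catA /= => ->.
have [pu1 tu] : p = p1 ++ u1 /\ tail v x = u2 ++ p2.
  by apply: cat_uniq_cons E; move: up; rewrite p'E cat_rcons.
have u20 : u2 = [::].
  case: u2 uI tu {pE E} => // z u2 uI tu.
  have /tail_notinI : z \in tail v x by rewrite tu mem_head.
  by rewrite uI // mem_cat !inE eqxx !orbT.
subst u2; split; rewrite ?last_rcons //.
- by rewrite -size_eq0 size_rcons.
- by rewrite pu1 -cats1 -catA.
- by rewrite last_cat.
by exists x; split=> //; rewrite tu.
Qed.

Definition end_codes (p q p' q' : seq point) : Prop :=
  exists x y u p1 q1, [/\ p' = p ++ tail v x, q' = q ++ tail v y, p = p1 ++ u, q = q1 ++ u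
   & [/\ u != [::], {subset u <= I}, last z0 u = v &
    [/\ (x <= 1)%N, (1 <= y <= 2)%N, (1 <= in_code p1 u)%N & (in_code q1 u <= 1)%N]]].

(** A common part inside [I] either avoids [v], and is then a common part inside [J] with the same
    codes, or ends at [v], and then its leaving codes are those of the chosen tails. *)
Lemma friendly_codes_extends p q p' q' :
  sorted step p' -> sorted step q' -> extends p p' -> extends q q' ->
  friendly_codes I p' q' <-> friendly_codes J p q \/ end_codes p q p' q'.
Proof.
move=> sp' sq' ep eq; split.
  case=> u [p1 [p2 [q1 [q2 [u0 uI pE qE [h1 h2 h3 h4]]]]]].
  have [vu|vu] := boolP (v \in u).
    right; have [_ _ pE' uv [x [x2 p'E tx]]] := extends_end sp' ep uI vu pE.
    have [_ _ qE' _ [y [y2 q'E ty]]] := extends_end sq' eq uI vu qE.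
    exists x, y, u, p1, q1; split=> //; split=> //.
    by move: h2 h4; rewrite tx ty !out_code_tail // => -> ->.
  have uJ : {subset u <= J}.
    by move=> z zu; move: (uI z zu); rewrite in_larger; case: eqVneq => // zv; rewrite -zv zu in vu.
  left; have [p3 pE' p3E] := extends_inner ep u0 uJ pE.
  have [q3 qE' q3E] := extends_inner eq u0 uJ qE.
  by exists u, p1, p3, q1, q3; split=> //; rewrite p3E q3E.
case=> [[u [p1 [p2 [q1 [q2 [u0 uJ pE qE [h1 h2 h3 h4]]]]]]]|].
  have [p3 pE' p3E] := extends_inner_inv ep u0 uJ pE.
  have [q3 qE' q3E] := extends_inner_inv eq u0 uJ qE.
  exists u, p1, p3, q1, q3; split; rewrite ?p3E ?q3E //.
  by move=> z /uJ; rewrite in_larger => ->; rewrite orbT.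
case=> x [y [u [p1 [q1 [-> -> -> -> [u0 uI uv [h1 /andP[h2 h2'] h3 h4]]]]]]].
exists u, p1, (tail v x), q1, (tail v y); rewrite -!catA; split=> //.
by rewrite !out_code_tail // (leq_trans h1).
Qed.

Lemma end_codes_mem p q p' q' : end_codes p q p' q' -> (v \in p) && (v \in q).
Proof.
case=> x [y [u [p1 [q1 [_ _ -> -> [u0 _ <- _]]]]]].
by rewrite !mem_cat; case: u u0 => // a u _; rewrite /= mem_last !orbT.
Qed.

Section Words.
Variable L : grid_shape.

Lemma friend_avoiding b q q' : sorted step b -> sorted step q' -> sorted step q ->
  {subset b <= L} -> {subset q' <= L} -> {subset q <= L} ->
  v \notin b -> extends q q' -> friend L I b q' = friend L J b q.
Proof.
move=> sb sq' sq bL q'L qL vb eq.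
have eb : extends b b by left.
have H1 := friendly_codes_extends sb sq' eb eq.
have H2 := friendly_codes_extends sq' sb eq eb.
apply/(friendP _ sb sq' bL q'L)/(friendP _ sb sq bL qL).
  case=> [/H1|/H2] [h|/end_codes_mem]; rewrite ?(negPf vb) ?andbF //; first by left.
  by right.
by case=> h; [left; apply/H1; left | right; apply/H2; left].
Qed.

(** The common part is left with codes [x] and [y], so only the entries are to be compared. If their
    codes are at most 1 and at least 1, equality would mean that both walks start with [u], hence
    are equal; conversely, a strict inequality between codes among 0, 1, 2 has 1 weakly between its
    sides. *)
Lemma end_codes_key p q x y : (x <= 2)%N -> (y <= 2)%N ->
  p != [::] -> q != [::] -> last z0 p = v -> last z0 q = v ->
  sorted step p -> sorted step q -> p != q ->
  {subset behead p <= I} -> {subset behead q <= I} ->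
  end_codes p q (p ++ tail v x) (q ++ tail v y) <->
  [&& (key q < key p)%O, (x <= 1)%N & (1 <= y)%N].
Proof.
move=> x2 y2 p0 q0 pv qv sp sq pq pI qI; split.
  case=> x' [y' [u [p1 [q1 [xE yE pE qE [u0 uI uv [h1 h2 h3 h4]]]]]]].
  have tail_inj k k' (r : seq point) : (k <= 2)%N -> (k' <= 2)%N ->
      r ++ tail v k = r ++ tail v k' -> k = k'.
    move=> k2 k'2 /eqP; rewrite eqseq_cat // eqxx => /eqP tE.
    by rewrite -(out_code_tail (u := p) k2 pv) tE out_code_tail.
  have xx' : x = x' by apply: tail_inj xE => //; apply: leq_trans h1 _.
  case/andP: h2 => y1 y'2.
  have yy' : y = y' by apply: tail_inj yE.
  subst x' y'; rewrite h1 y1 !andbT.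
  apply/(key_ltP q0 p0 sq sp qv pv); exists u, q1, p1; split=> //.
  rewrite ltn_neqAle (leq_trans h4) // andbT; apply: contraNneq pq => cE.
  have q11 : in_code q1 u == 1%N by rewrite eqn_leq h4 cE h3.
  have p11 : in_code p1 u == 1%N by rewrite -cE.
  move: q11 p11; rewrite !in_code_eq1 pE qE => /eqP-> /eqP->.
  by [].
case/and3P => /(key_ltP q0 p0 sq sp qv pv)[u [q1 [p1 [u0 qE pE lt]]]] x1 y1.
exists x, y, u, p1, q1; split=> //; split=> //.
(* Only [behead] is known to lie in [I]; as the codes differ, [p1] or [q1] is nonempty, and [u] lies
   in the [behead] of that walk. *)
- case: p1 pE lt => [|a p1] pE lt z zu; last first.
    by apply: pI; rewrite pE /= mem_cat zu orbT.
  case: q1 qE lt => [|a q1] qE //= _.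
  by apply: qI; rewrite qE /= mem_cat zu orbT.
- by rewrite -pv pE last_cat; case: (u) u0.
rewrite y1 (leq_ltn_trans _ lt) //; split=> //.
by rewrite -ltnS (leq_trans lt) ?in_code_le2.
Qed.

Lemma friend_extends p q x y : (x <= 2)%N -> (y <= 2)%N ->
  p != [::] -> q != [::] -> last z0 p = v -> last z0 q = v ->
  sorted step p -> sorted step q ->
  sorted step (p ++ tail v x) -> sorted step (q ++ tail v y) -> p != q ->
  {subset behead p <= I} -> {subset behead q <= I} ->
  {subset p ++ tail v x <= L} -> {subset q ++ tail v y <= L} ->
  friend L I (p ++ tail v x) (q ++ tail v y) =
  [|| friend L J p q, [&& (key q < key p)%O, (x <= 1)%N & (1 <= y)%N] |
                      [&& (key p < key q)%O, (y <= 1)%N & (1 <= x)%N]].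
Proof.
move=> x2 y2 p0 q0 pv qv sp sq sp' sq' pq pI qI p'L q'L.
have ep : extends p (p ++ tail v x) by right; split=> //; exists x.
have eq : extends q (q ++ tail v y) by right; split=> //; exists y.
have pL : {subset p <= L} by move=> z zp; apply: p'L; rewrite mem_cat zp.
have qL : {subset q <= L} by move=> z zq; apply: q'L; rewrite mem_cat zq.
have qp : q != p by rewrite eq_sym.
have kE := end_codes_key x2 y2 p0 q0 pv qv sp sq pq pI qI.
have kE' := end_codes_key y2 x2 q0 p0 qv pv sq sp qp qI pI.
have H1 := friendly_codes_extends sp' sq' ep eq.
have H2 := friendly_codes_extends sq' sp' eq ep.
apply/(friendP _ sp' sq' p'L q'L)/or3P.
  case=> [/H1|/H2] [].
  - by move=> h; apply: Or31; apply/friendP => //; left.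
  - by move/kE => h; apply: Or32.
  - by move=> h; apply: Or31; apply/friendP => //; right.
  - by move/kE' => h; apply: Or33.
case=> [/(friendP _ sp sq pL qL)[] h|/kE h|/kE' h].
- by left; apply/H1; left.
- by right; apply/H2; left.
- by left; apply/H1; right.
- by right; apply/H2; right.
Qed.

End Words.
End Extension.

(** * Adding a vertex to the interior *)

Section Complexes.
Variable L : grid_shape.

Definition to_word (p : seq point) : word L := odflt [bseq] [pick w : word L | pts w == p].

Lemma to_wordK (p : seq point) : sorted step p -> {subset p <= L} -> pts (to_word p) = p.
Proof.
move=> sp pL; rewrite /to_word; case: pickP => [w /eqP //|].
by have [w <-] := word_ex sp pL => /(_ w); rewrite eqxx.
Qed.

Lemma pts_sub (w : word L) : {subset pts w <= L}.
Proof. by move=> z /mapP[y _ ->]; apply: valP. Qed.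

Definition complex (P : pred (seq point)) (I : {fset point}) : {set {set word L}} :=
  [set F : {set word L} | [forall p in F, P (pts p)] &&
     [forall p in F, forall q in F, (p != q) ==> ~~ friend L I (pts p) (pts q)]].

Lemma complexP (P : pred (seq point)) I (F : {set word L}) :
  reflect ({in F, forall p, P (pts p)} /\
           {in F &, forall p q, p != q -> ~~ friend L I (pts p) (pts q)})
    (F \in complex P I).
Proof.
rewrite inE; apply: (iffP andP) => -[h1 h2]; split.
- exact/forall_inP.
- by move=> p q pF qF; move/forall_inP: h2 => /(_ p pF) /forall_inP/(_ q qF) /implyP.
- exact/forall_inP.
apply/forall_inP => p pF; apply/forall_inP => q qF; apply/implyP; exact: h2.
Qed.

Lemma sub_complex (P : pred (seq point)) I (F G : {set word L}) :
  G \subset F -> F \in complex P I -> G \in complex P I.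
Proof.
move=> /subsetP GF /complexP[h1 h2]; apply/complexP; split=> [p /GF|p q /GF pF /GF qF].
  exact: h1.
exact: h2.
Qed.

End Complexes.

(* The faces for [I] are obtained from those for [J = I :\ v]: among the walks
   arriving at [v], those of [P] go on Eastwards and those of [Q] Southwards;
   [cell] tells what becomes of the walks in [P :&: Q]: a path is extended both
   ways, a segment stops at [v]. *)
Section Step.
Variables (L : grid_shape) (J I : {fset point}) (v : point).
Hypotheses (IE : I = (v |` J)%fset) (vJ : v \notin J).
Hypotheses (eJ : east v \notin J) (sJ : south v \notin J).
Hypotheses (vI : interior L v).
Variables (PJ PI : pred (seq point)) (allowed : pred 'I_3).

Definition avoiding : {set word L} := [set w | PJ (pts w) && (v \notin pts w)].
Definition arriving : {set word L} := [set w | PJ (pts w) && (last z0 (pts w) == v)].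
Definition extend (x : 'I_3) (w : word L) : word L := to_word L (pts w ++ tail v x).

Local Notation B := avoiding.
Local Notation M := arriving.

Hypothesis PJ_walk : forall p, PJ p -> sorted step p && (p != [::]).
Hypothesis M_behead : forall w, w \in M -> {subset behead (pts w) <= I}.
Hypothesis PI_split : forall w : word L, PI (pts w) <->
  w \in B \/ exists2 x, allowed x & exists2 p, p \in M & w = extend x p.

Lemma arriving_walk w : w \in M -> [/\ sorted step (pts w), pts w != [::], last z0 (pts w) = v & v \in pts w].
Proof.
rewrite inE => /andP[/PJ_walk/andP[sw w0] /eqP wv]; split=> //.
by rewrite -{1}wv; case: (pts w) w0 => //= a p _; apply: mem_last.
Qed.

Lemma sorted_cat_tail p x : sorted step p -> last z0 p = v -> sorted step (p ++ tail v x).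
Proof.
case: p => [|a p] /= sp pv.
  by case: (tail_cases v x) => [->|[z ->]].
rewrite cat_path sp pv; case: (tail_cases v x) => [->|[z zE]] //.
by rewrite zE /= andbT; apply: (@tail_step v x); rewrite zE mem_head.
Qed.

Lemma tail_sub x : {subset tail v x <= L}.
Proof.
case/and5P: vI => _ _ sL eL _ z; rewrite /tail.
by case: ifP => _; [|case: ifP => _]; rewrite ?inE // => /eqP->.
Qed.

Lemma pts_extend x w : w \in M -> pts (extend x w) = pts w ++ tail v x.
Proof.
case/arriving_walk => sw _ wv _; apply: to_wordK; first exact: sorted_cat_tail.
by move=> z; rewrite mem_cat => /orP[/pts_sub|/tail_sub].
Qed.

Lemma ord3_le2 (x : 'I_3) : (x <= 2)%N. Proof. by rewrite -ltnS. Qed.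

Lemma extend_inj x y w w' : w \in M -> w' \in M -> extend x w = extend y w' -> x = y /\ w = w'.
Proof.
move=> wM w'M E; have := congr1 (@pts L) E; rewrite !pts_extend // => {}E.
have [sw w0 wv vw] := arriving_walk wM; have [sw' w'0 w'v vw'] := arriving_walk w'M.
have [p pE] : exists p, pts w = rcons p v.
  by case/lastP: (pts w) w0 wv => // p z _; rewrite last_rcons => ->; exists p.
have [q qE] : exists q, pts w' = rcons q v.
  by case/lastP: (pts w') w'0 w'v => // q z _; rewrite last_rcons => ->; exists q.
have up : uniq (p ++ v :: tail v x).
  by rewrite -cat_rcons -pE; apply/step_uniq/sorted_cat_tail.
move: E; rewrite pE qE !cat_rcons => /(cat_uniq_cons up)[pq tE]; split.
  apply/val_inj; rewrite /= -(@out_code_tail v [:: v] x) ?ord3_le2 // tE.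
  by rewrite out_code_tail ?ord3_le2.
by apply: pts_inj; rewrite pE qE pq.
Qed.

Lemma extend_notin_avoiding x w : w \in M -> extend x w \notin B.
Proof.
move=> wM; rewrite inE pts_extend // mem_cat.
by have [_ _ _ ->] := arriving_walk wM; rewrite andbF.
Qed.

Lemma disjoint_avoiding_arriving : [disjoint B & M].
Proof.
rewrite disjoints_subset; apply/subsetP => w wB; rewrite inE; apply/negP => /arriving_walk[_ _ _].
by move: wB; rewrite inE => /andP[_ /negPf->].
Qed.

Lemma key_inj_arriving : {in M &, injective (fun w : word L => key (pts w))}.
Proof.
move=> w w' /arriving_walk[sw w0 wv _] /arriving_walk[sw' w'0 w'v _] E.
by apply: pts_inj; apply: key_inj E; eassumption.
Qed.

Variable cell : {set word L} -> {set word L} -> 'I_3 -> {set word L}.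
Hypothesis cell_allowed : forall P Q x, ~~ allowed x -> cell P Q x = set0.
Hypothesis cell_P : forall (P Q : {set word L}) (p : word L), (p \in P) = [exists x : 'I_3, (1 <= x)%N && (p \in cell P Q x)].
Hypothesis cell_Q : forall (P Q : {set word L}) (p : word L), (p \in Q) = [exists x : 'I_3, (x <= 1)%N && (p \in cell P Q x)].
(** [friend_extends] compares different walks; two extensions of the same walk have to be treated
    separately. *)
Hypothesis cell_self : forall (P Q : {set word L}) (p : word L) (x y : 'I_3), p \in M -> x != y ->
  p \in cell P Q x -> p \in cell P Q y -> ~~ friend L I (pts (extend x p)) (pts (extend y p)).

Local Notation triple := ({set word L} * ({set word L} * {set word L}))%type.

Definition assemble (x : triple) : {set word L} :=
  x.1 :|: \bigcup_(i : 'I_3) extend i @: cell x.2.1 x.2.2 i.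

(** A walk that stops at [v] counts in both parts, because [friend_extends] asks for [1 <= x] or
    [x <= 1] only. *)
Definition east_part (F : {set word L}) : {set word L} :=
  [set p in M | [exists x : 'I_3, (1 <= x)%N && (extend x p \in F)]].
Definition south_part (F : {set word L}) : {set word L} :=
  [set p in M | [exists x : 'I_3, (x <= 1)%N && (extend x p \in F)]].
Definition dissect (F : {set word L}) : {set word L} * ({set word L} * {set word L}) :=
  (F :&: B, (east_part F, south_part F)).

(** Required for faces only: in the case of segments the two parts determine the extensions of a
    walk because a face contains at most one of them. *)
Hypothesis cell_dissect : forall (F : {set word L}) (x : 'I_3) (p : word L), F \in complex L PI I -> p \in M -> allowed x ->
  (p \in cell (east_part F) (south_part F) x) = (extend x p \in F).

Lemma cell_sub P Q x p : p \in cell P Q x -> p \in P :|: Q.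
Proof.
move=> px; rewrite inE (cell_P P Q) (cell_Q P Q).
have [x1|x1] := leqP 1 x; apply/orP; [left|right]; apply/existsP; exists x; rewrite px andbT //.
exact: ltnW.
Qed.

Lemma in_assemble w x : w \in assemble x <->
  w \in x.1 \/ exists i p, p \in cell x.2.1 x.2.2 i /\ w = extend i p.
Proof.
rewrite inE; split.
  case/orP => [|/bigcupP[i _ /imsetP[p pi ->]]]; first by left.
  by right; exists i, p.
case=> [->//|[i [p [pi ->]]]]; apply/orP; right; apply/bigcupP; exists i => //.
exact: imset_f.
Qed.

Lemma assembleK (x : triple) :
  x.1 \subset B -> x.2.1 \subset M -> x.2.2 \subset M -> dissect (assemble x) = x.
Proof.
case: x => FB [P Q] /= FBB PM QM.
have cM i p : p \in cell P Q i -> p \in M.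
  by move/cell_sub; rewrite inE => /orP[/(subsetP PM)|/(subsetP QM)].
have inA i p : p \in M -> (extend i p \in assemble (FB, (P, Q))) = (p \in cell P Q i).
  move=> pM; apply/idP/idP => [/in_assemble[/= /(subsetP FBB)|[j [q [qj E]]]]|pi].
  - by rewrite (negPf (extend_notin_avoiding _ pM)).
  - by have [-> ->] := extend_inj pM (cM _ _ qj) E.
  by apply/in_assemble; right; exists i, p.
rewrite /dissect; congr (_, (_, _)).
- apply/setP => w; rewrite in_setI; apply/idP/idP => [/andP[/in_assemble[//|[i [p [pi ->]]]]]|wF].
    by rewrite (negPf (extend_notin_avoiding _ (cM _ _ pi))).
  by rewrite (subsetP FBB) // andbT; apply/in_assemble; left.
- apply/setP => p; rewrite inE; case: (boolP (p \in M)) => pM /=.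
    by rewrite (cell_P P Q); apply: eq_existsb => i; rewrite inA.
  by apply/esym/negbTE; apply: contra pM; apply/subsetP.
apply/setP => p; rewrite inE; case: (boolP (p \in M)) => pM /=.
  by rewrite (cell_Q P Q); apply: eq_existsb => i; rewrite inA.
by apply/esym/negbTE; apply: contra pM; apply/subsetP.
Qed.

Lemma dissectK F : F \in complex L PI I -> assemble (dissect F) = F.
Proof.
move=> FC; have [FP _] := complexP _ _ _ FC; apply/setP => w; apply/idP/idP.
  case/in_assemble => [|[i [p [pi ->]]]] /=; first by rewrite inE => /andP[].
  have pM : p \in M by move/cell_sub: pi; rewrite !inE => /orP[]/andP[].
  have [ai|ai] := boolP (allowed i); last by move: pi; rewrite cell_allowed // inE.
  by rewrite -cell_dissect.
move=> wF; apply/in_assemble; case/PI_split: (FP w wF) => [wB|[i ai [p pM wE]]].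
  by left; rewrite /= inE wF.
by right; exists i, p; rewrite cell_dissect // -wE.
Qed.

Local Notation kkey := (fun w : word L => key (pts w)).

(** Pairs that involve a walk avoiding [v] are friendly for [I] exactly when they are for [J]. For
    two arriving walks, [friend_extends] adds that a walk going weakly East must not lie below one
    going weakly South, which is [cut]. *)
Lemma assemble_complex (x : triple) :
  x.1 \subset B -> x.2.1 \subset M -> x.2.2 \subset M ->
  (assemble x \in complex L PI I) =
  (x.1 :|: (x.2.1 :|: x.2.2) \in complex L PJ J) && cut kkey x.2.1 x.2.2.
Proof.
case: x => FB [P Q] /= FBB PM QM.
have cM i p : p \in cell P Q i -> p \in M.
  by move/cell_sub; rewrite inE => /orP[/(subsetP PM)|/(subsetP QM)].
have walkB w : w \in B -> sorted step (pts w) /\ v \notin pts w.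
  by rewrite inE => /andP[/PJ_walk/andP[-> _] ->].
have fBB w w' : w \in B -> w' \in B -> friend L I (pts w) (pts w') = friend L J (pts w) (pts w').
  move=> /walkB[sw vw] /walkB[sw' vw'].
  by apply: (friend_avoiding IE vJ eJ sJ) => //; [exact: pts_sub..|left].
have fBM i w p : w \in B -> p \in M ->
    friend L I (pts w) (pts (extend i p)) = friend L J (pts w) (pts p).
  move=> /walkB[sw vw] pM; have [sp p0 pv _] := arriving_walk pM.
  apply: (friend_avoiding IE vJ eJ sJ) => //; try exact: pts_sub.
    by rewrite pts_extend //; apply: sorted_cat_tail.
  by right; split=> //; exists (val i); [exact: ord3_le2|rewrite pts_extend].
have fMM i j p q : p \in M -> q \in M -> p != q ->
    friend L I (pts (extend i p)) (pts (extend j q)) =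
    [|| friend L J (pts p) (pts q),
      [&& (key (pts q) < key (pts p))%O, (i <= 1)%N & (1 <= j)%N] |
      [&& (key (pts p) < key (pts q))%O, (j <= 1)%N & (1 <= i)%N]].
  move=> pM qM pq; have [sp p0 pv _] := arriving_walk pM; have [sq q0 qv _] := arriving_walk qM.
  have pI := M_behead pM; have qI := M_behead qM.
  rewrite !pts_extend //; apply: (friend_extends IE vJ eJ sJ); rewrite ?ord3_le2 //.
  - exact: sorted_cat_tail.
  - exact: sorted_cat_tail.
  - by apply: contra pq => /eqP/pts_inj->.
  - by rewrite -pts_extend //; apply: pts_sub.
  by rewrite -pts_extend //; apply: pts_sub.
have inU w : w \in FB :|: (P :|: Q) -> w \in FB \/ exists i, w \in cell P Q i.
  rewrite !inE (cell_P P Q) (cell_Q P Q).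
  case/orP => [->|/orP[]/existsP[i /andP[_ wi]]]; [by left|by right; exists i..].
apply/idP/andP => [/complexP[AP AF]|[/complexP[UP UF] /cutP PQ]].
  split.
    apply/complexP; split.
      move=> w; rewrite inE => /orP[/(subsetP FBB)|]; first by rewrite inE => /andP[].
      by rewrite inE => /orP[/(subsetP PM)|/(subsetP QM)]; rewrite inE => /andP[].
    move=> p q /inU hp /inU hq pq.
    have mA (w : word L) : w \in FB -> w \in assemble (FB, (P, Q)).
      by move=> wF; apply/in_assemble; left.
    have mC i (w : word L) : w \in cell P Q i -> extend i w \in assemble (FB, (P, Q)).
      by move=> wi; apply/in_assemble; right; exists i, w.
    case: hp => [pF|[i pi]]; case: hq => [qF|[j qj]].
    - by rewrite -fBB ?(subsetP FBB) //; apply: AF => //; apply: mA.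
    - have pB := subsetP FBB _ pF.
      rewrite -(fBM j) ?(cM _ _ qj) //; apply: AF; [exact: mA|exact: mC|].
      by apply: contraTneq pB => ->; apply: extend_notin_avoiding; apply: cM qj.
    - have qB := subsetP FBB _ qF.
      rewrite friend_sym -(fBM i) ?(cM _ _ pi) //; apply: AF; [exact: mA|exact: mC|].
      by apply: contraTneq qB => ->; apply: extend_notin_avoiding; apply: cM pi.
    have := AF _ _ (mC _ _ pi) (mC _ _ qj).
    rewrite (fMM i j _ _ (cM _ _ pi) (cM _ _ qj) pq) negb_or.
    case: eqP => [E|_ /(_ isT) /andP[] //].
    by have [_ /eqP] := extend_inj (cM _ _ pi) (cM _ _ qj) E; rewrite (negPf pq).
  apply/cutP => p q pP qQ; rewrite leNgt; apply/negP => lt.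
  have pM := subsetP PM _ pP; have qM := subsetP QM _ qQ.
  have pq : p != q by apply: contraTneq lt => ->; rewrite ltxx.
  move: pP qQ; rewrite (cell_P P Q) (cell_Q P Q).
  case/existsP => i /andP[i1 pi] /existsP[j /andP[j1 qj]].
  have : ~~ friend L I (pts (extend i p)) (pts (extend j q)).
    apply: AF; try by apply/in_assemble; right; [exists i, p|exists j, q].
    - by apply/in_assemble; right; exists i, p.
    - by apply/in_assemble; right; exists j, q.
    by apply: contra pq => /eqP /(extend_inj pM qM)[_ ->].
  by rewrite fMM // lt i1 j1 !orbT.
apply/complexP; split.
  move=> w /in_assemble[/= wF|[i [p [pi ->]]]]; apply/PI_split.
    by left; apply: (subsetP FBB).
  right; exists i; last by exists p => //; apply: cM pi.
  by have [//|ai] := boolP (allowed i); move: pi; rewrite cell_allowed // inE.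
have U1 w : w \in FB -> w \in FB :|: (P :|: Q) by move=> wF; rewrite inE wF.
have U2 i w : w \in cell P Q i -> w \in FB :|: (P :|: Q).
  by move/cell_sub => wU; rewrite inE wU orbT.
move=> w w' /in_assemble[/= wF|[i [p [pi ->]]]] /in_assemble[/= wF'|[j [q [qj ->]]]] ww'.
- by rewrite fBB ?(subsetP FBB) //; apply: UF; rewrite ?U1.
- rewrite fBM ?(subsetP FBB) ?(cM _ _ qj) //; apply: UF; [exact: U1|exact: U2 qj|].
  have wB := subsetP FBB _ wF; apply: contraTneq wB => ->.
  by rewrite (disjointFl disjoint_avoiding_arriving) ?(cM _ _ qj).
- rewrite friend_sym fBM ?(subsetP FBB) ?(cM _ _ pi) //; apply: UF; [exact: U1|exact: U2 pi|].
  have wB := subsetP FBB _ wF'; apply: contraTneq wB => ->.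
  by rewrite (disjointFl disjoint_avoiding_arriving) ?(cM _ _ pi).
have [pq|pq] := eqVneq p q.
  subst q; apply: (cell_self (cM _ _ pi) _ pi qj).
  by apply: contra ww' => /eqP->.
rewrite fMM ?(cM _ _ pi) ?(cM _ _ qj) // negb_or UF ?(U2 _ _ pi) ?(U2 _ _ qj) //=.
rewrite negb_or; apply/andP; split; apply/negP => /and3P[+ h1 h2]; rewrite ltNge PQ //.
- by rewrite (cell_P P Q); apply/existsP; exists j; rewrite h2.
- by rewrite (cell_Q P Q); apply/existsP; exists i; rewrite h1.
- by rewrite (cell_P P Q); apply/existsP; exists i; rewrite h2.
by rewrite (cell_Q P Q); apply/existsP; exists j; rewrite h1.
Qed.

Variables (K : comNzRingType) (wt : word L -> K) (omega : 'I_3 -> K) (a b c : K).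
Hypothesis wt_extend : forall x w, w \in M -> allowed x -> wt (extend x w) = omega x.
Hypothesis cell_weight : forall P Q : {set word L},
  \prod_(x : 'I_3) omega x ^+ #|cell P Q x| = cut_weight a b c (P, Q).

Lemma assemble_weight (x : triple) :
  x.1 \subset B -> x.2.1 \subset M -> x.2.2 \subset M ->
  \prod_(w in assemble x) wt w = \prod_(w in x.1) wt w * cut_weight a b c x.2.
Proof.
case: x => FB [P Q] /= FBB PM QM.
have cM i p : p \in cell P Q i -> p \in M.
  by move/cell_sub; rewrite inE => /orP[/(subsetP PM)|/(subsetP QM)].
rewrite /assemble /=; set C := \bigcup_i _.
rewrite (eq_bigl [predU FB & C]) => [|w]; last by rewrite !inE.
rewrite bigU /=; last first.
  rewrite disjoints_subset; apply/subsetP => w wF; rewrite inE.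
  apply/negP => /bigcupP[i _ /imsetP[p pi wE]].
  by move: (subsetP FBB _ wF); rewrite wE (negPf (extend_notin_avoiding _ (cM _ _ pi))).
congr (_ * _); rewrite -cell_weight partition_disjoint_bigcup /=; last first.
  move=> i j ij; rewrite disjoints_subset; apply/subsetP => w /imsetP[p pi ->].
  rewrite inE; apply/negP => /imsetP[q qj /(extend_inj (cM _ _ pi) (cM _ _ qj))[ijE _]].
  by rewrite ijE eqxx in ij.
apply: eq_bigr => i _; rewrite big_imset /=; last first.
  by move=> p q pi qi /(extend_inj (cM _ _ pi) (cM _ _ qi))[].
have [ai|ai] := boolP (allowed i); last by rewrite cell_allowed // big_set0 cards0 expr0.
rewrite (eq_bigr (fun=> omega i)); first by rewrite prodr_const.
by move=> p pi; rewrite wt_extend // (cM _ _ pi).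
Qed.

(** The faces for [I] are grouped by the face [F] for [J] that they restrict to; those over [F] are
    the cuts of the chain [F :&: M], summed by [chain_sum]. *)
Lemma step_sum :
  \sum_(F in complex L PI I) \prod_(w in F) wt w =
  \sum_(F in complex L PJ J | F \subset B :|: M)
     \prod_(w in F :&: B) wt w * chain_poly a b c #|F :&: M|.
Proof.
pose U (x : triple) := x.1 :|: (x.2.1 :|: x.2.2).
pose good (x : triple) := [&& x.1 \subset B, x.2.1 \subset M, x.2.2 \subset M,
                   U x \in complex L PJ J & cut kkey x.2.1 x.2.2].
have goodP x : good x -> [/\ x.1 \subset B, x.2.1 \subset M & x.2.2 \subset M].
  by case/and5P.
rewrite (reindex_onto assemble dissect); last by move=> F FC; apply: dissectK.
rewrite (eq_bigl good); last first.
  move=> x; apply/idP/idP => [/andP[AC /eqP dx]|gx].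
    have x1 : x.1 \subset B by rewrite -dx subsetIr.
    have x2 : x.2.1 \subset M.
      by rewrite -dx; apply/subsetP => w; rewrite [_ \in east_part _]inE => /andP[].
    have x3 : x.2.2 \subset M.
      by rewrite -dx; apply/subsetP => w; rewrite [_ \in south_part _]inE => /andP[].
    by rewrite /good x1 x2 x3 /= -assemble_complex.
  have [x1 x2 x3] := goodP _ gx.
  rewrite assembleK // eqxx andbT assemble_complex //.
  by case/and5P: gx => _ _ _ -> ->.
rewrite (partition_big U (fun F => (F \in complex L PJ J) && (F \subset B :|: M))) /=; last first.
  move=> x gx; case/and5P: (gx) => x1 x2 x3 -> _ /=.
  by rewrite setUSS // subUset x2 x3.
apply: eq_bigr => F /andP[FC FBM].
have FE : F = (F :&: B) :|: (F :&: M) by rewrite -setIUr; apply/esym/setIidPl.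
rewrite -(@chain_sum _ _ _ kkey _ a b c (F :&: M)); last first.
  by move=> w w' /setIP[_ wM] /setIP[_ w'M]; apply: key_inj_arriving.
rewrite mulr_sumr.
rewrite (reindex_onto (fun y => (F :&: B, y)) (fun x => x.2)) /=; last first.
  move=> x /andP[gx /eqP UF]; have [x1 x2 x3] := goodP _ gx.
  rewrite -UF /U setIUl (setIidPl x1) [X in _ :|: X](_ : _ = set0) ?setU0; first by case: (x).
  apply/eqP; rewrite setI_eq0 disjoint_sym; apply: disjointWr disjoint_avoiding_arriving.
  by rewrite subUset x2 x3.
apply: eq_big => [[P Q]|[P Q]] /=.
  rewrite eqxx andbT; apply/idP/idP => [/andP[gx /eqP UF]|/andP[/eqP PQF PQ]].
    have [/= x1 x2 x3] := goodP _ gx.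
    case/and5P: gx => _ _ _ _ /= ->; rewrite andbT; apply/eqP.
    have FBM0 : (F :&: B) :&: M = set0.
      by apply/eqP; rewrite setI_eq0; apply: disjointWl disjoint_avoiding_arriving; rewrite subsetIr.
    rewrite -[in RHS]UF /U /= setIUl FBM0 set0U.
    by apply/esym/setIidPl; rewrite subUset x2 x3.
  rewrite /good /U /= PQF -FE FC PQ eqxx subsetIr !andbT /=.
  by apply/andP; split; apply: subset_trans (subsetIr F M); rewrite -PQF ?subsetUl ?subsetUr.
case/andP => /andP[gx _] _; have [x1 x2 x3] := goodP _ gx.
by rewrite assemble_weight.
Qed.

End Step.

(** * Paths *)

Lemma subset_prod (T : finType) (K : comNzRingType) (S : {set T}) (w : T -> K) :
  \sum_(F : {set T} | F \subset S) \prod_(t in F) w t = \prod_(t in S) (1 + w t).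
Proof.
rewrite [RHS]big_mkcond /=.
rewrite (eq_bigr (fun t => (if t \in S then w t else 0) + 1)); last first.
  by move=> t _; case: ifP => _; rewrite ?add0r // addrC.
rewrite bigA_distr /= big_mkcond /=; apply: eq_bigr => F _.
case: ifP => FS; last first.
  have /subsetPn[t tF tS] : ~~ (F \subset S) by rewrite FS.
  by rewrite (bigD1 t) //= tF (negPf tS) mul0r.
rewrite [LHS]big_mkcond; apply: eq_bigr => t _.
by case: ifP => // tF; rewrite (subsetP FS).
Qed.

Lemma ord3_cases (x : 'I_3) : [\/ x = ord0, x = inord 1 | x = ord_max].
Proof.
case: x => -[|[|[|//]]] ?; [apply: Or31|apply: Or32|apply: Or33]; apply: val_inj => //=.
by rewrite inordK.
Qed.

Lemma big_ord3 (K : comNzRingType) (f : 'I_3 -> K) :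
  \prod_(x : 'I_3) f x = f ord0 * f (inord 1) * f ord_max.
Proof.
rewrite !big_ord_recl big_ord0 mulr1 mulrA; congr (_ * f _ * f _); apply: val_inj => //=.
by rewrite inordK.
Qed.

Lemma exists_ord3 (f : pred 'I_3) : [exists x, f x] = [|| f ord0, f (inord 1) | f ord_max].
Proof.
apply/existsP/or3P => [[x fx]|]; last by case=> fx; eexists; exact: fx.
by case: (ord3_cases x) fx => ->; [apply: Or31|apply: Or32|apply: Or33].
Qed.

Lemma inord1 : (inord 1 : 'I_3) = 1%N :> nat. Proof. by rewrite inordK. Qed.

Section FullPaths.
Variable I : {fset point}.

(* Horizontal and vertical paths are included, and also the single edges between
   two points outside [I]: these are the walks by which a point that is then
   added to [I] is reached from outside. *)
Definition full_path (p : seq point) : bool :=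
  if p is a :: p' then
    [&& p' != [::], sorted step p, a \notin I, last a p' \notin I
      & all (mem I) (behead (belast a p'))]
  else false.

Lemma full_pathP p :
  reflect (exists a m b, [/\ p = a :: rcons m b, sorted step p, a \notin I, b \notin I
                           & {subset m <= I}])
    (full_path p).
Proof.
case: p => [|a p]; first by right; case=> ? [? [? []]].
case/lastP: p => [|m b]; first by right; case=> ? [[|? ?] [? []]].
rewrite /full_path last_rcons belast_rcons -size_eq0 size_rcons.
apply: (iffP and5P) => [[_ sp aI bI /allP mI]|]; first by exists a, m, b.
case=> a' [m' [b' [[<-] /rcons_inj[<- <-] sp aI bI mI]]]; split=> //; exact/allP.
Qed.

(* Segments that may in addition leave [I] with their last step. *)
Definition open_segment (s : seq point) : bool :=
  if s is a :: s' then [&& sorted step s, a \in I & all (mem I) (belast a s')]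
  else false.

Lemma open_segmentP s :
  reflect (exists m b, [/\ s = rcons m b, sorted step s, {subset m <= I}
                         & m = [::] -> b \in I])
    (open_segment s).
Proof.
case: s => [|a s]; first by right; case=> [[|? ?] [? []]].
case/lastP: s => [|m b].
  apply: (iffP and3P) => [[_ aI _]|]; first by exists [::], a.
  by case=> -[|? [|? ?]] [? [//= [<-] _ _ /(_ erefl)]].
rewrite /open_segment belast_rcons -rcons_cons.
apply: (iffP and3P) => [[sp aI /allP mI]|].
  by exists (a :: m), b; split.
case=> m' [b' [/rcons_inj[<- <-] sp mI _]]; split=> //; last exact/allP.
by apply: mI; rewrite mem_head.
Qed.

End FullPaths.

Definition last_edge (p : seq point) : point * point := (nth z0 p (size p).-2, last z0 p).

Lemma last_edge_rcons p z : p != [::] -> last_edge (rcons p z) = (last z0 p, z).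
Proof.
case/lastP: p => // p y _; rewrite /last_edge !last_rcons !size_rcons /=.
by rewrite !nth_rcons size_rcons ltnSn ltnn eqxx.
Qed.

Section Sums.
Variable L : grid_shape.

Definition path_sum (K : comNzRingType) (u : K) (I : {fset point}) (A : point * point -> K) : K :=
  \sum_(F in complex L (full_path I) I) \prod_(w in F) (u * A (last_edge (pts w))).

Definition segment_weight (K : comNzRingType) (X : K) (I : {fset point})
    (A : point * point -> K) (p : seq point) : K :=
  if last z0 p \in I then X else A (last_edge p) - 1.

Definition segment_sum (K : comNzRingType) (X : K) (I : {fset point}) (A : point * point -> K) : K :=
  \sum_(F in complex L (open_segment I) I) \prod_(w in F) segment_weight X I A (pts w).

(** Coding edges as full paths of [fset0] makes the base of the induction, [path_sum_fset0], a
    product over [edges]. *)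
Definition edges (I : {fset point}) : {set word L} :=
  [set w : word L | full_path fset0 (pts w) & last z0 (pts w) \notin I].

Section VertexStep.
Variables (J I : {fset point}) (v : point).
Hypotheses (IE : I = (v |` J)%fset) (vJ : v \notin J).
Hypotheses (eJ : east v \notin J) (sJ : south v \notin J).
Hypotheses (vI : interior L v).

(** The vertex after [v] is South or East of it, hence outside [I], so it can only be the last
    one. *)
Lemma step_after_vertex (m1 m2 : seq point) (b : point) : sorted step (m1 ++ v :: rcons m2 b) ->
  {subset m2 <= I} -> m2 = [::] /\ exists2 x : 'I_3, x != 1%N :> nat & [:: b] = tail v x.
Proof.
move=> /cat_sorted2[_] /=; case: m2 => [|z m2] /=.
  rewrite andbT => /orP[]/eqP-> _; split=> //; first by exists ord0.
  by exists ord_max.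
case/andP => /orP[]/eqP-> _ /(_ _ (mem_head _ _)).
  have : south v \in tail v 0 by rewrite inE.
  by move/(tail_notinI IE eJ sJ) => /negPf->.
have : east v \in tail v 2 by rewrite inE.
by move/(tail_notinI IE eJ sJ) => /negPf->.
Qed.

Lemma notin_larger z : z \notin I -> z != v /\ z \notin J.
Proof. by rewrite (in_larger IE) negb_or => /andP. Qed.

Lemma subset_smaller : {subset J <= I}.
Proof. by move=> z zJ; rewrite (in_larger IE) zJ orbT. Qed.

Lemma full_path_arriving (p : seq point) : full_path J p -> last z0 p = v ->
  [/\ p != [::], sorted step p, head z0 p \notin I & {subset behead p <= I}].
Proof.
case/full_pathP => a [m [b [-> sp aJ bJ mJ]]] /=; rewrite last_rcons => bv; subst b.
split=> //.
  rewrite (in_larger IE) negb_or aJ andbT; apply: contraTneq (step_uniq sp) => ->.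
  by rewrite /= mem_rcons mem_head.
by move=> z; rewrite mem_rcons inE (in_larger IE) => /orP[->|/mJ->]; rewrite ?orbT.
Qed.

Lemma full_path_split (w : word L) : full_path I (pts w) <->
  w \in avoiding L v (full_path J) \/
  exists2 x : 'I_3, x != 1%N :> nat &
    exists2 p, p \in arriving L v (full_path J) & w = extend v x p.
Proof.
have walk p : full_path J p -> sorted step p && (p != [::]).
  by case/full_pathP => a [m [b [-> -> _ _ _]]].
split.
  case/full_pathP => a [m [b [pE sp aI bI mI]]].
  have [av aJ] := notin_larger aI; have [bv bJ] := notin_larger bI.
  have [vm|vm] := boolP (v \in m).
    case/splitPr: vm pE mI => m1 m2 pE mI; rewrite pE in sp.
    have [|z zm|m20 [x x1 tE]] := @step_after_vertex (a :: m1) m2 b.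
    - by move: sp; rewrite rcons_cat rcons_cons.
    - by apply: mI; rewrite mem_cat inE zm !orbT.
    subst m2; right; exists x => //.
    have qE : pts w = (a :: rcons m1 v) ++ [:: b] by rewrite pE cat_cons !cats1.
    have sq : sorted step (a :: rcons m1 v).
      by move: sp; rewrite -pE qE => /cat_sorted2[].
    have [y yq|q qw] := @word_ex L (a :: rcons m1 v) sq.
      by apply: (@pts_sub L w); rewrite qE mem_cat yq.
    have qM : q \in arriving L v (full_path J).
      rewrite inE qw -rcons_cons last_rcons eqxx andbT rcons_cons; apply/full_pathP.
      exists a, m1, v; split=> // z zm1; move: (mI z); rewrite mem_cat zm1 (in_larger IE) => /(_ isT).
      case: eqVneq => // zv; subst z; move: (step_uniq sp).
      by rewrite /= rcons_cat cat_uniq /= zm1 !andbF.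
    exists q => //; apply: (@pts_inj L); rewrite (pts_extend vI walk x qM) qw qE.
    by rewrite tE.
  left; rewrite inE; apply/andP; split.
    apply/full_pathP; exists a, m, b; split=> // z zm; move: (mI z zm).
    by rewrite (in_larger IE); case: eqVneq => // zv; rewrite -zv zm in vm.
  by rewrite pE inE mem_rcons inE !negb_or vm eq_sym av eq_sym bv.
case=> [|[x x1 [p pM ->]]].
  rewrite inE => /andP[/full_pathP[a [m [b [pE sp aJ bJ mJ]]]] vp].
  apply/full_pathP; exists a, m, b; move: vp; rewrite pE inE mem_rcons inE !negb_or.
  case/and3P => va vb vm; split; rewrite ?(in_larger IE) ?negb_or 1?eq_sym ?va ?vb -?pE //.
  by move=> z /mJ; apply: subset_smaller.
rewrite (pts_extend vI walk x pM); move: pM; rewrite inE => /andP[pJ /eqP pv].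
have [p0 sp hI pI] := full_path_arriving pJ pv.
have st := @sorted_cat_tail v _ x sp pv.
case: (pts p) pJ pv p0 sp hI pI st => // a q pJ qv _ sp aI qI st.
have [z zE] : exists z, tail v x = [:: z].
  by case: x x1 {st} => -[|[|[|//]]] //= ? _; eexists.
rewrite zE in st *; rewrite cats1 rcons_cons in st *.
apply/full_pathP; exists a, q, z; split=> //.
by apply: (tail_notinI IE eJ sJ (x := x)); rewrite zE mem_head.
Qed.

Lemma full_path_walk (p : seq point) : full_path J p -> sorted step p && (p != [::]).
Proof. by case/full_pathP => a [m [b [-> -> _ _ _]]]. Qed.

Local Notation MP := (arriving L v (full_path J)).
Local Notation BP := (avoiding L v (full_path J)).

Lemma behead_arriving (w : word L) : w \in MP -> {subset behead (pts w) <= I}.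
Proof. by rewrite inE => /andP[h /eqP/(full_path_arriving h)[]]. Qed.

(** A part common to two extensions of [p] is entered in the same way in both, so its code is 1 and
    [p] starts with it; but a path starts outside [I]. *)
Lemma not_friendly_self (p : seq point) (x y : nat) : full_path J p -> last z0 p = v ->
  (x <= 2)%N -> (y <= 2)%N ->
  sorted step (p ++ tail v x) -> sorted step (p ++ tail v y) ->
  ~ friendly_codes I (p ++ tail v x) (p ++ tail v y).
Proof.
move=> pJ pv x2 y2 spx spy.
have [p0 sp hI _] := full_path_arriving pJ pv.
have hu (u : seq point) : u != [::] -> {subset u <= I} -> forall r, p <> u ++ r.
  case: u => // z u _ uI r pE; move: hI.
  by rewrite pE uI ?mem_head.
have ex k : (k <= 2)%N -> extends v p (p ++ tail v k) by right; split=> //; exists k.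
case/(friendly_codes_extends IE vJ eJ sJ spx spy (ex _ x2) (ex _ y2)).
  case=> u [p1 [p2 [q1 [q2 [u0 uJ pE qE [h1 _ h3 _]]]]]].
  have pq : p1 = q1.
    have up : uniq (p1 ++ u ++ p2) by rewrite -pE step_uniq.
    have E : p1 ++ u ++ p2 = q1 ++ u ++ q2 by rewrite -pE -qE.
    by have [] := cat_uniq_split u0 up E.
  subst q1; have : in_code p1 u == 1%N by rewrite eqn_leq h1 h3.
  rewrite in_code_eq1 => /eqP p10; apply: (hu u u0 _ p2); last by rewrite pE p10.
  by move=> z /uJ; apply: subset_smaller.
case=> x' [y' [u [p1 [q1 [_ _ pE qE [u0 uI _ [_ _ h1 h3]]]]]]].
have pq : p1 = q1.
  have up : uniq (p1 ++ u ++ [::]) by rewrite cats0 -pE step_uniq.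
  have E : p1 ++ u ++ [::] = q1 ++ u ++ [::] by rewrite !cats0 -pE -qE.
  by have [] := cat_uniq_split u0 up E.
subst q1; have : in_code p1 u == 1%N by rewrite eqn_leq h1 h3.
rewrite in_code_eq1 => /eqP p10; apply: (hu u u0 uI [::]).
by rewrite cats0 pE p10.
Qed.

Lemma last_edge_extend (p : seq point) (x : nat) : p != [::] -> last z0 p = v ->
  x != 1%N -> last_edge (p ++ tail v x) = (v, if x == 0%N then south v else east v).
Proof.
move=> p0 pv x1; rewrite /tail (negPf x1); case: ifP => _;
  by rewrite cats1 last_edge_rcons // pv.
Qed.

Definition path_cell (P Q : {set word L}) (x : 'I_3) : {set word L} :=
  if x == 0%N :> nat then Q else if x == 1%N :> nat then set0 else P.

(** A walk in both parts yields two paths, so its weight is the product of the other two; it is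
    displayed with [u] in front for [chain_poly_scale]. *)
Lemma path_sum_fiber (K : comNzRingType) (u : K) (A : point * point -> K) :
  path_sum u I A =
  \sum_(F in complex L (full_path J) J | F \subset BP :|: MP)
     \prod_(w in F :&: BP) (u * A (last_edge (pts w))) *
     chain_poly (u * A (v, east v)) (u * A (v, south v))
       (u * (u * A (v, east v) * A (v, south v))) #|F :&: MP|.
Proof.
pose om (x : 'I_3) := if x == 0%N :> nat then u * A (v, south v)
                      else if x == 1%N :> nat then 1 else u * A (v, east v).
have pcell : forall P Q x p, p \in path_cell P Q x ->
    x != 1%N :> nat by move=> P Q [[|[|[|//]]] ?] p //=; rewrite /path_cell inE.
apply: (@step_sum L J I v IE vJ eJ sJ vI _ _ (fun x : 'I_3 => x != 1%N :> nat)
  full_path_walk behead_arriving full_path_split path_cell _ _ _ _ _ K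
  (fun w => u * A (last_edge (pts w))) om).
- by move=> P Q [[|[|[|//]]] ?] //=.
- move=> P Q p; rewrite exists_ord3 /path_cell inord1 /= !inE.
  by [].
- by move=> P Q p; rewrite exists_ord3 /path_cell inord1 /= !inE !orbF.
- move=> P Q p x y pM _ _ _.
  have [sp p0 pv _] := arriving_walk full_path_walk pM.
  have pJ : full_path J (pts p) by move: pM; rewrite inE => /andP[].
  have sx := sorted_cat_tail x sp pv; have sy := sorted_cat_tail y sp pv.
  have nf := not_friendly_self pJ pv; rewrite !(pts_extend vI full_path_walk) //.
  apply/negP; case/friendP => //; try exact: nf; try exact: ord3_le2.
  + by move=> z; rewrite -(pts_extend vI full_path_walk) //; apply: pts_sub.
  + by move=> z; rewrite -(pts_extend vI full_path_walk) //; apply: pts_sub.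
  + by apply: nf => //; apply: ord3_le2.
  by apply: nf => //; apply: ord3_le2.
- move=> F x p FC pM x1.
  (* [v] is in [I], so a walk that stops there is not a path of [I]. *)
  have no1 : extend v (inord 1) p \in F = false.
    apply/negbTE/negP => /(proj1 (complexP _ _ _ FC)).
    rewrite (pts_extend vI full_path_walk) // inord1 /= cats0.
    have [_ p0 pv _] := arriving_walk full_path_walk pM.
    case/full_pathP => a [m [b [pE _ _ bI _]]]; move: pv; rewrite pE /= last_rcons => bv.
    by move: bI; rewrite bv (in_larger IE) eqxx.
  rewrite /path_cell; case: (ord3_cases x) x1 => -> //=; rewrite ?inord1 //= => _.
    by rewrite inE pM exists_ord3 inord1 /= no1 !orbF.
  by rewrite inE pM exists_ord3 inord1 /= no1.
- move=> x w wM x1; rewrite (pts_extend vI full_path_walk) //.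
  have [_ w0 wv _] := arriving_walk full_path_walk wM.
  by rewrite last_edge_extend // /om; case: ifP => // _; rewrite (negPf x1).
move=> P Q; rewrite big_ord3 /om /path_cell !inord1 /= expr1n mulr1 /cut_weight /=.
set a := u * A (v, east v); set b := u * A (v, south v).
have -> : u * (u * A (v, east v) * A (v, south v)) = a * b by rewrite /a /b; ring.
clearbody a b; rewrite -(cardsID Q P) -(cardsID P Q) (setIC Q P) !exprD exprMn.
move: (a ^+ _) (a ^+ _) (b ^+ _) (b ^+ _) => c1 c2 c3 c4; ring.
Qed.

Lemma prod_avoiding_arriving (K : comNzRingType) (PJ : pred (seq point))
    (F : {set word L}) (f : word L -> K) :
  (forall p, PJ p -> sorted step p && (p != [::])) ->
  F \subset avoiding L v PJ :|: arriving L v PJ ->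
  \prod_(w in F) f w =
  \prod_(w in F :&: avoiding L v PJ) f w * \prod_(w in F :&: arriving L v PJ) f w.
Proof.
move=> walk FBM; rewrite (bigID (mem (avoiding L v PJ))) /=; congr (_ * _).
  by apply: eq_bigl => w; rewrite in_setI.
apply: eq_bigl => w; rewrite in_setI; case: (boolP (w \in F)) => //= wF.
move: (subsetP FBM w wF); rewrite in_setU.
case: (boolP (w \in avoiding L v PJ)) => /= [wB _|_ ->] //.
by rewrite (disjointFr (@disjoint_avoiding_arriving L v PJ walk) wB).
Qed.

(* The weights seen from [v]: the two edges into [v] become the variable, and
   the edges out of [v] are cut. *)
Definition arrival_weight (K : comNzRingType) (A : point * point -> K)
    (e : point * point) : {poly K} :=
  if e.2 == v then 'X else if e.1 == v then 0 else (A e)%:P.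

Lemma last_edge_mem (p : seq point) : p != [::] -> (last_edge p).1 \in p.
Proof. by case: p => // a p _; rewrite mem_nth //= ltnS leq_pred. Qed.

Lemma last_edge2 (p : seq point) : (last_edge p).2 = last z0 p.
Proof. by []. Qed.

Lemma last_mem (p : seq point) : p != [::] -> last z0 p \in p.
Proof. by case: p => //= a p _; apply: mem_last. Qed.

(** The faces for [J] that [path_sum_fiber] omits contain a path starting at [v]. Its next vertex is
    outside [J], so it is a single edge out of [v], of weight 0 under [arrival_weight]. *)
Lemma path_sum_step (K : comNzRingType) (u : K) (A : point * point -> K) :
  path_sum u I A =
  chain_functional (A (v, east v)) (A (v, south v)) (u * A (v, east v) * A (v, south v))
    (path_sum u%:P J (arrival_weight A)).
Proof.
rewrite path_sum_fiber [path_sum u%:P _ _](bigID (fun F : {set word L} => F \subset BP :|: MP)) /=.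
rewrite linearD /= [X in _ + chain_functional _ _ _ X]big1 ?linear0 ?addr0.
  rewrite linear_sum; apply: eq_bigr => F /andP[FC FBM].
  rewrite (prod_avoiding_arriving _ full_path_walk FBM) /=.
  rewrite (eq_bigr (fun w => (u * A (last_edge (pts w)))%:P)); last first.
    move=> w; rewrite in_setI inE => /and3P[_ wJ vw].
    have /andP[_ w0] := full_path_walk wJ.
    rewrite /arrival_weight last_edge2 polyCM; case: eqP => [wv|_].
      by move: vw; rewrite -wv last_mem.
    by case: eqP => // wv; move: vw; rewrite -wv last_edge_mem.
  rewrite [X in chain_functional _ _ _ (_ * X)](eq_bigr (fun=> u%:P * 'X)); last first.
    by move=> w; rewrite in_setI inE => /and3P[_ _ /eqP wv]; rewrite /arrival_weight last_edge2 wv eqxx.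
  rewrite prodr_const -(rmorph_prod polyC) /= exprMn -polyC_exp !mul_polyC !linearZ /=.
  by rewrite chain_functionalXn chain_poly_scale.
move=> F /andP[FC /subsetPn[w wF]]; rewrite inE negb_or => /andP[wB wM].
have wJ := (proj1 (complexP _ _ _ FC)) _ wF.
suff w0 : arrival_weight A (last_edge (pts w)) = 0.
  by rewrite (bigD1 w) //= w0 mulr0 mul0r.
move: wB wM; rewrite !inE wJ /= negbK /arrival_weight last_edge2 => vw lv.
rewrite (negPf lv); suff -> : (last_edge (pts w)).1 = v by rewrite eqxx.
case/full_pathP: wJ vw lv => a [m [b [-> sw aJ bJ mJ]]].
rewrite /= last_rcons inE mem_rcons inE => /or3P[/eqP va|/eqP<-|/mJ]; last first.
- by rewrite (negPf vJ).
- by rewrite eqxx.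
move=> _; subst a; case: m sw mJ => [|z m] //= /andP[vz _] mJ.
have zJ : z \in J by apply: mJ; rewrite mem_head.
by case/orP: vz => /eqP zE; move: zJ; rewrite zE ?(negPf eJ) ?(negPf sJ).
Qed.

End VertexStep.
End Sums.

(** * Segments *)

Section SegmentStep.
Variables (L : grid_shape) (J I : {fset point}) (v : point).
Hypotheses (IE : I = (v |` J)%fset) (vJ : v \notin J).
Hypotheses (eJ : east v \notin J) (sJ : south v \notin J).
Hypotheses (vI : interior L v).

(** The lazy segment at [v] is not a segment of [J], but the segments of [I] that start at [v] are
    its extensions; it enters the chain as one more walk arriving at [v]. *)
Definition started_segment (p : seq point) : bool := open_segment J p || (p == [:: v]).

Local Notation MS := (arriving L v (open_segment J)).
Local Notation BS := (avoiding L v (open_segment J)).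
Local Notation MS' := (arriving L v started_segment).
Local Notation BS' := (avoiding L v started_segment).

Lemma started_segment_walk (p : seq point) : started_segment p -> sorted step p && (p != [::]).
Proof.
case/orP => [/open_segmentP[m [b [-> -> _ _]]]|/eqP-> //].
by rewrite -size_eq0 size_rcons.
Qed.

Lemma open_segment_walk (p : seq point) : open_segment J p -> sorted step p && (p != [::]).
Proof. by move=> pJ; apply: started_segment_walk; rewrite /started_segment pJ. Qed.

Lemma started_segment_arriving (p : seq point) : started_segment p -> last z0 p = v ->
  {subset p <= I}.
Proof.
case/orP => [/open_segmentP[m [b [-> _ mJ _]]]|/eqP->]; last first.
  by move=> _ z; rewrite inE (in_larger IE) => ->.
rewrite last_rcons => -> z; rewrite mem_rcons inE (in_larger IE).
by case/orP => [->//|/mJ->]; rewrite orbT.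
Qed.

Lemma behead_started (w : word L) : w \in MS' -> {subset behead (pts w) <= I}.
Proof.
rewrite inE => /andP[h /eqP/(started_segment_arriving h) wI] z zw.
by apply: wI; apply: mem_behead.
Qed.

Lemma after_vertex (m1 m2 : seq point) (b : point) : sorted step (m1 ++ v :: rcons m2 b) ->
  {subset m2 <= I} -> m2 = [::] /\ exists x : 'I_3, [:: b] = tail v x.
Proof.
by move=> sm m2I; have [-> [x _ bE]] := step_after_vertex IE eJ sJ sm m2I; split=> //; exists x.
Qed.

Lemma word_prefix (w : word L) (p q : seq point) : sorted step (pts w) -> pts w = p ++ q ->
  exists w' : word L, pts w' = p.
Proof.
move=> sw wE; apply: word_ex; first by move: sw; rewrite wE => /cat_sorted2[].
by move=> z zp; apply: (@pts_sub L w); rewrite wE mem_cat zp.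
Qed.

Lemma open_segment_split (w : word L) : open_segment I (pts w) <->
  w \in BS' \/ exists2 x : 'I_3, true & exists2 p, p \in MS' & w = extend v x p.
Proof.
split.
  case/open_segmentP => m [b [wE sw mI bI]].
  have [vm|vm] := boolP (v \in m).
    case/splitPr: vm wE mI bI => m1 m2 wE mI _; rewrite wE in sw.
    have [|z zm|m20 [x tE]] := @after_vertex m1 m2 b.
    - by move: sw; rewrite rcons_cat rcons_cons.
    - by apply: mI; rewrite mem_cat inE zm !orbT.
    subst m2; right; exists x => //.
    have wE' : pts w = rcons m1 v ++ [:: b] by rewrite wE !cats1.
    have [|q qE] := @word_prefix w (rcons m1 v) [:: b] _ wE'; first by rewrite wE.
    have sq : sorted step (rcons m1 v) by move: sw; rewrite -wE wE' => /cat_sorted2[].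
    have qM : q \in MS'.
      rewrite inE qE last_rcons eqxx andbT /started_segment.
      case: m1 mI sq wE wE' sw {qE} => [|a m1] mI sq wE wE' sw; first by rewrite eqxx orbT.
      rewrite [X in _ || X](_ : _ = false) ?orbF; last first.
        by apply/eqP => /(congr1 size); rewrite size_rcons.
      apply/open_segmentP; exists (a :: m1), v; split=> // z zm1.
      move: (mI z); rewrite mem_cat zm1 (in_larger IE) => /(_ isT).
      case: eqVneq => // zv; subst z; move: (step_uniq sq).
      by rewrite rcons_uniq zm1.
    exists q => //; apply: (@pts_inj L).
    by rewrite (pts_extend vI started_segment_walk x qM) qE wE' tE.
  have mJ : {subset m <= J}.
    move=> z zm; move: (mI z zm); rewrite (in_larger IE); case: eqVneq => // zv.
    by rewrite -zv zm in vm.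
  have [bv|bv] := eqVneq b v.
    subst b; right; exists (inord 1) => //; exists w; last first.
      apply: (@pts_inj L); rewrite /extend inord1 cats0 to_wordK //.
      exact: pts_sub.
    rewrite inE wE last_rcons eqxx andbT /started_segment.
    case: m wE sw mI bI vm mJ => [|a m] wE sw mI bI vm mJ; first by rewrite eqxx orbT.
    by apply/orP; left; apply/open_segmentP; exists (a :: m), v; split; rewrite -?wE.
  left; rewrite inE; apply/andP; split.
    apply/orP; left; apply/open_segmentP; exists m, b; split=> // m0.
    by move: (bI m0); rewrite (in_larger IE) (negPf bv).
  by rewrite wE mem_rcons inE negb_or eq_sym bv.
case=> [|[x _ [p pM ->]]].
  rewrite inE => /andP[/orP[/open_segmentP[m [b [wE sw mJ bJ]]]|/eqP->]]; last by rewrite inE eqxx.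
  move=> _; apply/open_segmentP; exists m, b; split=> // [z /mJ|/bJ]; exact: (subset_smaller IE).
rewrite (pts_extend vI started_segment_walk x pM); move: pM; rewrite inE => /andP[pJ /eqP pv].
have /andP[sp p0] := started_segment_walk pJ.
have pI := started_segment_arriving pJ pv.
have sx := sorted_cat_tail x sp pv.
case: (tail_cases v x) => [tE|[z tE]]; rewrite tE in sx *.
  rewrite cats0; case/lastP: (pts p) p0 sp pI => // m b _ sp pI; apply/open_segmentP.
  exists m, b; split=> // [z zm|_]; apply: pI; rewrite mem_rcons inE ?zm ?orbT //.
  by rewrite eqxx.
rewrite cats1 in sx *; apply/open_segmentP; exists (pts p), z; split=> //.
by move=> pp0; rewrite pp0 in p0.
Qed.

(** Unlike paths, segments start inside [I], so two different extensions of [p] are friendly along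
    [p] itself. This is why the three cells of [segment_cell] are disjoint. *)
Lemma friendly_self (p : seq point) (x y : nat) : p != [::] -> last z0 p = v ->
  {subset p <= I} -> (x < y <= 2)%N -> friendly_codes I (p ++ tail v x) (p ++ tail v y).
Proof.
move=> p0 pv pI /andP[xy y2]; exists p, [::], (tail v x), [::], (tail v y).
have x2 : (x <= 2)%N by rewrite (leq_trans (ltnW xy)).
split=> //; rewrite !out_code_tail //; split=> //; last exact: leq_ltn_trans xy.
by rewrite -ltnS (leq_trans xy).
Qed.

Lemma friend_self (p : word L) (x y : 'I_3) : p \in MS' -> x != y ->
  friend L I (pts (extend v x p)) (pts (extend v y p)).
Proof.
move=> pM xy; have [sp p0 pv _] := arriving_walk started_segment_walk pM.
have pI : {subset pts p <= I}.
  by move: pM; rewrite inE => /andP[h _]; apply: started_segment_arriving.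
have wE z := pts_extend vI started_segment_walk z pM.
have ws z : sorted step (pts (extend v z p)) by rewrite wE; apply: sorted_cat_tail.
apply/friendP; [exact: ws|exact: ws|exact: pts_sub|exact: pts_sub|].
rewrite !wE; move: xy; rewrite neq_ltn => /orP[lt|lt]; [left|right];
  by apply: friendly_self => //; rewrite lt ord3_le2.
Qed.

Definition segment_cell (P Q : {set word L}) (x : 'I_3) : {set word L} :=
  if x == 0%N :> nat then Q :\: P else if x == 1%N :> nat then P :&: Q else P :\: Q.

Lemma segment_sum_fiber (K : comNzRingType) (X : K) (A : point * point -> K) :
  segment_sum L X I A =
  \sum_(F in complex L started_segment J | F \subset BS' :|: MS')
     \prod_(w in F :&: BS') segment_weight X I A (pts w) *
     chain_poly (A (v, east v) - 1) (A (v, south v) - 1) X #|F :&: MS'|.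
Proof.
pose om (x : 'I_3) := if x == 0%N :> nat then A (v, south v) - 1
                      else if x == 1%N :> nat then X else A (v, east v) - 1.
apply: (@step_sum L J I v IE vJ eJ sJ vI _ _ (fun x : 'I_3 => true)
  started_segment_walk behead_started open_segment_split segment_cell _ _ _ _ _ K
  (fun w => segment_weight X I A (pts w)) om).
- by [].
- move=> P Q p; rewrite exists_ord3 /segment_cell inord1 /= !inE.
  by case: (p \in P); case: (p \in Q).
- move=> P Q p; rewrite exists_ord3 /segment_cell inord1 /= !inE.
  by case: (p \in P); case: (p \in Q).
- move=> P Q p x y pM; rewrite /segment_cell.
  case: (ord3_cases x) => ->; case: (ord3_cases y) => ->; rewrite ?inord1 ?eqxx //= !inE;
    by case: (p \in P); case: (p \in Q).
- move=> F x p FC pM _.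
  have no y z : y != z -> ~~ ((extend v y p \in F) && (extend v z p \in F)).
    move=> yz; apply/negP => /andP[yF zF]; have [_ nf] := complexP _ _ _ FC; move: (nf _ _ yF zF).
    rewrite friend_self //; case: eqP => [E|_ /(_ isT)] //.
    by have [/eqP] := extend_inj vI started_segment_walk pM pM E; rewrite (negPf yz).
  have n01 : (ord0 : 'I_3) != inord 1 by apply/eqP => /(congr1 val); rewrite /= inordK.
  have n12 : (inord 1 : 'I_3) != ord_max by apply/eqP => /(congr1 val); rewrite /= inordK.
  have := no ord0 ord_max isT; move: (no ord0 (inord 1) n01) (no (inord 1) ord_max n12).
  have eE : (p \in east_part v started_segment F) =
      (extend v (inord 1) p \in F) || (extend v ord_max p \in F).
    by rewrite inE pM exists_ord3 inord1.
  have sE : (p \in south_part v started_segment F) =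
      (extend v ord0 p \in F) || (extend v (inord 1) p \in F).
    by rewrite inE pM exists_ord3 inord1 /= orbF.
  rewrite /segment_cell; case: (ord3_cases x) => ->;
    rewrite ?inord1 /= ?(in_setD, in_setI) eE sE;
    case: (extend v ord0 p \in F); case: (extend v (inord 1) p \in F);
    by case: (extend v ord_max p \in F).
- move=> x w wM _; rewrite (pts_extend vI started_segment_walk) // /segment_weight /om.
  have [_ w0 wv _] := arriving_walk started_segment_walk wM.
  have tI k z : z \in tail v k -> z \in I = false.
    by move=> /(tail_notinI IE eJ sJ)/negbTE.
  case: (ord3_cases x) => ->; rewrite ?inord1 /=.
  + by rewrite last_edge_extend // cats1 last_rcons (tI 0%N) // mem_head.
  + by rewrite cats0 wv (in_larger IE) eqxx.
  by rewrite last_edge_extend // cats1 last_rcons (tI 2) // mem_head.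
move=> P Q; rewrite big_ord3 /om /segment_cell !inord1 /= /cut_weight /=.
by rewrite [RHS]mulrC mulrCA [RHS]mulrC [RHS]mulrAC [RHS]mulrC !mulrA.
Qed.

End SegmentStep.

(** * The two vertex steps compared *)

Section MainStep.
Variables (L : grid_shape) (J I : {fset point}) (v : point).
Hypotheses (IE : I = (v |` J)%fset) (vJ : v \notin J).
Hypotheses (eJ : east v \notin J) (sJ : south v \notin J).
Hypotheses (vI : interior L v).

Local Notation MS := (arriving L v (open_segment J)).
Local Notation BS := (avoiding L v (open_segment J)).
Local Notation MS' := (arriving L v (started_segment J v)).
Local Notation BS' := (avoiding L v (started_segment J v)).

Local Notation lazy_v := (to_word L [:: v]).

Lemma pts_lazy_v : pts lazy_v = [:: v].
Proof. by apply: to_wordK => // z; rewrite inE => /eqP->; case/and5P: vI. Qed.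

Lemma eq_lazy_v (w : word L) : (pts w == [:: v]) = (w == lazy_v).
Proof.
by apply/eqP/eqP => [E|->]; [apply: pts_inj; rewrite pts_lazy_v|exact: pts_lazy_v].
Qed.

Lemma lazy_v_notopen : ~~ open_segment J (pts lazy_v).
Proof. by rewrite pts_lazy_v /= andbT (negPf vJ). Qed.

Lemma avoiding_started : BS' = BS.
Proof.
apply/setP => w; rewrite !inE /started_segment; case: (eqVneq (pts w) [:: v]) => [->|_].
  by rewrite inE eqxx !andbF.
by rewrite orbF.
Qed.

Lemma arriving_started : MS' = lazy_v |: MS.
Proof.
apply/setP => w; rewrite !inE /started_segment eq_lazy_v orbC.
by case: eqVneq => [->|] //=; rewrite pts_lazy_v eqxx.
Qed.

Lemma open_segment_arriving (F : {set word L}) : F \in complex L (open_segment J) J ->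
  F \subset BS :|: MS.
Proof.
case/complexP => FJ _; apply/subsetP => w wF; have wJ := FJ w wF; rewrite !inE wJ /=.
case/open_segmentP: wJ => m [b [-> sw mJ _]]; rewrite last_rcons mem_rcons inE negb_or eq_sym.
case: eqVneq => //= bv; rewrite orbF.
by apply/negP => /mJ; rewrite (negPf vJ).
Qed.

Lemma not_friend_lazy_v (w : word L) : ~~ friend L J (pts lazy_v) (pts w).
Proof.
apply/existsP => -[u /and3P[u0 /allP uJ]]; rewrite pts_lazy_v => fr.
suff /mem_infix uv : infix (pts u) [:: v].
  case: (pts u) u0 uJ uv => // z s _ uJ /(_ z (mem_head _ _)).
  by rewrite inE => /eqP zv; move: (uJ z (mem_head _ _)); rewrite /= zv (negPf vJ).
case/orP: fr => /and4P[h1 h2 h3 h4]; [move: h1|move: h3] => /orP[/prefixW // |];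
  by case: (pts u) u0 => // z s _ /consl_infix.
Qed.

Lemma started_complex (F : {set word L}) : lazy_v \notin F ->
  (F \in complex L (started_segment J v) J) = (F \in complex L (open_segment J) J).
Proof.
move=> lF; apply/complexP/complexP => -[h1 h2]; split=> // w wF; last first.
  by rewrite /started_segment h1.
by case/orP: (h1 w wF) => //; rewrite eq_lazy_v => /eqP wl; rewrite -wl wF in lF.
Qed.

Lemma lazy_complex (F : {set word L}) :
  (lazy_v |: F \in complex L (started_segment J v) J) =
  (F \in complex L (started_segment J v) J).
Proof.
apply/idP/idP; first by apply: sub_complex; apply: subsetUr.
case/complexP => h1 h2; apply/complexP; split.
  by move=> w /setU1P[->|/h1 //]; rewrite /started_segment pts_lazy_v eqxx orbT.
move=> p q /setU1P[->|pF] /setU1P[->|qF] pq; try exact: not_friend_lazy_v.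
  by rewrite friend_sym not_friend_lazy_v.
exact: h2.
Qed.

(** The lazy segment at [v] has no vertex in [J], so it may be added to every face for [J]. The two
    terms are the faces without and with it, the chain being one longer in the second. *)
Lemma segment_sum_chain (K : comNzRingType) (X : K) (A : point * point -> K) :
  let N := chain_poly (A (v, east v) - 1) (A (v, south v) - 1) X in
  segment_sum L X I A =
  \sum_(F in complex L (open_segment J) J)
    \prod_(w in F :&: BS) segment_weight X I A (pts w) * (N #|F :&: MS| + N #|F :&: MS|.+1).
Proof.
move=> N; rewrite (segment_sum_fiber IE vJ eJ sJ vI) avoiding_started arriving_started.
have lB : lazy_v \notin BS by rewrite inE pts_lazy_v mem_head andbF.
have lM : lazy_v \notin MS by rewrite inE (negPf lazy_v_notopen).
rewrite (bigID (fun F : {set word L} => lazy_v \in F)) /= addrC.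
have C1 (F : {set word L}) :
    (F \in complex L (started_segment J v) J) && (F \subset BS :|: (lazy_v |: MS)) &&
      (lazy_v \notin F) = (F \in complex L (open_segment J) J).
  have [lF|lF] := boolP (lazy_v \in F); rewrite ?andbF ?andbT.
    apply/esym/negbTE/negP => /complexP[/(_ _ lF)].
    by rewrite (negPf lazy_v_notopen).
  rewrite started_complex //; apply/andb_idr => /open_segment_arriving FBM.
  by apply: subset_trans FBM _; rewrite setUS // subsetUr.
rewrite (eq_bigl _ _ C1).
have FM (F : {set word L}) : lazy_v \notin F -> F :&: (lazy_v |: MS) = F :&: MS.
  move=> lF; apply/setP => w; rewrite !in_setI in_setU1; case: eqVneq => //= ->.
  by rewrite (negPf lF).
have lF (F : {set word L}) : F \in complex L (open_segment J) J -> lazy_v \notin F.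
  by case/complexP => FJ _; apply: contra lazy_v_notopen => /FJ.
rewrite (eq_bigr (fun F => \prod_(w in F :&: BS) segment_weight X I A (pts w) * N #|F :&: MS|));
  last by move=> F /lF/FM->.
under [RHS]eq_bigr do rewrite mulrDr.
rewrite [RHS]big_split /=; congr (_ + _).
rewrite (reindex_onto (fun F => lazy_v |: F) (fun F => F :\ lazy_v)) /=; last first.
  by move=> F /andP[_ ?]; rewrite setD1K.
apply: eq_big => F.
  rewrite setU11 andbT; apply/idP/idP.
    case/andP => /andP[+ _] /eqP FE; rewrite lazy_complex started_complex //.
    by rewrite -FE !inE eqxx.
  move=> FC; have lFF := lF F FC; rewrite setU1K // eqxx andbT lazy_complex started_complex // FC /=.
  have := open_segment_arriving FC; rewrite subUset sub1set !inE eqxx orbT /=.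
  by move=> FBM; apply: subset_trans FBM _; rewrite setUS // subsetUr.
case/andP => _ /eqP FE; have lFF : lazy_v \notin F by rewrite -FE !inE eqxx.
have -> : (lazy_v |: F) :&: BS = F :&: BS.
  apply/setP => w; rewrite !in_setI in_setU1; case: eqVneq => //= ->.
  by rewrite (negPf lB) andbF.
have -> : (lazy_v |: F) :&: (lazy_v |: MS) = lazy_v |: (F :&: MS) by rewrite setUIr.
by rewrite cardsU1 in_setI (negPf lFF).
Qed.

(** A segment arriving at [v] ends outside [J], hence weighs ['X - 1]: this gives the power of
    ['X - 1] in [chain_functional_substitution]. *)
Lemma segment_sum_arrival (K : comNzRingType) (X : K) (A : point * point -> K) :
  segment_sum L X%:P J (arrival_weight v A) =
  \sum_(F in complex L (open_segment J) J)
    (\prod_(w in F :&: BS) segment_weight X I A (pts w))%:P * ('X - 1) ^+ #|F :&: MS|.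
Proof.
apply: eq_bigr => F FC.
rewrite (prod_avoiding_arriving _ (@open_segment_walk J v) (open_segment_arriving FC)).
congr (_ * _).
  rewrite rmorph_prod; apply: eq_bigr => w; rewrite in_setI inE => /and3P[_ wJ vw].
  have /andP[_ w0] := open_segment_walk v wJ.
  rewrite /segment_weight (in_larger IE).
  have lv : last z0 (pts w) != v by apply: contraNneq vw => <-; apply: last_mem.
  rewrite (negPf lv) /=; case: ifP => // _.
  rewrite /arrival_weight last_edge2 (negPf lv) rmorphB rmorph1 /=.
  by case: eqP => // E; move: vw; rewrite -E last_edge_mem.
rewrite (eq_bigr (fun=> 'X - 1)) ?prodr_const // => w.
rewrite in_setI inE => /and3P[_ _ /eqP wv].
by rewrite /segment_weight wv (negPf vJ) /arrival_weight last_edge2 wv eqxx.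
Qed.

Lemma edge_wordP (K : {fset point}) (w : word L) : w \in edges L K <->
  exists a b, [/\ pts w = [:: a; b], step a b & b \notin K].
Proof.
rewrite inE; split.
  case/andP => /full_pathP[a [m [b [wE sw _ _ m0]]]] lK.
  case: m wE sw m0 => [|z m] wE sw m0; last by have := m0 z (mem_head _ _); rewrite in_fset0.
  by exists a, b; move: sw lK; rewrite wE /= andbT.
case=> a [b [wE ab bK]]; rewrite wE; apply/andP; split=> //; apply/full_pathP.
by exists a, [::], b; split; rewrite ?in_fset0 //= ab.
Qed.

Lemma edge_word_ex (a b : point) : step a b -> a \in L -> b \in L ->
  pts (to_word L [:: a; b]) = [:: a; b].
Proof.
move=> ab aL bL; apply: to_wordK; rewrite /= ?ab // => z.
by rewrite !inE => /orP[]/eqP->.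
Qed.

Local Notation c_weight u A := (\prod_(w in edges L I | (last_edge (pts w)).1 != v)
   (1 + u * A (last_edge (pts w)))).

Lemma edge_product_out (K : comNzRingType) (u : K) (A : point * point -> K) :
  \prod_(w in edges L I) (1 + u * A (last_edge (pts w))) =
  c_weight u A * ((1 + u * A (v, east v)) * (1 + u * A (v, south v))).
Proof.
case/and5P: (vI) => vL _ sL eL _.
have sE : step v (east v) by rewrite /step eqxx orbT.
have sS : step v (south v) by rewrite /step eqxx.
pose we := to_word L [:: v; east v]; pose ws := to_word L [:: v; south v].
have weE : pts we = [:: v; east v] by apply: edge_word_ex.
have wsE : pts ws = [:: v; south v] by apply: edge_word_ex.
have eI : east v \notin I by rewrite (in_larger IE) negb_or (step_neq sE) eJ.
have sI : south v \notin I by rewrite (in_larger IE) negb_or (step_neq sS) sJ.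
rewrite (bigID (fun w : word L => (last_edge (pts w)).1 != v)) /=; congr (_ * _).
have wes : ws != we.
  apply: contraNneq (south_neq_east v) => E; move: wsE.
  by rewrite E weE => /(congr1 (last z0)) /= ->.
rewrite (bigD1 we) /=; last first.
  rewrite negbK weE /last_edge /= eqxx andbT; apply/edge_wordP.
  by exists v, (east v).
rewrite (bigD1 ws) /=; last first.
  rewrite wes negbK wsE /last_edge /= eqxx !andbT; apply/edge_wordP.
  by exists v, (south v).
rewrite big1 ?mulr1 ?weE ?wsE // => w /andP[/andP[/andP[wI]]].
rewrite negbK => wv nwe nws; case/edge_wordP: wI wv => a [b [wE ab bI]].
rewrite wE /last_edge /= => /eqP av; subst a; case/orP: ab => /eqP bE; subst b.
  by case/eqP: nws; apply: pts_inj; rewrite wsE.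
by case/eqP: nwe; apply: pts_inj; rewrite weE.
Qed.

(** Compared with [edges L I], the set [edges L J] has in addition the two edges into [v], each of
    weight ['X]; the edges out of [v] have weight 0 and contribute the factor 1. *)
Lemma edge_product_in (K : comNzRingType) (u : K) (A : point * point -> K) :
  \prod_(w in edges L J) (1 + u%:P * arrival_weight v A (last_edge (pts w))) =
  (c_weight u A)%:P * (1 + u *: 'X) ^+ 2.
Proof.
case/and5P: (vI) => vL nL _ _ wL.
have sW : step (west v) v by rewrite stepE eqxx orbT.
have sN : step (north v) v by rewrite stepE eqxx.
pose ww := to_word L [:: west v; v]; pose wn := to_word L [:: north v; v].
have wwE : pts ww = [:: west v; v] by apply: edge_word_ex.
have wnE : pts wn = [:: north v; v] by apply: edge_word_ex.
rewrite (bigID (mem (edges L I))) /=; congr (_ * _).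
  rewrite rmorph_prod [RHS]big_mkcondr /=.
  rewrite (eq_bigl (mem (edges L I))) /=; last first.
    move=> w; apply: andb_idl => /edge_wordP[a [b [wE ab]]].
    rewrite (in_larger IE) negb_or => /andP[_ bJ]; apply/edge_wordP; by exists a, b.
  apply: eq_bigr => w /edge_wordP[a [b [wE ab]]]; rewrite (in_larger IE) negb_or => /andP[bv _].
  rewrite /arrival_weight wE /last_edge /= (negPf bv); case: eqVneq => /= _.
    by rewrite mulr0 addr0.
  by rewrite polyCD polyCM.
have nwn : wn != ww.
  apply: contraNneq (north_neq_west v) => E; move: wnE.
  by rewrite E wwE => /(congr1 (head z0)) /= ->.
rewrite (bigD1 ww) /=; last first.
  apply/andP; split; first by apply/edge_wordP; exists (west v), v.
  by apply/negP => /edge_wordP[a [b []]]; rewrite wwE => -[_ <-]; rewrite (in_larger IE) eqxx.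
rewrite (bigD1 wn) /=; last first.
  rewrite nwn andbT; apply/andP; split; first by apply/edge_wordP; exists (north v), v.
  by apply/negP => /edge_wordP[a [b []]]; rewrite wnE => -[_ <-]; rewrite (in_larger IE) eqxx.
rewrite big1 ?mulr1; last first.
  move=> w /andP[/andP[/andP[/edge_wordP[a [b [wE ab bJ]]] wI] nww] nwn'].
  have [bv|bv] := eqVneq b v; last first.
    by case/negP: wI; apply/edge_wordP; exists a, b; split; rewrite // (in_larger IE) negb_or bv.
  subst b; move: ab; rewrite stepE => /orP[]/eqP aE; subst a.
    by case/eqP: nwn'; apply: pts_inj; rewrite wnE.
  by case/eqP: nww; apply: pts_inj; rewrite wwE.
by rewrite /arrival_weight wwE wnE /last_edge /= eqxx mul_polyC expr2.
Qed.

End MainStep.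

(** * The identity without initial paths *)

Section MainIdentity.
Variable L : grid_shape.

Lemma friend_fset0 (p q : seq point) : friend L fset0 p q = false.
Proof.
apply/negbTE/existsP => -[u /and3P[u0 /allP uI _]].
by case: (pts u) u0 uI => // z s _ /(_ z (mem_head _ _)); rewrite /= in_fset0.
Qed.

Lemma path_sum_fset0 (K : comNzRingType) (u : K) (A : point * point -> K) :
  path_sum L u fset0 A = \prod_(w in edges L fset0) (1 + u * A (last_edge (pts w))).
Proof.
rewrite -subset_prod; apply: eq_bigl => F; apply/complexP/subsetP => [[FP _] w wF|FE].
  rewrite inE FP //=; exact: in_fset0.
split=> [w /FE|p q _ _ _]; first by rewrite inE => /andP[].
by rewrite friend_fset0.
Qed.

Lemma segment_sum_fset0 (K : comNzRingType) (X : K) (A : point * point -> K) :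
  segment_sum L X fset0 A = 1.
Proof.
rewrite /segment_sum (big_pred1 set0) ?big_set0 // => F /=.
apply/complexP/eqP => [[FP _]|->]; last by split=> [w|p q]; rewrite inE.
apply/setP => w; rewrite in_set0; apply/negbTE/negP => /FP.
case: (pts w) => // a p /and3P[_ aI _].
by rewrite in_fset0 in aI.
Qed.

(** South and East steps increase the difference of the coordinates, so a vertex of [I] that
    maximises it will do. *)
Lemma southeast_vertex_ex (I : {fset point}) : I != fset0 ->
  exists2 v, v \in I & (east v \notin I) && (south v \notin I).
Proof.
case/fset0Pn => v0 v0I.
pose v := val [arg max_(w > [` v0I]%fset) ((val w).1 - (val w).2)]%O.
have vmax w : w \in I -> w.1 - w.2 <= v.1 - v.2.
  move=> wI; rewrite /v; case: arg_maxP => // i _ /(_ [` wI]%fset); exact.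
exists v; first exact: valP.
by apply/andP; split; apply/negP => /vmax; rewrite /east /south /=; lia.
Qed.

(* The vertices of [I] are removed one at a time, in an order such that the
   walks arriving at the removed vertex can only leave [I] from there; the ring
   varies in the induction, as its edges become polynomial variables. *)
Lemma path_sum_segment_sum (I : {fset point}) :
  {in I, forall z, interior L z} ->
  forall (K : comNzRingType) (u X : K) (A : point * point -> K), X * u = 1 + u ->
  path_sum L u I A =
  u ^+ #|` I| * \prod_(w in edges L I) (1 + u * A (last_edge (pts w))) * segment_sum L X I A.
Proof.
move: {2}#|` I| (erefl #|` I|) => n; elim: n I => [|n IH] I In Iint K u X A Xu.
  have -> : I = fset0 by apply/cardfs0_eq.
  by rewrite path_sum_fset0 segment_sum_fset0 cardfs0 expr0 mul1r mulr1.
have [|v vI /andP[eI sI]] := @southeast_vertex_ex I.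
  by apply: contra_eq_neq In => ->; rewrite cardfs0.
pose J := (I `\ v)%fset.
have IE : I = (v |` J)%fset by rewrite fsetD1K.
have vJ : v \notin J by rewrite in_fsetD1 eqxx.
have eJ : east v \notin J by rewrite in_fsetD1 negb_and eI orbT.
have sJ : south v \notin J by rewrite in_fsetD1 negb_and sI orbT.
have vint := Iint v vI.
have Jn : #|` J| = n by move: In; rewrite (cardfsD1 v) vI => -[].
have Jint : {in J, forall z, interior L z} by move=> z /fsetD1P[_ /Iint].
have XuP : X%:P * u%:P = 1 + u%:P by rewrite -polyCM Xu polyCD.
rewrite (path_sum_step IE vJ eJ sJ vint) (IH J Jn Jint _ _ _ _ XuP).
rewrite (edge_product_in IE vJ vint) (edge_product_out IE eJ sJ vint) Jn In.
rewrite (segment_sum_arrival L IE vJ) (segment_sum_chain IE vJ eJ sJ vint).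
set c := \prod_(w in _ | _) _; set B := avoiding _ _ _; set M := arriving _ _ _.
have polyE (W S : {poly K}) : u%:P ^+ n * (c%:P * W) * S = (u ^+ n * c) *: (W * S).
  by rewrite -mul_polyC polyCM polyC_exp !mulrA.
rewrite polyE linearZ /= [X in chain_functional _ _ _ X]mulr_sumr linear_sum !mulr_sumr /=.
(* Both sides are now sums over the faces for [J], and they agree face by face. *)
apply: eq_bigr => F _; rewrite mulrCA mul_polyC linearZ /= (chain_functional_substitution _ _ _ Xu) /=.
by rewrite exprS; move: (chain_poly _ _ _ _) (_ ^+ #|_|) (\prod_(w in _) _) => k b f; ring.
Qed.

End MainIdentity.

(** * Straight paths and their last edges *)

Section Straight.
Implicit Types (p q u : seq point) (I : {fset point}).

Definition straight p := horizontal p || vertical p.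

Definition reduced_path I p := full_path I p && ~~ straight p.

Lemma full_path_inner I p u p1 p2 : full_path I p -> u != [::] -> {subset u <= I} ->
  p = p1 ++ u ++ p2 -> p1 != [::] /\ p2 != [::].
Proof.
case/full_pathP => a [m [b [-> _ aI bI _]]] u0 uI E; split.
  apply: contraTneq isT => p10; move: E; rewrite p10; case: (u) u0 uI => // z u' _ uI [az _].
  by rewrite az uI ?mem_head in aI.
apply: contraTneq isT => p20; move: E; rewrite p20 cats0 -rcons_cons.
case/lastP: (u) u0 uI => // u' z _ uI; rewrite -rcons_cat => /rcons_inj[_ bz].
by rewrite bz uI ?mem_rcons ?mem_head in bI.
Qed.

Lemma horizontal_codes p1 u p2 : u != [::] -> horizontal (p1 ++ u ++ p2) ->
  (p1 != [::] -> in_code p1 u = 2) /\ (p2 != [::] -> out_code u p2 = 2).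
Proof.
rewrite /horizontal => u0 hp; split.
  move=> p10; rewrite /in_code (negPf p10); case/lastP: p1 p10 hp => // r y _.
  case: u u0 => // z u _; rewrite cat_rcons => /cat_sorted2[_] /= /andP[/eqP-> _].
  by rewrite last_rcons -east_west eqxx.
move=> p20; rewrite /out_code (negPf p20); case: p2 p20 hp => // y r _.
case/lastP: u u0 => // u z _ /cat_sorted2[_]; rewrite cat_rcons => /cat_sorted2[_] /= /andP[/eqP-> _].
by rewrite last_rcons eq_sym (negPf (south_neq_east z)).
Qed.

Lemma vertical_codes p1 u p2 : u != [::] -> vertical (p1 ++ u ++ p2) ->
  (p1 != [::] -> in_code p1 u = 0%N) /\ (p2 != [::] -> out_code u p2 = 0%N).
Proof.
rewrite /vertical => u0 hp; split.
  move=> p10; rewrite /in_code (negPf p10); case/lastP: p1 p10 hp => // r y _.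
  case: u u0 => // z u _; rewrite cat_rcons => /cat_sorted2[_] /= /andP[+ _].
  by rewrite south_north last_rcons => /eqP->; rewrite (negPf (north_neq_west z)).
move=> p20; rewrite /out_code (negPf p20); case: p2 p20 hp => // y r _.
case/lastP: u u0 => // u z _ /cat_sorted2[_]; rewrite cat_rcons => /cat_sorted2[_] /= /andP[/eqP-> _].
by rewrite last_rcons eqxx.
Qed.

(** Friendliness asks for codes on opposite sides of 1 on entering and on leaving, while an inner
    part of a horizontal path has code 2 twice and one of a vertical path has code 0 twice. *)
Lemma straight_not_friendly I p q : full_path I p -> straight p ->
  ~ friendly_codes I p q /\ ~ friendly_codes I q p.
Proof.
move=> pI sp; split.
  case=> u [p1 [p2 [q1 [q2 [u0 uI pE _ [h1 h2 _ _]]]]]].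
  have [p10 p20] := full_path_inner pI u0 uI pE; rewrite pE in sp.
  case/orP: sp => [/(horizontal_codes u0)|/(vertical_codes u0)] [c1 c2].
    by rewrite (c2 p20) in h2.
  by rewrite (c1 p10) in h1.
case=> u [q1 [q2 [p1 [p2 [u0 uI _ pE [_ _ h1 h2]]]]]].
have [p10 p20] := full_path_inner pI u0 uI pE; rewrite pE in sp.
case/orP: sp => [/(horizontal_codes u0)|/(vertical_codes u0)] [c1 c2].
  by rewrite (c1 p10) in h1.
by rewrite (c2 p20) in h2.
Qed.

Lemma horizontal_vertical_edge p1 a b : horizontal (p1 ++ [:: a; b]) ->
  vertical (p1 ++ [:: a; b]) -> False.
Proof.
move=> /cat_sorted2[_] /= /andP[/eqP-> _] /cat_sorted2[_] /= /andP[/eqP E _].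
by move/eqP: (south_neq_east a); rewrite E.
Qed.

Lemma full_path_last_edge I p : full_path I p -> exists p1, p = p1 ++ [:: (last_edge p).1; (last_edge p).2].
Proof.
case/full_pathP => a [m [b [-> _ _ _ _]]]; rewrite -rcons_cons last_edge_rcons //.
by case/lastP: m => [|m c] /=; [exists [::]|exists (a :: m); rewrite last_rcons -!cats1 /= -catA].
Qed.

(** The start of [p] is outside [I], so it cannot be an inner vertex of [q]. *)
Lemma full_path_proper_suffix I p q u q1 : full_path I p -> full_path I q ->
  p = u -> q = q1 ++ u -> q1 = [::].
Proof.
move=> /full_pathP[a [m [b [pE _ aI _ _]]]] /full_pathP[a' [m' [b' [qE _ _ _ mI]]]] <-.
rewrite qE pE; case: q1 => // z q1 [_] E.
have : a \in m'; last by move/mI; rewrite (negPf aI).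
have : rcons m' b' = rcons (q1 ++ a :: m) b by rewrite rcons_cat rcons_cons.
by case/rcons_inj => -> _; rewrite mem_cat mem_head orbT.
Qed.

(** The last edge tells the direction. Two different paths enter some common suffix with different
    codes; if both are straight in the same direction, one of them must start there, against
    [full_path_proper_suffix]. *)
Lemma straight_inj I p q : full_path I p -> full_path I q -> straight p -> straight q ->
  last_edge p = last_edge q -> p = q.
Proof.
move=> pI qI sp sq pq.
have [p0 wp] : p != [::] /\ sorted step p by case/full_pathP: pI => a [m [b [-> ? _ _ _]]].
have [q0 wq] : q != [::] /\ sorted step q by case/full_pathP: qI => a [m [b [-> ? _ _ _]]].
have lpq : last z0 p = last z0 q by rewrite -!last_edge2 pq.
have main p' q' : full_path I p' -> full_path I q' -> p' != [::] -> q' != [::] ->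
    sorted step p' -> sorted step q' -> last z0 p' = last z0 q' -> 
    (horizontal p' /\ horizontal q' \/ vertical p' /\ vertical q') -> (key p' < key q')%O -> False.
  move=> p'I q'I p'0 q'0 wp' wq' lE hv.
  case/(key_ltP p'0 q'0 wp' wq' lE erefl) => u [p1 [q1 [u0 pE qE lt]]].
  have [p10|p10] := eqVneq p1 [::].
    have q10 : q1 = [::] by apply: (full_path_proper_suffix p'I q'I _ qE); rewrite pE p10.
    by rewrite p10 q10 ltnn in lt.
  have [q10|q10] := eqVneq q1 [::].
    have : p1 = [::]; last by move/eqP; rewrite (negPf p10).
    by apply: (full_path_proper_suffix q'I p'I _ pE); rewrite qE q10.
  have pE' : p' = p1 ++ u ++ [::] by rewrite cats0.
  have qE' : q' = q1 ++ u ++ [::] by rewrite cats0.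
  rewrite pE' qE' in hv; case: hv => -[h h'].
    have [c1 _] := horizontal_codes u0 h; have [c2 _] := horizontal_codes u0 h'.
    by rewrite (c1 p10) (c2 q10) in lt.
  have [c1 _] := vertical_codes u0 h; have [c2 _] := vertical_codes u0 h'.
  by rewrite (c1 p10) (c2 q10) in lt.
have hv : horizontal p /\ horizontal q \/ vertical p /\ vertical q.
  have [p1 pE] := full_path_last_edge pI; have [q1 qE] := full_path_last_edge qI.
  rewrite pq in pE; case/orP: sp => hp; case/orP: sq => hq; [by left| | |by right].
    case: (@horizontal_vertical_edge [::] (last_edge q).1 (last_edge q).2).
      by rewrite pE in hp; exact: (cat_sorted2 hp).2.
    by rewrite qE in hq; exact: (cat_sorted2 hq).2.
  case: (@horizontal_vertical_edge [::] (last_edge q).1 (last_edge q).2).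
    by rewrite qE in hq; exact: (cat_sorted2 hq).2.
  by rewrite pE in hp; exact: (cat_sorted2 hp).2.
apply: (key_inj p0 q0 wp wq lpq erefl); case: (ltgtP (key p) (key q)) => // lt.
  by case: (main p q).
by case: (main q p) => //; case: hv => -[? ?]; [left|right].
Qed.

End Straight.

(** * Horizontal and vertical paths *)

Section Runs.
Variables (f : point -> point) (I : {fset point}).
Hypothesis f_free : forall a, injective (fun k => iter k f a).

(** A bounded search is enough: the iterates are distinct, so one more of them than [I] has points
    cannot all lie in [I]. *)
Definition exit_time (a : point) : nat :=
  find (fun k => iter k f a \notin I) (iota 0 #|` I|.+1).

(* The straight line from [a] in direction [f], up to its first point outside
   [I] included; it is just [a] when [a \notin I]. *)
Definition run (a : point) : seq point := traject f a (exit_time a).+1.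

Lemma exit_timeP a : iter (exit_time a) f a \notin I /\
  forall j, (j < exit_time a)%N -> iter j f a \in I.
Proof.
have ex : has (fun k => iter k f a \notin I) (iota 0 #|` I|.+1).
  rewrite -[has _ _]negbK -all_predC; apply/negP => /allP in_larger.
  have : (size (mkseq (fun k => iter k f a) #|` I|.+1) <= #|` I|)%N.
    apply: uniq_leq_size; first by apply: mkseq_uniq; apply: f_free.
    by move=> z /mapP[k ki ->]; move: (in_larger k ki); rewrite /= negbK.
  by rewrite size_mkseq ltnn.
have kE := nth_find 0%N ex; move: (ex); rewrite has_find size_iota => kn.
rewrite nth_iota // in kE; split=> // j jk.
have := before_find 0%N jk; rewrite nth_iota ?add0n; last exact: ltn_trans jk kn.
by move/negbT; rewrite negbK.
Qed.

Lemma run_rcons a : run a = rcons (traject f a (exit_time a)) (iter (exit_time a) f a).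
Proof. exact: trajectSr. Qed.

Lemma run_inner a : {subset traject f a (exit_time a) <= I}.
Proof. by move=> z /trajectP[j jk ->]; apply: (exit_timeP a).2. Qed.

Lemma run_exit a : iter (exit_time a) f a \notin I.
Proof. exact: (exit_timeP a).1. Qed.

Lemma run_outside a : a \notin I -> run a = [:: a].
Proof.
move=> aI; rewrite /run; case: (posnP (exit_time a)) => [->|] //.
by move/(exit_timeP a).2; rewrite /= (negPf aI).
Qed.

Lemma run_fpath a : fpath f a (behead (run a)).
Proof. exact: fpath_traject. Qed.

Lemma run_sub (L : grid_shape) a : {in I, forall z, (z \in L) && (f z \in L)} -> a \in L ->
  {subset run a <= L}.
Proof.
move=> IL aL z /trajectP[[|j] jk ->] //=.
by case/andP: (IL _ ((exit_timeP a).2 _ jk)).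
Qed.

End Runs.

Lemma iter_west k a : iter k west a = (a.1 - k%:Z, a.2).
Proof.
by case: a => x y; elim: k => [|k IH]; rewrite ?iterS ?IH /west /=; congr pair; lia.
Qed.

Lemma iter_north k a : iter k north a = (a.1, a.2 + k%:Z).
Proof.
by case: a => x y; elim: k => [|k IH]; rewrite ?iterS ?IH /north /=; congr pair; lia.
Qed.

Lemma iter_south k a : iter k south a = (a.1, a.2 - k%:Z).
Proof.
by case: a => x y; elim: k => [|k IH]; rewrite ?iterS ?IH /south /=; congr pair; lia.
Qed.

Lemma west_free a : injective (fun k => iter k west a).
Proof. by move=> j k; rewrite !iter_west => -[]; lia. Qed.

Lemma north_free a : injective (fun k => iter k north a).
Proof. by move=> j k; rewrite !iter_north => -[]; lia. Qed.

Lemma south_free a : injective (fun k => iter k south a).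
Proof. by move=> j k; rewrite !iter_south => -[]; lia. Qed.

Lemma horizontal_sorted p : horizontal p -> sorted step p.
Proof. by apply: sub_sorted => v w; rewrite /step orbC => ->. Qed.

Lemma vertical_sorted p : vertical p -> sorted step p.
Proof. by apply: sub_sorted => v w; rewrite /step => ->. Qed.

Lemma horizontal_rev_run I a p : horizontal (a :: p) -> horizontal (rev (run west I a) ++ p).
Proof.
move=> hp; rewrite /run /= rev_cons cat_rcons.
move: (exit_time west I a) => k; elim: k a p hp => //= k IH a p hp.
rewrite rev_cons cat_rcons; apply: IH => /=.
by rewrite hp andbT east_west.
Qed.

Lemma vertical_rev_run I a p : vertical (a :: p) -> vertical (rev (run north I a) ++ p).
Proof.
move=> hp; rewrite /run /= rev_cons cat_rcons.
move: (exit_time north I a) => k; elim: k a p hp => //= k IH a p hp.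
rewrite rev_cons cat_rcons; apply: IH => /=.
by rewrite hp andbT south_north.
Qed.

Section Lines.
Variables (L : grid_shape) (I : {fset point}).
Hypothesis I_interior : {in I, forall z, interior L z}.

Definition lines : {set word L} := [set w | full_path I (pts w) && straight (pts w)].

Lemma interior_in z : z \in I ->
  [/\ z \in L, north z \in L, south z \in L, east z \in L & west z \in L].
Proof. by move/I_interior/and5P. Qed.

Lemma full_path_rev_run (f : point -> point) a b :
  (forall a, injective (fun k => iter k f a)) ->
  sorted step (rev (run f I a) ++ [:: b]) -> b \notin I ->
  full_path I (rev (run f I a) ++ [:: b]).
Proof.
move=> free sp bI; apply/full_pathP.
exists (iter (exit_time f I a) f a), (rev (traject f a (exit_time f I a))), b.
split=> //; first by rewrite run_rcons rev_rcons cats1.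
  exact: run_exit.
by move=> z; rewrite mem_rev; apply: run_inner.
Qed.

(** A straight path is determined by its last edge, and an edge ending outside [I] is prolonged
    straight backwards until it leaves [I]. So the straight paths account for exactly the product
    over the edges at [A = 1]. *)
Lemma card_lines : #|lines| = #|edges L I|.
Proof.
pose f (w : word L) := to_word L [:: (last_edge (pts w)).1; (last_edge (pts w)).2].
have fE (w : word L) : full_path I (pts w) ->
    pts (f w) = [:: (last_edge (pts w)).1; (last_edge (pts w)).2].
  move=> wI; have sw : sorted step (pts w) by case/full_pathP: wI => ? [? [? []]].
  rewrite /f; have [p1] := full_path_last_edge wI.
  case: (last_edge (pts w)) => a b /= wE.
  apply: to_wordK; first by move: sw; rewrite wE => /cat_sorted2[].
  by move=> z zw; apply: (@pts_sub L w); rewrite wE mem_cat zw orbT.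
have finj : {in lines &, injective f}.
  move=> w w'; rewrite !inE => /andP[wI ws] /andP[w'I w's] E.
  apply: pts_inj; apply: (straight_inj wI w'I ws w's).
  have := congr1 (@pts L) E; rewrite !fE // => -[E1 E2].
  by rewrite /last_edge E1 E2.
rewrite -(card_in_imset finj); apply/eq_card => e; apply/imsetP/idP.
  case=> w; rewrite inE => /andP[wI ws] ->; apply/edge_wordP.
  have [p1 wE] := full_path_last_edge wI.
  exists (last_edge (pts w)).1, (last_edge (pts w)).2; split; first exact: fE.
    have : sorted step (pts w) by case/full_pathP: wI => ? [? [? []]].
    by rewrite {1}wE => /cat_sorted2[_] /= /andP[].
  by case/full_pathP: wI => a [m [b [-> _ _ bI _]]]; rewrite last_edge2 /= last_rcons.
case/edge_wordP => a [b [eE ab bI]].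
have [aL bL] : a \in L /\ b \in L.
  by split; apply: (@pts_sub L e); rewrite eE !inE eqxx ?orbT.
have [g [g_free gL gs ss]] : exists g, [/\ forall a, injective (fun k => iter k g a),
    {in I, forall z, (z \in L) && (g z \in L)},
    straight (rev (run g I a) ++ [:: b]) & sorted step (rev (run g I a) ++ [:: b])].
  case/orP: ab => /eqP bE.
    exists north; have vp : vertical (rev (run north I a) ++ [:: b]).
      by apply: vertical_rev_run; rewrite /= bE eqxx.
    split; [exact: north_free| |by rewrite /straight vp orbT|exact: vertical_sorted].
    by move=> z /interior_in[-> -> _ _ _].
  exists west; have hp : horizontal (rev (run west I a) ++ [:: b]).
    by apply: horizontal_rev_run; rewrite /= bE eqxx.
  split; [exact: west_free| |by rewrite /straight hp|exact: horizontal_sorted].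
  by move=> z /interior_in[-> _ _ _ ->].
have [w wE] : exists w : word L, pts w = rev (run g I a) ++ [:: b].
  apply: word_ex => // z; rewrite mem_cat mem_rev mem_seq1 => /orP[|/eqP->] //.
  exact: run_sub.
have wI : full_path I (pts w) by rewrite wE; apply: full_path_rev_run.
exists w; first by rewrite inE wI wE.
apply: pts_inj; rewrite fE // eE wE cats1 last_edge_rcons; last first.
  by rewrite -size_eq0 size_rev.
by rewrite /run /= rev_cons last_rcons.
Qed.

Lemma full_path_complex_split (K : comNzRingType) (u : K) :
  \sum_(F in complex L (full_path I) I) u ^+ #|F| =
  (1 + u) ^+ #|lines| * \sum_(F in complex L (reduced_path I) I) u ^+ #|F|.
Proof.
have not_line (w w' : word L) : w \in lines -> full_path I (pts w') ->
    ~~ friend L I (pts w) (pts w').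
  rewrite inE => /andP[wI ws] w'I; have [n1 n2] := straight_not_friendly (pts w') wI ws.
  have sw : sorted step (pts w) by case/full_pathP: wI => ? [? [? []]].
  have sw' : sorted step (pts w') by case/full_pathP: w'I => ? [? [? []]].
  by apply/negP => /friendP-/(_ sw sw' (@pts_sub L w) (@pts_sub L w'))[].
rewrite mulr_sumr (partition_big (fun F => F :\: lines) (mem (complex L (reduced_path I) I))) /=.
  apply: eq_bigr => F0 F0C; have [F0r F0f] := complexP _ _ _ F0C.
  have F0l : F0 :&: lines = set0.
    apply/setP => w; rewrite in_setI in_set0; apply/negbTE/negP => /andP[/F0r].
    by rewrite inE /reduced_path => /andP[-> /negPf->].
  rewrite (reindex_onto (fun S => F0 :|: S) (fun F => F :&: lines)) /=; last first.
    by move=> F /andP[_ /eqP<-]; rewrite setUC setID.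
  have powE : (1 + u) ^+ #|lines| = \sum_(S : {set word L} | S \subset lines) u ^+ #|S|.
    rewrite -prodr_const -subset_prod; apply: eq_bigr => S _; exact: prodr_const.
  rewrite powE mulr_suml; apply: eq_big => S.
    apply/idP/idP => [/andP[_ /eqP<-]|Sl]; first exact: subsetIr.
    rewrite setIUl F0l set0U (setIidPl Sl) eqxx andbT.
    rewrite setDUl (_ : S :\: lines = set0) ?setU0; last by apply/eqP; rewrite setD_eq0.
    apply/andP; split; last by rewrite -{2}(setID F0 lines) F0l set0U.
    have SI w : w \in S -> full_path I (pts w) by move/(subsetP Sl); rewrite inE => /andP[].
    have F0I w : w \in F0 -> full_path I (pts w) by move/F0r/andP => [].
    apply/complexP; split=> [w /setUP[/F0I|/SI]|w w'] //.
    move=> /setUP[w0|wS] /setUP[w'0|w'S] ww'.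
    - exact: F0f.
    - by rewrite friend_sym not_line ?(subsetP Sl) // F0I.
    - by rewrite not_line ?(subsetP Sl) // F0I.
    by rewrite not_line ?(subsetP Sl) // SI.
  case/andP => _ /eqP SE; rewrite cardsU.
  have -> : F0 :&: S = set0.
    by apply/eqP; rewrite -subset0 -F0l setIS // -SE subsetIr.
  by rewrite cards0 subn0 exprD mulrC.
move=> F /complexP[FI Ff]; apply/complexP; split=> [w /setDP[wF wl]|w w' /setDP[wF _] /setDP[w'F _]].
  by rewrite /reduced_path FI //=; move: wl; rewrite inE FI.
exact: Ff.
Qed.

Definition segment (p : seq point) : bool := [&& p != [::], sorted step p & all (mem I) p].

Lemma segmentE p : segment p = open_segment I p && (last z0 p \in I).
Proof.
apply/idP/idP.
  case/and3P; case/lastP: p => // m b _ sp /allP pI; rewrite last_rcons.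
  have {}pI : {subset rcons m b <= I} by [].
  rewrite (pI b) ?mem_rcons ?mem_head // andbT; apply/open_segmentP; exists m, b; split=> //.
    by move=> z zm; apply: pI; rewrite mem_rcons inE zm orbT.
  by move=> _; apply: pI; rewrite mem_rcons mem_head.
case/andP => /open_segmentP[m [b [-> sp mI _]]]; rewrite last_rcons => bI.
apply/and3P; split=> //; first by rewrite -size_eq0 size_rcons.
by apply/allP => z; rewrite mem_rcons inE => /orP[/eqP->|/mI].
Qed.

Lemma reduced_path_sum (K : fieldType) (u X : K) : X * u = 1 + u -> 1 + u != 0 ->
  \sum_(F in complex L (reduced_path I) I) u ^+ #|F| =
  u ^+ #|` I| * \sum_(F in complex L segment I) X ^+ #|F|.
Proof.
move=> Xu u1; have := path_sum_segment_sum I_interior (fun=> 1) Xu.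
rewrite prodr_const mulr1 -card_lines.
have -> : path_sum L u I (fun=> 1) = \sum_(F in complex L (full_path I) I) u ^+ #|F|.
  by apply: eq_bigr => F _; rewrite prodr_const mulr1.
rewrite full_path_complex_split.
move=> E; apply: (mulfI (expf_neq0 #|lines| u1)); rewrite {}E.
rewrite -mulrA mulrCA; congr (_ * (_ * _)).
(* At [A = 1] an end outside [I] weighs 0, so only the faces made of segments inside [I] survive. *)
rewrite /segment_sum (bigID (fun F : {set word L} => F \in complex L segment I)) /= addrC big1 ?add0r.
  apply: eq_big => [F|F /andP[_ /complexP[FS _]]].
    apply: andb_idl => /complexP[FS Ff]; apply/complexP; split=> // w /FS.
    by rewrite segmentE => /andP[].
  rewrite -prodr_const; apply: eq_bigr => w /FS.
  by rewrite segmentE /segment_weight => /andP[_ ->].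
move=> F /andP[/complexP[FO Ff] FnS].
have /existsP[w /andP[wF wS]] : [exists w, (w \in F) && ~~ segment (pts w)].
  apply: contraR FnS => /existsPn FS; apply/complexP; split=> // w wF.
  by move: (FS w); rewrite wF /= negbK.
rewrite (bigD1 w) //= /segment_weight; move: wS; rewrite segmentE FO //= => /negPf->.
by rewrite subrr mul0r.
Qed.

End Lines.

(** * Faces containing initial paths *)

Lemma cat_eq_cat (p1 s x t : seq point) : p1 ++ s = x ++ t ->
  (exists2 d, x = p1 ++ d & s = d ++ t) \/
  (exists d, [/\ d != [::], p1 = x ++ d & t = d ++ s]).
Proof.
elim: p1 x => [|z p1 IH] [|z' x] //=; try by left; eexists.
- by move=> <-; right; exists (z :: p1).
case=> <- /IH[[d -> ->]|[d [d0 -> ->]]]; first by left; exists d.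
by right; exists d.
Qed.

Lemma in_code_head p u : in_code p u = in_code p [:: head z0 u].
Proof. by []. Qed.

Lemma out_code_last u p : out_code u p = out_code [:: last z0 u] p.
Proof. by []. Qed.

Lemma in_code_cat x p u : p != [::] -> in_code (x ++ p) u = in_code p u.
Proof.
case: p => // z p _; rewrite /in_code last_cat /=.
by rewrite -size_eq0 size_cat addnS.
Qed.

Lemma out_code_cat u p y : p != [::] -> out_code u (p ++ y) = out_code u p.
Proof. by case: p. Qed.

Section Lift.
Variables (L : grid_shape) (I J : {fset point}).
Hypothesis I_interior : {in I, forall z, interior L z}.
Hypothesis JI : {subset J <= I}.

Definition west_tail (a : point) : seq point := rev (behead (run west I a)).
Definition south_tail (a : point) : seq point := behead (run south I a).

(* [p] is prolonged straight to the West and straight to the South until it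
   leaves [I]; the initial path at [a] is [lift [:: a]]. *)
Definition lift (p : seq point) : seq point :=
  west_tail (head z0 p) ++ p ++ south_tail (last z0 p).

Lemma west_tail_horizontal a : horizontal (rcons (west_tail a) a).
Proof.
have := @horizontal_rev_run I a [::] isT.
by rewrite cats0 /run /= rev_cons.
Qed.

Lemma south_tail_vertical a : vertical (a :: south_tail a).
Proof.
rewrite /vertical /south_tail /=.
by apply: sub_path (run_fpath south I a) => v w /= /eqP->.
Qed.

Lemma west_tail_outside a : a \notin I -> west_tail a = [::].
Proof. by move=> aI; rewrite /west_tail run_outside //; exact: west_free. Qed.

Lemma south_tail_outside a : a \notin I -> south_tail a = [::].
Proof. by move=> aI; rewrite /south_tail run_outside //; exact: south_free. Qed.

Lemma west_tail_inside a : a \in I ->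
  exists z s, [/\ west_tail a = z :: s, z \notin I & {subset s <= I}].
Proof.
move=> aI; rewrite /west_tail run_rcons.
have : iter (exit_time west I a) west a \notin I by apply: run_exit; exact: west_free.
have : {subset traject west a (exit_time west I a) <= I} by apply: run_inner; exact: west_free.
case: (exit_time west I a) => [|k] sI zI; first by rewrite /= aI in zI.
exists (iter k.+1 west a), (rev (traject west (west a) k)); split=> //.
  by rewrite [behead _]/= rev_rcons.
by move=> z; rewrite mem_rev => zk; apply: sI; rewrite inE zk orbT.
Qed.

Lemma south_tail_inside a : a \in I ->
  exists z s, [/\ south_tail a = rcons s z, z \notin I & {subset s <= I}].
Proof.
move=> aI; rewrite /south_tail run_rcons.
have : iter (exit_time south I a) south a \notin I by apply: run_exit; exact: south_free.
have : {subset traject south a (exit_time south I a) <= I} by apply: run_inner; exact: south_free.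
case: (exit_time south I a) => [|k] sI zI; first by rewrite /= aI in zI.
exists (iter k.+1 south a), (traject south (south a) k); split=> //.
by move=> z zk; apply: sI; rewrite inE zk orbT.
Qed.

Lemma tails_sub a : a \in L -> {subset west_tail a ++ south_tail a <= L}.
Proof.
move=> aL z; rewrite mem_cat mem_rev => /orP[] /mem_behead.
  apply: run_sub aL _; first exact: west_free.
  by move=> y /(interior_in I_interior)[-> _ _ _ ->].
apply: run_sub aL _; first exact: south_free.
by move=> y /(interior_in I_interior)[-> _ -> _ _].
Qed.

Lemma lift_sub p : p != [::] -> {subset p <= L} -> {subset lift p <= L}.
Proof.
move=> p0 pL z; rewrite /lift !mem_cat => /or3P[zw|/pL //|zs].
  apply: (tails_sub (a := head z0 p)); last by rewrite mem_cat zw.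
  by apply: pL; case: (p) p0 => // b q _; rewrite mem_head.
apply: (tails_sub (a := last z0 p)); last by rewrite mem_cat zs orbT.
by apply: pL; apply: last_mem.
Qed.

Lemma lift_sorted p : p != [::] -> sorted step p -> sorted step (lift p).
Proof.
move=> p0 sp; rewrite /lift; case: p p0 sp => // a p _ sp.
rewrite cat_cons sorted_cat_cons (horizontal_sorted (west_tail_horizontal a)) /=.
by rewrite cat_path [path _ _ _]sp; apply: (vertical_sorted (south_tail_vertical _)).
Qed.

(* The part of a walk that survives in the lift of [P]: outside of [P] the
   lift is straight, which the codes exclude. *)
Lemma lift_West_North P p1 u p2 : P != [::] -> u != [::] -> p1 != [::] -> p2 != [::] ->
  lift P = p1 ++ u ++ p2 -> (in_code p1 u <= 1)%N -> (1 <= out_code u p2)%N ->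
  exists P1 P2, [/\ P = P1 ++ u ++ P2, P1 != [::], P2 != [::],
    p1 = west_tail (head z0 P) ++ P1 & p2 = P2 ++ south_tail (last z0 P)].
Proof.
move=> P0 u0 p10 p20 E c1 c2; move: (E); rewrite /lift.
set x := west_tail _; set y := south_tail _ => /esym/cat_eq_cat[[d xE dE]|[P1 [P10 p1E]]].
  have hx := west_tail_horizontal (head z0 P); rewrite -/x xE in hx.
  have hd : exists t, rcons (p1 ++ d) (head z0 P) = p1 ++ [:: head z0 u] ++ t.
    rewrite rcons_cat; have : head z0 (rcons d (head z0 P)) = head z0 u.
      have : head z0 (u ++ p2) = head z0 u by case: (u) u0.
      by rewrite dE => <-; case: (d) => //=; case: (P) P0.
    case: (rcons d _) (size_rcons d (head z0 P)) => // b t _ /= ->.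
    by exists t.
  case: hd => t tE; rewrite tE in hx.
  have [/(_ p10) c _] := @horizontal_codes p1 [:: head z0 u] t isT hx.
  by rewrite in_code_head c in c1.
rewrite catA => /cat_eq_cat[[d uE yE]|[d [d0 PE dE]]]; last first.
  by exists P1, d; split=> //; rewrite PE catA.
have hy := south_tail_vertical (last z0 P); rewrite -/y yE -cat_cons lastI cat_rcons in hy.
have [_ /(_ p20) c] := @vertical_codes _ [:: _] p2 isT hy.
have ul : last z0 u = last (last z0 P) d.
  have := congr1 (last z0) uE; rewrite !last_cat.
  by case: (u) u0.
by rewrite out_code_last ul c in c2.
Qed.

(** Here the codes agree with the directions of the tails and do not suffice. A part that begins in
    the West tail either stops before the head of [P], and is left to the East, or contains that
    head, which is not in [J]; similarly at the South tail. *)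
Lemma lift_core P p1 u p2 : P != [::] -> head z0 P \notin J -> last z0 P \notin J ->
  u != [::] -> {subset u <= J} -> lift P = p1 ++ u ++ p2 ->
  (1 <= in_code p1 u)%N -> (out_code u p2 <= 1)%N -> p1 != [::] -> p2 != [::] ->
  exists P1 P2, [/\ P = P1 ++ u ++ P2, P1 != [::], P2 != [::],
    p1 = west_tail (head z0 P) ++ P1 & p2 = P2 ++ south_tail (last z0 P)].
Proof.
move=> P0 aJ bJ u0 uJ E c1 c2 p10 p20; move: (E); rewrite /lift.
set x := west_tail _; set y := south_tail _ => /esym/cat_eq_cat[[d xE dE]|[P1 [P10 p1E]]].
  have hx := west_tail_horizontal (head z0 P); rewrite -/x xE in hx.
  case/cat_eq_cat: dE => [[e dE p2E]|[e [e0 uE eE]]].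
    have h : horizontal (p1 ++ u ++ rcons e (head z0 P)) by move: hx; rewrite dE rcons_cat rcons_cat.
    have [_] := horizontal_codes u0 h; rewrite -size_eq0 size_rcons => /(_ isT) c.
    suff c' : out_code u p2 = out_code u (rcons e (head z0 P)) by rewrite c' c in c2.
    rewrite p2E /out_code; have -> : (e ++ P ++ y == [::]) = (rcons e (head z0 P) == [::]).
      by case: (e) => //; case: (P) P0.
    by case: (e) => //; case: (P) P0.
  have : head z0 P \in u.
    have <- : head z0 e = head z0 P.
      have := congr1 (head z0) eE; case: (e) e0 => // z e' _; case: (P) P0 => //.
    by rewrite uE mem_cat; case: (e) e0 => // z e' _; rewrite mem_head orbT.
  by move/uJ; rewrite (negPf aJ).
rewrite catA => /cat_eq_cat[[d uE yE]|[d [d0 PE dE]]]; last first.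
  by exists P1, d; split=> //; rewrite PE catA.
have hy := south_tail_vertical (last z0 P); rewrite -/y yE in hy.
case/cat_eq_cat: uE => [[e PE eE]|[e [e0 P1E eE]]].
  have [e0|e0] := eqVneq e [::].
    have v : vertical ([:: last z0 P] ++ u ++ p2) by rewrite eE e0.
    have [/(_ isT) c _] := vertical_codes u0 v.
    have cE : in_code p1 u = in_code [:: last z0 P] u.
      rewrite p1E in_code_cat // /in_code (negPf P10) /= PE e0 cats0.
      by case: (P1) P10.
    by move: c1; rewrite cE c.
  have : last z0 P \in u.
    rewrite PE last_cat eE mem_cat; case: (e) e0 => // z s _ /=.
    by rewrite mem_last.
  by move/uJ; rewrite (negPf bJ).
have v : vertical ((last z0 P :: e) ++ u ++ p2) by move: hy; rewrite eE -catA.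
have [/(_ isT) c _] := vertical_codes u0 v.
have cE : in_code p1 u = in_code (last z0 P :: e) u.
  by rewrite p1E in_code_cat // P1E in_code_cat //; case: (e) e0.
by move: c1; rewrite cE c.
Qed.

End Lift.

Section Link.
Variables (L : grid_shape) (I J : {fset point}).
Hypothesis I_interior : {in I, forall z, interior L z}.
Hypothesis JI : {subset J <= I}.

(* Common to the reduced paths of [J] and to [[:: a]] for [a] in [I] but not
   in [J]. *)
Definition core (P : seq point) : Prop :=
  [/\ P != [::], head z0 P \notin J, last z0 P \notin J &
      forall P1 u P2, P1 != [::] -> P2 != [::] -> P = P1 ++ u ++ P2 -> {subset u <= J}].

Lemma core_full_path P : full_path J P -> core P.
Proof.
case/full_pathP => a [m [b [-> sp aJ bJ mJ]]]; split; rewrite //= ?last_rcons //.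
move=> [|z P1] u P2 // _ + [_].
case/lastP: P2 => // P2 c _; rewrite -!rcons_cat => /rcons_inj[mE _] y yu.
by apply: mJ; rewrite mE !mem_cat yu orbT.
Qed.

Lemma core_point a : a \notin J -> core [:: a].
Proof.
move=> aJ; split=> // -[|z P1] u P2 // _ P20 [_ /(congr1 size)] /=.
by rewrite !size_cat => /esym/eqP; rewrite !addn_eq0 !size_eq0 (negPf P20) !andbF.
Qed.

Lemma lift_ends P p1 u p2 : P != [::] -> u != [::] -> {subset u <= I} -> lift I P = p1 ++ u ++ p2 ->
  p1 != [::] /\ p2 != [::].
Proof.
move=> P0 u0 uI E.
have hI : head z0 (lift I P) \notin I.
  have [aI|aI] := boolP (head z0 P \in I).
    have [z [s [wE zI _]]] := west_tail_inside aI.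
    by rewrite /lift wE.
  by rewrite /lift west_tail_outside //=; case: (P) P0 aI.
have lI : last z0 (lift I P) \notin I.
  rewrite /lift !last_cat.
  have -> : last (last z0 (west_tail I (head z0 P))) P = last z0 P by case: (P) P0.
  have [bI|bI] := boolP (last z0 P \in I).
    have [z [s [sE zI _]]] := south_tail_inside bI.
    by rewrite sE last_rcons.
  by rewrite south_tail_outside.
split.
  apply: contraNneq hI => p10; rewrite E p10 /=.
  by case: (u) u0 uI => // z s _ uI; apply: uI; rewrite mem_head.
apply: contraNneq lI => p20; rewrite E p20 cats0 last_cat.
by case: (u) u0 uI => // z s _ uI; apply: uI; rewrite /= mem_last.
Qed.

(** From left to right [u] is only known to lie in [I]. The walk entering from the North and leaving
    to the East comes first: its codes put [u] inside [Q], hence in [J], which [lift_core] needs for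
    the other walk. *)
Lemma friendly_codes_lift P Q : core P -> core Q ->
  friendly_codes I (lift I P) (lift I Q) <-> friendly_codes J P Q.
Proof.
move=> [P0 aJ bJ Pin] [Q0 cJ dJ Qin]; split.
  case=> u [p1 [p2 [q1 [q2 [u0 uI pE qE [h1 h2 h3 h4]]]]]].
  have [p10 p20] := lift_ends P0 u0 uI pE.
  have [q10 q20] := lift_ends Q0 u0 uI qE.
  have [Q1 [Q2 [QE Q10 Q20 q1E q2E]]] := lift_West_North Q0 u0 q10 q20 qE h3 h4.
  have uJ := Qin _ _ _ Q10 Q20 QE.
  have [P1 [P2 [PE P10 P20 p1E p2E]]] := lift_core P0 aJ bJ u0 uJ pE h1 h2 p10 p20.
  exists u, P1, P2, Q1, Q2; split=> //.
  move: h1 h2 h3 h4; rewrite p1E p2E q1E q2E !in_code_cat // !out_code_cat //.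
case=> u [P1 [P2 [Q1 [Q2 [u0 uJ PE QE [h1 h2 h3 h4]]]]]].
have ends R R1 R2 : head z0 R \notin J -> last z0 R \notin J -> R = R1 ++ u ++ R2 ->
    R1 != [::] /\ R2 != [::].
  move=> hJ lJ RE; split.
    apply: contraNneq hJ => R10; rewrite RE R10 /=.
    by case: (u) u0 uJ => // z s _ uJ'; apply: uJ'; rewrite mem_head.
  apply: contraNneq lJ => R20; rewrite RE R20 cats0 last_cat.
  by case: (u) u0 uJ => // z s _ uJ'; apply: uJ'; rewrite /= mem_last.
have [P10 P20] := ends _ _ _ aJ bJ PE; have [Q10 Q20] := ends _ _ _ cJ dJ QE.
exists u, (west_tail I (head z0 P) ++ P1), (P2 ++ south_tail I (last z0 P)).
exists (west_tail I (head z0 Q) ++ Q1), (Q2 ++ south_tail I (last z0 Q)).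
rewrite !in_code_cat // !out_code_cat //; split=> // [z /uJ/JI //||].
  by rewrite {1}/lift {2}PE -!catA.
by rewrite {1}/lift {2}QE -!catA.
Qed.

Lemma not_friendly_point a P : a \notin J ->
  ~ friendly_codes J [:: a] P /\ ~ friendly_codes J P [:: a].
Proof.
move=> aJ; have no u p1 p2 : u != [::] -> {subset u <= J} -> [:: a] = p1 ++ u ++ p2 -> False.
  move=> u0 uJ E; have : a \in u.
    have := congr1 size E; rewrite /= !size_cat.
    case: u u0 uJ E => // z u _ uJ; case: p1 => [[-> _]|z' p1]; first by rewrite mem_head.
    by rewrite /=; lia.
  by move/uJ; rewrite (negPf aJ).
split; first by case=> u [p1 [p2 [q1 [q2 [u0 uJ pE _ _]]]]]; exact: no u0 uJ pE.
by case=> u [p1 [p2 [q1 [q2 [u0 uJ _ qE _]]]]]; exact: no u0 uJ qE.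
Qed.

Lemma lift_reduced P : reduced_path J P -> reduced_path I (lift I P).
Proof.
case/andP => PJ nsP; have [P0 aJ bJ _] := core_full_path PJ.
have sP : sorted step P by case/full_pathP: PJ => ? [? [? []]].
apply/andP; split; last first.
  apply: contra nsP; rewrite /lift => /orP[] h; apply/orP; [left|right];
    exact: (cat_sorted2 (cat_sorted2 h).2).1.
have sl := lift_sorted I P0 sP.
case/full_pathP: PJ P0 sP sl => a [m [b [PE _ _ _ mJ]]] P0 sP sl.
move: sl; rewrite /lift PE /= last_rcons => sl.
have [z1 [r1 [wE z1I r1I]]] : exists z1 r1, [/\ rcons (west_tail I a) a = z1 :: r1,
    z1 \notin I & {subset r1 <= I}].
  have [aI|aI] := boolP (a \in I).
    have [z [s [-> zI sI]]] := west_tail_inside aI.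
    exists z, (rcons s a); split=> // y; rewrite mem_rcons inE => /orP[/eqP->|/sI] //.
  by exists a, [::]; rewrite west_tail_outside.
have [z2 [r2 [sE z2I r2I]]] : exists z2 r2, [/\ b :: south_tail I b = rcons r2 z2,
    z2 \notin I & {subset r2 <= I}].
  have [bI|bI] := boolP (b \in I).
    have [z [s [-> zI sI]]] := south_tail_inside bI.
    exists z, (b :: s); split=> // y; rewrite inE => /orP[/eqP->|/sI] //.
  by exists b, [::]; rewrite south_tail_outside.
have E : west_tail I a ++ a :: rcons m b ++ south_tail I b = z1 :: rcons (r1 ++ m ++ r2) z2.
  by rewrite -cat_rcons wE cat_rcons sE -!rcons_cat.
apply/full_pathP; exists z1, (r1 ++ m ++ r2), z2; split=> //.
by move=> y; rewrite !mem_cat => /or3P[/r1I|/mJ/JI|/r2I].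
Qed.

Lemma lift_point_reduced a : a \in I -> reduced_path I (lift I [:: a]).
Proof.
move=> aI; have sl := @lift_sorted I [:: a] isT isT; move: sl; rewrite /lift /=.
have hw := west_tail_horizontal I a; have vs := south_tail_vertical I a; move: hw vs.
have [z [s [-> zI sI]]] := west_tail_inside aI.
have [z' [s' [-> z'I s'I]]] := south_tail_inside aI => hw vs sl.
apply/andP; split.
  apply/full_pathP; exists z, (s ++ a :: s'), z'; split=> //; first by rewrite rcons_cat.
  by move=> y; rewrite mem_cat inE => /or3P[/sI|/eqP->|/s'I].
apply/negP => /orP[] h.
  have h' : horizontal ([::] ++ a :: rcons s' z') by exact: (cat_sorted2 h).2.
  by case: s' vs h' {s'I sl h} => [|y s'] vs h';
    [apply: (@horizontal_vertical_edge [::] a z')|apply: (@horizontal_vertical_edge [::] a y)];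
    [exact: h'|exact: vs|move: h'; rewrite /horizontal /= => /andP[->]|
     move: vs; rewrite /vertical /= => /andP[->]].
have h' : vertical (rcons (z :: s) a).
  have : vertical ((z :: s) ++ a :: rcons s' z') := h.
  by rewrite -cat_rcons => /cat_sorted2[].
case/lastP: s hw h' {sI sl h} => [|s y] hw h'.
  by apply: (@horizontal_vertical_edge [::] z a).
apply: (@horizontal_vertical_edge (z :: s) y a).
  by move: hw; rewrite -rcons_cons -!cats1 -catA.
by move: h'; rewrite -rcons_cons -!cats1 -catA.
Qed.

Lemma reduced_path_end2 P : reduced_path J P -> exists a m b,
  [/\ P = a :: rcons m b, a \notin J, b \notin J & {subset m <= J}].
Proof. by case/andP => /full_pathP[a [m [b [-> _ aJ bJ mJ]]]] _; exists a, m, b. Qed.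

(** If the tails differed, one of the reduced paths would lie along a straight tail, or an end of
    one walk, which is not in [J], would be an inner vertex of the other. *)
Lemma lift_inj P Q : reduced_path J P -> reduced_path J Q \/ (exists2 a, a \notin J & Q = [:: a]) ->
  lift I P = lift I Q -> P = Q.
Proof.
move=> PJ QJ; case/andP: (PJ) => _; rewrite negb_or => /andP[nhP nvP].
have [P0 aJ bJ Pin] : core P by apply: core_full_path; case/andP: PJ.
have [Q0 cJ dJ Qin] : core Q.
  by case: QJ => [/andP[/core_full_path]|[a aJ' ->]] //; apply: core_point.
have hw := west_tail_horizontal I; have vs := south_tail_vertical I.
have sizeP : (1 < size P)%N.
  by have [a [m [b [-> _ _ _]]]] := reduced_path_end2 PJ; rewrite /= size_rcons.
have inner R R1 c R2 : core R -> R1 != [::] -> R2 != [::] -> R = R1 ++ c :: R2 -> c \in J.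
  move=> [_ _ _ Rin] R10 R20 RE; apply: (Rin R1 [:: c] R2) => //; exact: mem_head.
have cP : core P by [].
have cQ : core Q by [].
rewrite /lift.
set x := west_tail I (head z0 P); set x' := west_tail I (head z0 Q).
set y := south_tail I (last z0 P); set y' := south_tail I (last z0 Q) => E.
have [xx' PQ] : x = x' /\ P ++ y = Q ++ y'.
  case/cat_eq_cat: E => [[d x'E dE]|[d [d0 xE dE]]].
    have [d0|d0] := eqVneq d [::]; first by move: x'E dE; rewrite d0 cats0.
    have hd : horizontal (rcons d (head z0 Q)).
      by have := hw (head z0 Q); rewrite -/x' x'E rcons_cat => /cat_sorted2[].
    case/cat_eq_cat: dE => [[e d_E _]|[e [e0 PE eE]]].
      by move: hd; rewrite d_E rcons_cat => /cat_sorted2[hP _]; rewrite /horizontal hP in nhP.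
    case: e e0 PE eE => // c e _ PE eE.
    have cE : c = head z0 Q by move: eE; case: (Q) Q0 => // q Q' _ [->].
    have [e0|e0] := eqVneq e [::].
      by move: nhP; rewrite PE e0 cats1 cE hd.
    by have := inner P d c e cP d0 e0 PE; rewrite cE (negPf cJ).
  have hd : horizontal (rcons d (head z0 P)).
    by have := hw (head z0 P); rewrite -/x xE rcons_cat => /cat_sorted2[].
  case: QJ => [QJ|[a aJ' QE]]; last first.
    case: d d0 hd xE dE => // c d _ _ _; rewrite QE => -[ca E'].
    have y'E : y' = south_tail I a by rewrite /y' QE.
    have := vs a; rewrite -y'E E' -cat_cons.
    by case/cat_sorted2 => _ /cat_sorted2[hP _]; rewrite /vertical hP in nvP.
  case/andP: (QJ) => _; rewrite negb_or => /andP[nhQ _].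
  case/cat_eq_cat: dE => [[e d_E _]|[e [e0 QE eE]]].
    by move: hd; rewrite d_E rcons_cat => /cat_sorted2[hQ _]; rewrite /horizontal hQ in nhQ.
  case: e e0 QE eE => // c e _ QE eE.
  have cE : c = head z0 P by move: eE; case: (P) P0 => // q P' _ [->].
  have [e0|e0] := eqVneq e [::].
    by move: nhQ; rewrite QE e0 cats1 cE hd.
  by have := inner Q d c e cQ d0 e0 QE; rewrite cE (negPf aJ).
case/cat_eq_cat: PQ => [[d QE yE]|[d [d0 PE y'E]]].
  have [d0|d0] := eqVneq d [::]; first by rewrite QE d0 cats0.
  case: QJ => [QJ|[a _ Qa]]; last first.
    have := congr1 size QE; rewrite Qa size_cat /=.
    by case: (d) d0 => // ? ? _ /=; move: sizeP; lia.
  move: QE; case/lastP: (P) P0 sizeP bJ => // P' b _ sizeP'; rewrite last_rcons cat_rcons => bJ' QE.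
  have P'0 : P' != [::] by move: sizeP'; rewrite size_rcons; case: (P').
  by have := inner Q P' b d cQ P'0 d0 QE; rewrite (negPf bJ').
move: PE; case: QJ => [QJ|[a _ Qa]].
  have [c [m [e [QE _ eJ _]]]] := reduced_path_end2 QJ.
  rewrite QE -rcons_cons cat_rcons => PE.
  by have := inner P (c :: m) e d cP isT d0 PE; rewrite (negPf eJ).
rewrite Qa => PE; have y'a : y' = south_tail I a by rewrite /y' Qa.
have := vs a; rewrite -y'a y'E -cat_cons => /cat_sorted2[hP _].
by move: nvP; rewrite PE /vertical hP.
Qed.

End Link.

(** * Paths that do not kiss an initial path *)

Lemma southward_split t s : t != [::] -> vertical t -> sorted step (t ++ s) ->
  ~~ vertical (t ++ s) ->
  exists w q, [/\ s = w ++ q, vertical (t ++ w), q != [::] & out_code (t ++ w) q = 2].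
Proof.
elim: s t => [|y s IH] t t0 vt; first by rewrite cats0 vt.
have [yE|yE] := eqVneq y (south (last z0 t)).
  have vy : vertical (rcons t y).
    case/lastP: t t0 vt yE => // t z _ vt; rewrite last_rcons => yE.
    by rewrite /vertical -cats1 cat_rcons sorted_cat_cons [sorted _ _]vt /= yE eqxx.
  rewrite -cat_rcons => st nv; have [|w [q [-> vw q0 oq]]] := IH (rcons t y) _ vy st nv.
    by rewrite -size_eq0 size_rcons.
  by exists (y :: w), q; rewrite -cat_rcons.
move=> _ _; exists [::], (y :: s); rewrite cats0; split=> //.
by rewrite /out_code /= (negPf yE).
Qed.

Lemma westward_split t s : t != [::] -> horizontal t -> sorted step (s ++ t) ->
  ~~ horizontal (s ++ t) ->
  exists q w, [/\ s = q ++ w, horizontal (w ++ t), q != [::] & in_code q (w ++ t) = 0%N].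
Proof.
elim/last_ind: s t => [|s y IH] t t0 ht; first by rewrite ht.
have [yE|yE] := eqVneq y (west (head z0 t)).
  have hy : horizontal (y :: t).
    by case: t t0 ht yE => // z t _ ht yE; rewrite /horizontal /= [path _ _ _]ht east_west yE eqxx.
  rewrite cat_rcons => st nv; have [q [w [-> hw q0 iq]]] := IH (y :: t) isT hy st nv.
  by exists q, (rcons w y); rewrite rcons_cat cat_rcons.
move=> _ _; exists (rcons s y), [::]; rewrite cats0; split=> //.
  by rewrite -size_eq0 size_rcons.
by rewrite /in_code -size_eq0 size_rcons last_rcons (negPf yE).
Qed.

Section RunRecognition.
Variables (f : point -> point) (I : {fset point}).
Hypothesis f_free : forall a, injective (fun k => iter k f a).

Lemma run_prefix c s : fpath f c s -> {subset c :: s <= I} ->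
  exists2 t, t != [::] & behead (run f I c) = s ++ t.
Proof.
case/fpathP => n ->{s} sI.
have ltn : (n < exit_time f I c)%N.
  rewrite ltnNge; apply/negP => le; move: (run_exit I f_free c); rewrite sI //.
  rewrite -[c :: _]/(traject f c n.+1); apply/trajectP; exists (exit_time f I c) => //.
exists (traject f (iter n f (f c)) (exit_time f I c - n)).
  by rewrite -size_eq0 size_traject subn_eq0 -ltnNge.
by rewrite /run [behead _]/= -trajectD subnKC // ltnW.
Qed.

Lemma run_unique c s z : fpath f c (rcons s z) -> {subset c :: s <= I} -> z \notin I ->
  behead (run f I c) = rcons s z.
Proof.
move=> fs sI zI; have [|t t0 E] := @run_prefix c s _ sI.
  by move: fs; rewrite rcons_path => /andP[].
have cI : c \in I by apply: sI; rewrite mem_head.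
have ftr := run_fpath f I c; rewrite E cat_path in ftr.
case/andP: ftr => _; case: t t0 E => // z' t _ E.
have goalE : behead (run f I c) = traject f (f c) (exit_time f I c) by [].
move=> /= /andP[/eqP zE _]; rewrite -goalE.
move: fs; rewrite rcons_path => /andP[_ /eqP]; rewrite zE => z'z; rewrite z'z in E.
suff t0 : t = [::] by rewrite E t0 cats1.
case/lastP: t E => // t y E.
suff : z \in traject f c (exit_time f I c) by move/(run_inner f_free); rewrite (negPf zI).
have := run_rcons f I c; rewrite /run [traject _ _ _.+1]/=.
rewrite -goalE E -rcons_cons -rcons_cat -rcons_cons => /rcons_inj[<- _].
by rewrite inE mem_cat mem_head !orbT.
Qed.

End RunRecognition.

Lemma horizontal_rev s c : horizontal (rcons s c) -> fpath west c (rev s).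
Proof.
move=> h; rewrite -[path _ _ _]/(sorted (frel west) (c :: rev s)) -rev_rcons rev_sorted.
by apply: sub_sorted h => v w /=; rewrite east_west eq_sym.
Qed.

Section LinkSum.
Variables (L : grid_shape) (I J : {fset point}).
Hypothesis I_interior : {in I, forall z, interior L z}.
Hypothesis JI : {subset J <= I}.

(** The common part is found by following the initial path at [c] in both directions as long as [p]
    does: westwards until [p] comes from the North, southwards until [p] goes East. The two negative
    hypotheses say that both happen, so the codes are opposite at both ends. *)
Lemma friendly_cut p s1 c s2 : full_path I p -> p = s1 ++ c :: s2 -> c \in I ->
  ~~ horizontal (rcons s1 c) -> ~~ vertical (c :: s2) ->
  friendly_codes I (lift I [:: c]) p.
Proof.
move=> pI pE cI nh nv; have [_ _ _ pin] := core_full_path pI.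
have sp : sorted step p by case/full_pathP: pI => ? [? [? []]].
rewrite pE sorted_cat_cons in sp; case/andP: sp => sp1 sp2.
have [|w [q2 [s2E vw q20 oq]]] := @southward_split [:: c] s2 isT isT _ nv; first exact: sp2.
have [||q1 [w' [s1E hw q10 iq]]] := @westward_split [:: c] s1 isT isT.
- by rewrite cats1.
- by rewrite cats1.
pose u := w' ++ c :: w.
have uE : p = q1 ++ u ++ q2 by rewrite pE s1E s2E /u -!catA.
have uI := pin _ _ _ q10 q20 uE.
have [|y yw|t1 t10 t1E] := @run_prefix west I west_free c (rev w').
- by apply: horizontal_rev; rewrite -cats1.
- by apply: uI; rewrite mem_cat; move: yw; rewrite !inE mem_rev => /orP[->|->]; rewrite ?orbT.
have [|y yw|t2 t20 t2E] := @run_prefix south I south_free c w.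
- by apply: sub_path vw => y z /= /eqP->.
- by apply: uI; rewrite mem_cat yw orbT.
have lE : lift I [:: c] = rev t1 ++ u ++ t2.
  by rewrite /lift [head _ _]/= [last _ _]/= /west_tail /south_tail t1E t2E rev_cat revK /u -!catA.
have u0 : u != [::] by rewrite -size_eq0 size_cat addnS.
have rt10 : rev t1 != [::] by rewrite -size_eq0 size_rev size_eq0.
have hl : horizontal (rev t1 ++ (rcons w' c) ++ [::]).
  have := west_tail_horizontal I c.
  by rewrite /west_tail t1E rev_cat revK rcons_cat cats0.
have hd : head z0 u = head z0 (rcons w' c) by rewrite /u; case: (w').
have wc0 : rcons w' c != [::] by rewrite -size_eq0 size_rcons.
have [/(_ rt10) c1 _] := horizontal_codes wc0 hl.
have vl : vertical ([::] ++ (c :: w) ++ t2).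
  by have := south_tail_vertical I c; rewrite /south_tail t2E.
have [_ /(_ t20) c2] := @vertical_codes [::] (c :: w) t2 isT vl.
have lu : last z0 u = last z0 (c :: w) by rewrite /u last_cat.
exists u, (rev t1), t2, q1, q2; split=> //.
rewrite !(in_code_head _ u) !(out_code_last u) hd lu -!in_code_head -!out_code_last c1 c2.
have -> : in_code q1 (rcons w' c) = 0%N by rewrite -cats1.
by have -> : out_code (c :: w) q2 = 2.
Qed.

(** [p] is the lift of a shrinking piece [a :: rcons m b], at first [p] itself. A point [c] of [m]
    outside [J] cuts the piece, and by [friendly_cut] one half is absorbed by a straight tail. The
    other half is not straight: otherwise the whole piece would be, or [p] would be the initial path
    at [c]. *)
Lemma lift_surj p : reduced_path I p ->
  (forall c, c \in I -> c \notin J ->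
     p <> lift I [:: c] /\ ~ friendly_codes I (lift I [:: c]) p) ->
  exists2 P, reduced_path J P & p = lift I P.
Proof.
case/andP => pI nsp H.
have sp : sorted step p by case/full_pathP: pI => ? [? [? []]].
have main n a m b : (size m < n)%N -> p = lift I (a :: rcons m b) ->
    ~~ straight (a :: rcons m b) -> a \notin J -> b \notin J -> {subset m <= I} ->
    exists2 P, reduced_path J P & p = lift I P.
  elim: n a m b => // n IH a m b mn pE nsP aJ bJ mI.
  have pE' : p = west_tail I a ++ (a :: rcons m b) ++ south_tail I b.
    by rewrite pE /lift /= last_rcons.
  have [/allP mJ|/allPn[c cm cJ]] := boolP (all (mem J) m).
    exists (a :: rcons m b) => //; apply/andP; split=> //; apply/full_pathP.
    exists a, m, b; split=> //.
    by move: sp; rewrite pE' => /cat_sorted2[_ /cat_sorted2[]].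
  have cI := mI c cm; have [nq nf] := H c cI cJ.
  case/splitPr: cm pE pE' nsP mn mI => m1 m2 pE pE' nsP mn mI.
  have pE2 : p = (west_tail I a ++ a :: m1) ++ c :: (rcons m2 b ++ south_tail I b).
    by rewrite pE' rcons_cat rcons_cons -!catA !cat_cons -!catA.
  have vb := south_tail_vertical I b; have ha := west_tail_horizontal I a.
  have PE : a :: rcons (m1 ++ c :: m2) b = (a :: m1) ++ c :: rcons m2 b.
    by rewrite rcons_cat.
  have vcat : vertical (c :: rcons m2 b) -> vertical (c :: (rcons m2 b ++ south_tail I b)).
    by move=> v; rewrite cat_rcons -cat_cons /vertical sorted_cat_cons rcons_cons [sorted _ _]v.
  have hcat : horizontal (rcons (a :: m1) c) -> horizontal (rcons (west_tail I a ++ a :: m1) c).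
    move=> h; rewrite rcons_cat rcons_cons /horizontal sorted_cat_cons [sorted _ _]ha /=.
    by move: h; rewrite rcons_cons.
  have [z [i [e [pzE _ zI eI iI]]]] := full_pathP _ _ pI.
  (* Up to [c], the path is then a horizontal line coming from outside [I], which [run_unique]
     identifies with the West tail of [c]. *)
  have westE : horizontal (rcons (west_tail I a ++ a :: m1) c) ->
      west_tail I c = west_tail I a ++ a :: m1.
    move=> h; have fr := horizontal_rev h.
    have [s wE sI] : exists2 s, west_tail I a ++ a :: m1 = z :: s & {subset s <= I}.
      case E : (west_tail I a ++ a :: m1) => [|z' s]; first by case: (west_tail I a) E.
      move: pE2; rewrite E pzE => -[<- iE]; exists s => // y ys.
      apply: iI; case/lastP: (rcons m2 b ++ _) iE => [|t e'].
        by rewrite cats1 => /rcons_inj[-> _].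
      by rewrite -rcons_cons -rcons_cat => /rcons_inj[-> _]; rewrite mem_cat ys.
    rewrite wE rev_cons in fr; rewrite /west_tail (run_unique west_free fr) //.
      by rewrite rev_rcons revK wE.
    by move=> y; rewrite inE mem_rev => /orP[/eqP->|/sI].
  have southE : vertical (c :: (rcons m2 b ++ south_tail I b)) ->
      south_tail I c = rcons m2 b ++ south_tail I b.
    move=> v; have [s sE sI] : exists2 s, rcons m2 b ++ south_tail I b = rcons s e & {subset s <= I}.
      case/lastP E : (rcons m2 b ++ south_tail I b) => [|s e'].
        by move/eqP: E; rewrite -size_eq0 size_cat size_rcons.
      move: pE2; rewrite E pzE -rcons_cons -rcons_cons -rcons_cat => /rcons_inj[iE ->].
      exists s => // y ys; apply: iI.
      have : y \in behead (z :: i) by rewrite iE; case: (west_tail I a) => //= *; rewrite !(mem_cat, inE) ys !orbT.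
      by [].
    have fr : fpath south c (rcons s e).
      by rewrite -sE; apply: sub_path v => y w /= /eqP->.
    rewrite /south_tail (run_unique south_free fr) //.
    by move=> y; rewrite inE => /orP[/eqP->|/sI].
  have liftc : horizontal (rcons (west_tail I a ++ a :: m1) c) ->
      vertical (c :: (rcons m2 b ++ south_tail I b)) -> False.
    by move=> /westE wE /southE sE; apply: nq; rewrite /lift /= wE sE.
  have [h|nh] := boolP (horizontal (rcons (west_tail I a ++ a :: m1) c)).
    apply: (IH c m2 b) => //.
    - by rewrite ltnS in mn; apply: leq_trans mn; rewrite size_cat /= addnS ltnS leq_addl.
    - by rewrite /lift /= last_rcons (westE h) pE2.
    - apply: contra nsP => /orP[hP|/vcat/(liftc h)//]; apply/orP; left.
      rewrite PE /horizontal sorted_cat_cons.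
      by move: h; rewrite rcons_cat => /cat_sorted2[_ ->].
    by move=> y ym; apply: mI; rewrite mem_cat inE ym !orbT.
  have [v|nv] := boolP (vertical (c :: (rcons m2 b ++ south_tail I b))); last first.
    by case: nf; apply: friendly_cut pE2 cI nh nv.
  apply: (IH a m1 c) => //.
  - by rewrite ltnS in mn; apply: leq_trans mn; rewrite size_cat /= addnS ltnS leq_addr.
  - by rewrite /lift /= last_rcons (southE v) pE2 -catA cat_cons [rcons m1 c ++ _]cat_rcons.
  - apply: contra nsP => /orP[/hcat/liftc/(_ v)//|vP]; apply/orP; right.
    rewrite PE /vertical sorted_cat_cons rcons_cons [sorted _ _]vP /=.
    by move: v; rewrite -cat_cons => /cat_sorted2[].
  by move=> y ym; apply: mI; rewrite mem_cat ym.
have [a [m [b [pE _ aI bI mI]]]] := full_pathP _ _ pI.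
apply: (main (size m).+1 a m b) => //; rewrite -?pE //.
- by rewrite pE /lift /= last_rcons west_tail_outside // south_tail_outside // cats0.
- by apply: contra aI; apply: JI.
by apply: contra bI; apply: JI.
Qed.

End LinkSum.

(** * Links of faces *)

Section FaceLinks.
Variables (L : grid_shape) (I J : {fset point}).
Hypothesis I_interior : {in I, forall z, interior L z}.
Hypothesis JI : {subset J <= I}.

Lemma interior_mem z : z \in I -> z \in L.
Proof. by move/I_interior/and5P => []. Qed.

Lemma reduced_path_sorted K p : reduced_path K p -> p != [::] /\ sorted step p.
Proof. by case/andP => /full_pathP[a [m [b [-> ? _ _ _]]]] _. Qed.

Section Paths.
Variable Q : {set word L}.
Hypothesis QP : forall w : word L,
  w \in Q <-> exists a, [/\ a \in I, a \notin J & pts w = lift I [:: a]].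

Definition lift_word (w : word L) : word L := to_word L (lift I (pts w)).

Lemma pts_lift_word (w : word L) : reduced_path J (pts w) -> pts (lift_word w) = lift I (pts w).
Proof.
move=> /reduced_path_sorted[w0 sw]; apply: to_wordK; first exact: lift_sorted.
by apply: lift_sub => //; apply: pts_sub.
Qed.

Lemma core_reduced w : reduced_path J w -> core J w.
Proof. by case/andP => /core_full_path. Qed.

Lemma friend_lift (p q : word L) P R : core J P -> core J R -> sorted step P -> sorted step R ->
  pts p = lift I P -> pts q = lift I R -> 
  {subset P <= L} -> {subset R <= L} -> friend L I (pts p) (pts q) = friend L J P R.
Proof.
move=> cP cR sP sR pE qE PL RL; have [P0 _ _ _] := cP; have [R0 _ _ _] := cR.
have sp : sorted step (pts p) by rewrite pE; apply: lift_sorted.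
have sq : sorted step (pts q) by rewrite qE; apply: lift_sorted.
have H1 := friendly_codes_lift JI cP cR; have H2 := friendly_codes_lift JI cR cP.
apply/(friendP _ sp sq (@pts_sub L p) (@pts_sub L q))/(friendP _ sP sR PL RL).
  by rewrite pE qE => -[/H1|/H2] h; [left|right].
by rewrite pE qE => -[/H1|/H2] h; [left|right].
Qed.

Lemma not_friend_point a P : a \in I -> a \notin J -> sorted step P -> {subset P <= L} ->
  ~~ friend L J [:: a] P.
Proof.
move=> aI aJ sP PL; have [n1 n2] := not_friendly_point P aJ.
have aL : {subset [:: a] <= L} by move=> z; rewrite inE => /eqP->; apply: interior_mem.
have sa : sorted step [:: a] by [].
by apply/negP => /(friendP _ sa sP aL PL)[].
Qed.

Lemma not_friend_Q_lift (q w : word L) P : q \in Q -> core J P -> sorted step P ->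
  {subset P <= L} -> pts w = lift I P -> ~~ friend L I (pts q) (pts w).
Proof.
move=> /QP[a [aI aJ qE]] cP sP PL wE.
have aL : {subset [:: a] <= L} by move=> z; rewrite inE => /eqP->; apply: interior_mem.
have sa : sorted step [:: a] by [].
rewrite (friend_lift (core_point aJ) cP sa sP qE wE aL PL).
exact: not_friend_point.
Qed.

Lemma lift_word_inj w w' : reduced_path J (pts w) -> reduced_path J (pts w') ->
  lift_word w = lift_word w' -> w = w'.
Proof.
move=> wJ w'J /(congr1 (@pts L)); rewrite !pts_lift_word // => E.
by apply: pts_inj; apply: (lift_inj wJ _ E); left.
Qed.

Lemma lift_word_notQ w : reduced_path J (pts w) -> lift_word w \notin Q.
Proof.
move=> wJ; apply/negP => /QP[a [aI aJ]]; rewrite pts_lift_word // => E.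
have E' : pts w = [:: a] by apply: (lift_inj wJ _ E); right; exists a.
by case/andP: wJ => /full_pathP[b [m [c [wE _ _ _ _]]]]; move: wE; rewrite E'; case: m.
Qed.

(** [h] adds the initial paths to the lifts, and [h'] recovers the walks that were lifted. A face
    containing [Q] has no other members: a path outside [Q] kisses none of [Q], so [lift_surj]
    applies to it. *)
Lemma path_link_sum (K : comNzRingType) (u : K) :
  \sum_(F in complex L (reduced_path I) I | Q \subset F) u ^+ #|F| =
  u ^+ #|Q| * \sum_(F in complex L (reduced_path J) J) u ^+ #|F|.
Proof.
pose h (F : {set word L}) := Q :|: lift_word @: F.
pose h' (F : {set word L}) := [set w | reduced_path J (pts w) && (lift_word w \in F)].
have hK (F : {set word L}) : {in F, forall w, reduced_path J (pts w)} -> h' (h F) = F.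
  move=> FJ; apply/setP => w; rewrite !inE; apply/idP/idP => [/andP[wJ]|wF].
    rewrite (negPf (lift_word_notQ wJ)) /= => /imsetP[w' w'F E].
    by rewrite (lift_word_inj wJ (FJ _ w'F) E).
  by rewrite FJ // (imset_f lift_word wF) orbT.
have h'K (F : {set word L}) : F \in complex L (reduced_path I) I -> Q \subset F -> h (h' F) = F.
  case/complexP => FI Ff QF; apply/setP => w; rewrite in_setU; apply/orP/idP.
    by case=> [/(subsetP QF) //|/imsetP[w' + ->]]; rewrite inE => /andP[].
  move=> wF; have [wQ|wQ] := boolP (w \in Q); [by left|right].
  have [c cI cJ|P PJ wE] := lift_surj JI (FI w wF).
    split=> [wE|]; first by case/negP: wQ; apply/QP; exists c.
    have [q qE] : exists q : word L, pts q = lift I [:: c].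
      apply: word_ex; first exact: lift_sorted.
      by apply: lift_sub => // z; rewrite inE => /eqP->; apply: interior_mem.
    have qQ : q \in Q by apply/QP; exists c.
    have qw : q != w by apply: contraNneq wQ => <-.
    have := Ff q w (subsetP QF _ qQ) wF qw; rewrite -qE => nf fr.
    have sq : sorted step (pts q) by rewrite qE; apply: lift_sorted.
    have [_ sw] := reduced_path_sorted (FI w wF).
    by case/negP: nf; apply/friendP; rewrite ?qE -?qE //; try exact: pts_sub; left.
  have [P0 sP] := reduced_path_sorted PJ.
  have [w' w'P] : exists w' : word L, pts w' = P.
    apply: word_ex => // z zP; apply: (@pts_sub L w).
    by rewrite wE /lift !mem_cat zP orbT.
  have w'E : lift_word w' = w.
    by apply: pts_inj; rewrite pts_lift_word w'P.
  by apply/imsetP; exists w'; rewrite // inE w'P PJ w'E.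
have fr w w' : reduced_path J (pts w) -> reduced_path J (pts w') ->
    friend L I (pts (lift_word w)) (pts (lift_word w')) = friend L J (pts w) (pts w').
  move=> wJ w'J; have [_ sw] := reduced_path_sorted wJ; have [_ sw'] := reduced_path_sorted w'J.
  apply: friend_lift; rewrite ?pts_lift_word //; try exact: core_reduced; exact: pts_sub.
have hC (F : {set word L}) : {in F, forall w, reduced_path J (pts w)} ->
    (h F \in complex L (reduced_path I) I) = (F \in complex L (reduced_path J) J).
  move=> FJ; apply/complexP/complexP => -[CP Cf]; split=> //.
  - move=> w w' wF w'F ww'; rewrite -fr ?FJ //; apply: Cf.
    + by rewrite in_setU imset_f ?orbT.
    + by rewrite in_setU imset_f ?orbT.
    by apply: contra ww' => /eqP/lift_word_inj->; rewrite ?FJ.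
  - move=> w /setUP[/QP[a [aI _ ->]]|/imsetP[w' w'F ->]]; first exact: lift_point_reduced.
    by rewrite pts_lift_word ?FJ //; apply: (lift_reduced JI); apply: FJ.
  have cL w : w \in F -> [/\ core J (pts w), sorted step (pts w) &
      pts (lift_word w) = lift I (pts w)].
    move=> wF; have [_ sw] := reduced_path_sorted (FJ w wF).
    by split=> //; [apply: core_reduced; apply: FJ|apply: pts_lift_word; apply: FJ].
  move=> w w' /setUP[wQ|/imsetP[w1 w1F ->]] /setUP[w'Q|/imsetP[w2 w2F ->]] ww'.
  - case/QP: (w'Q) => a [aI aJ w'E].
    have sa : sorted step [:: a] by [].
    apply: (not_friend_Q_lift wQ (core_point aJ) sa _ w'E).
    by move=> z; rewrite inE => /eqP->; apply: interior_mem.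
  - have [c2 s2 E2] := cL _ w2F.
    by apply: (not_friend_Q_lift wQ c2 s2 _ E2); apply: pts_sub.
  - have [c1 s1 E1] := cL _ w1F; rewrite friend_sym.
    by apply: (not_friend_Q_lift w'Q c1 s1 _ E1); apply: pts_sub.
  rewrite fr ?FJ //; apply: Cf => //.
  by apply: contra ww' => /eqP->.
rewrite mulr_sumr (reindex_onto h h') /=; last by move=> F /andP[]; apply: h'K.
apply: eq_big => F.
  apply/idP/idP => [/andP[/andP[hFC _] /eqP hF]|FC].
    by rewrite -hC // => w; rewrite -hF inE => /andP[].
  have FJ : {in F, forall w, reduced_path J (pts w)} by case/complexP: FC.
  by rewrite hC // FC hK // eqxx subsetUl.
case/andP => _ /eqP hF; have FJ : {in F, forall w, reduced_path J (pts w)}.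
  by move=> w; rewrite -hF inE => /andP[].
rewrite -exprD /h cardsU card_in_imset; last first.
  by move=> w w' wF w'F; apply: lift_word_inj; apply: FJ.
have -> : Q :&: lift_word @: F = set0.
  apply/setP => w; rewrite in_setI in_set0; apply/negbTE/negP => /andP[wQ /imsetP[w' w'F wE]].
  by move: (lift_word_notQ (FJ _ w'F)); rewrite -wE wQ.
by rewrite cards0 subn0.
Qed.

End Paths.

Section Segments.
Variable T : {set word L}.
Hypothesis TP : forall w : word L,
  w \in T <-> exists a, [/\ a \in I, a \notin J & pts w = [:: a]].

Lemma friend_common K (p q : seq point) : sorted step p -> sorted step q ->
  {subset p <= L} -> {subset q <= L} -> friend L K p q -> exists2 z, z \in p & z \in q.
Proof.
move=> sp sq pL qL /(friendP _ sp sq pL qL).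
case=> -[[|z u] [p1 [p2 [q1 [q2 [// _ _ -> -> _]]]]]]; exists z;
  by rewrite !(mem_cat, inE) eqxx !orbT.
Qed.

Lemma friend_restrict (p q : seq point) : sorted step p -> sorted step q ->
  {subset p <= L} -> {subset q <= L} -> {subset p <= J} ->
  friend L I p q = friend L J p q.
Proof.
move=> sp sq pL qL pJ; apply/(friendP _ sp sq pL qL)/(friendP _ sp sq pL qL).
  by case=> -[u [p1 [p2 [q1 [q2 [u0 uI pE qE cs]]]]]]; [left|right];
    exists u, p1, p2, q1, q2; split=> // z zu; apply: pJ;
    rewrite ?pE ?qE !mem_cat zu orbT.
by case=> -[u [p1 [p2 [q1 [q2 [u0 uJ pE qE cs]]]]]]; [left|right];
  exists u, p1, p2, q1, q2; split=> // z /uJ/JI.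
Qed.

Lemma size_pts (w : word L) : size (pts w) = size w.
Proof. exact: size_map. Qed.

(** That [T] lies in [epsilon G] means that the other members of [G] avoid the points of [I] outside
    [J], that is, are segments of [J]. Such segments share no vertex with those of [T], hence are
    nonfriendly to them. *)
Lemma segment_link_sum (K : comNzRingType) (X : K) :
  \sum_(G in complex L (segment I) I | T \subset epsilon G) X ^+ #|G| =
  X ^+ #|T| * \sum_(G in complex L (segment J) J) X ^+ #|G|.
Proof.
have epsP (G : {set word L}) (t : word L) : t \in epsilon G -> t \in G /\
    forall s, s \in G -> s != t -> ~~ infix (pts t) (pts s).
  rewrite inE => /and3P[tG _ /forall_inP h]; split=> // s sG st.
  by move: (h s sG); rewrite st.
have segP K' w : segment K' w -> sorted step w /\ {subset w <= K'}.
  by case/and3P => _ sw /allP wK; split.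
have segT w : w \in T -> segment I (pts w).
  by case/TP => a [aI _ ->]; rewrite /segment /= aI.
have segJI w : segment J w -> segment I w.
  by case/and3P => w0 sw /allP wJ; rewrite /segment w0 sw; apply/allP => z /wJ/JI.
have notJT (w : word L) : segment J (pts w) -> w \notin T.
  by move=> /segP[_ wJ]; apply/negP => /TP[a [_ aJ wE]]; move: aJ; rewrite wJ // wE mem_head.
rewrite mulr_sumr (reindex_onto (fun G => T :|: G) (fun G => G :\: T)) /=; last first.
  move=> G /andP[_ TG]; rewrite setDE setUIr setUCr setIT; apply/setUidPr.
  by apply/subsetP => t /(subsetP TG)/epsP[].
have disj (G : {set word L}) : (T :|: G) :\: T = G -> T :&: G = set0.
  move=> GE; rewrite -GE; apply/setP => w; rewrite !inE.
  by case: (w \in T); rewrite ?andbF.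
apply: eq_big => G; last first.
  by case/andP => _ /eqP/disj TG; rewrite -exprD cardsU TG cards0 subn0.
apply/idP/idP => [/andP[/andP[GC TG] /eqP GE]|GC].
  have [CS Cf] := complexP _ _ _ GC.
  have GJ w : w \in G -> segment J (pts w).
    move=> wG; have wTG : w \in T :|: G by rewrite inE wG orbT.
    have /and3P[w0 sw /allP wI] := CS w wTG.
    rewrite /segment w0 sw; apply/allP => c cw; apply: contraT => cJ.
    have cI := wI c cw.
    have [t tE] : exists t : word L, pts t = [:: c].
      by apply: word_ex => // z; rewrite inE => /eqP->; apply: interior_mem.
    have tT : t \in T by apply/TP; exists c.
    have [_ h] := epsP _ _ (subsetP TG _ tT).
    have wt : w = t by apply/eqP; apply: contraT => /(h w wTG); rewrite tE infix1s cw.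
    by move: wG; rewrite -GE wt !inE tT.
  apply/complexP; split=> // w w' wG w'G ww'.
  have [sw wJ] := segP _ _ (GJ w wG); have [sw' _] := segP _ _ (GJ w' w'G).
  rewrite -friend_restrict //; try exact: pts_sub.
  by apply: Cf; rewrite // inE ?wG ?w'G orbT.
have [CS Cf] := complexP _ _ _ GC.
have GE : (T :|: G) :\: T == G.
  apply/eqP/setP => w; rewrite !inE; case: (boolP (w \in G)) => wG; last by rewrite orbF andNb.
  by rewrite (notJT _ (CS w wG)) orbT.
have nTG t w : t \in T -> w \in G -> ~~ friend L I (pts t) (pts w).
  move=> tT wG; have [sw wJ] := segP _ _ (CS w wG); have [st _] := segP _ _ (segT t tT).
  apply/negP => /(friend_common st sw (@pts_sub L t) (@pts_sub L w))[z].
  case/TP: tT => a [_ aJ ->]; rewrite inE => /eqP->.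
  by move/wJ; rewrite (negPf aJ).
rewrite GE andbT; apply/andP; split.
  apply/complexP; split=> [w /setUP[/segT //|/CS/segJI //]|w w'].
  move=> /setUP[wT|wG] /setUP[w'T|w'G] ww'.
  - apply/negP; have [sw _] := segP _ _ (segT w wT); have [sw' _] := segP _ _ (segT w' w'T).
    case/(friend_common sw sw' (@pts_sub L w) (@pts_sub L w')) => z.
    case/TP: wT => a [_ _ wE]; case/TP: w'T => a' [_ _ w'E].
    rewrite wE w'E !inE => /eqP-> /eqP aa'; case/eqP: ww'.
    by apply: pts_inj; rewrite wE w'E aa'.
  - exact: nTG.
  - by rewrite friend_sym; apply: nTG.
  have [sw wJ] := segP _ _ (CS w wG); have [sw' _] := segP _ _ (CS w' w'G).
  by rewrite friend_restrict //; try exact: pts_sub; apply: Cf.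
apply/subsetP => t tT; have /TP[a [aI aJ tE]] := tT.
rewrite inE in_setU tT -size_pts tE /=; apply/forall_inP => s sTG; apply/implyP => st.
rewrite infix1s; case/setUP: sTG => [/TP[a' [_ _ sE]]|sG].
  rewrite sE inE; apply: contra st => /eqP aa'.
  by apply/eqP/pts_inj; rewrite sE tE aa'.
have [_ sJ] := segP _ _ (CS s sG).
by apply: contra aJ; apply: sJ.
Qed.

End Segments.
End FaceLinks.

(** * The two complexes *)

Section Correspondence.
Variables (L : grid_shape) (I : {fset point}).
Hypothesis IP : forall z, (z \in I) = interior L z.

Lemma all_interior : {in I, forall z, interior L z}.
Proof. by move=> z; rewrite IP. Qed.

Lemma is_path_full (w : word L) : is_path L (pts w) = full_path I (pts w).
Proof.
have wL := @pts_sub L w; case: (pts w) wL => // a p wL.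
have bE z : z \in a :: p -> boundary L z = (z \notin I).
  by move=> /wL zL; rewrite /boundary zL IP.
rewrite /is_path /full_path bE ?mem_head // bE ?mem_last //; do 4! congr (_ && _).
by apply: eq_all => z; rewrite /= IP.
Qed.

Lemma is_segmentE p : is_segment L p = segment I p.
Proof. by rewrite /is_segment /segment; do 2! congr (_ && _); apply: eq_all => z; rewrite /= IP. Qed.

Lemma kiss_friend (p q : seq point) : full_path I p -> full_path I q ->
  kiss L p q = friend L I p q.
Proof.
move=> pI qI; have no r u : full_path I r -> u != [::] -> {subset u <= I} ->
    prefix u r = false /\ suffix u r = false.
  move=> rI u0 uI; split; apply/negbTE/negP.
    by move=> /prefixP[t rE]; have [] := @full_path_inner I r u [::] t rI u0 uI rE.
  move=> /suffixP[t rE]; have [] := @full_path_inner I r u t [::] rI u0 uI; last by [].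
  by rewrite cats0.
have sw r : full_path I r -> sorted step r by case/full_pathP => ? [? [? []]].
apply: eq_existsb => u; rewrite is_segmentE /segment.
case: (eqVneq (pts u) [::]) => //= u0; case: (boolP (all _ _)) => [/allP uI|_]; last by rewrite !andbF.
have E r t : full_path I r -> full_path I t ->
    friendly_along (pts u) r t = kiss_along (pts u) r t.
  move=> rI tI; rewrite /friendly_along /kiss_along.
  by have [-> ->] := no r _ rI u0 uI; have [-> ->] := no t _ tI u0 uI.
rewrite andbT !E //; apply: andb_idl; rewrite -!E // => h.
(* The common part inherits from its path that it is made of steps, as [is_segment] demands. *)
have [r [t [r1 [r2 rE]]]] : exists r t r1 r2, [/\ friendly_along (pts u) r t, full_path I r & r = r1 ++ pts u ++ r2].
  by case/orP: h => h; [have/(friendly_alongP u0 (sw _ pI) (sw _ qI))[r1 [r2 [? [? [rE _ _]]]]] := h; exists p, q, r1, r2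
    | have/(friendly_alongP u0 (sw _ qI) (sw _ pI))[r1 [r2 [? [? [rE _ _]]]]] := h; exists q, p, r1, r2].
by case: rE => _ /sw sr rE; move: sr; rewrite rE => /cat_sorted2[_ /cat_sorted2[]].
Qed.

Lemma friendly_friend (p q : seq point) : sorted step p -> sorted step q ->
  friendly L p q = friend L I p q.
Proof.
move=> sp sq; apply: eq_existsb => u; rewrite is_segmentE /segment.
case: (eqVneq (pts u) [::]) => //= u0.
case: (boolP (all _ _)) => _; rewrite ?andbF ?andbT //; apply: andb_idl => h.
case/orP: h => /friendly_alongP-/(_ u0).
  case/(_ sp sq) => p1 [p2 [? [? [pE _ _]]]].
  by move: sp; rewrite pE => /cat_sorted2[_ /cat_sorted2[]].
case/(_ sq sp) => p1 [p2 [? [? [pE _ _]]]].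
by move: sq; rewrite pE => /cat_sorted2[_ /cat_sorted2[]].
Qed.

Lemma reduced_nonkissing_complexE :
  reduced_nonkissing_complex L = complex L (reduced_path I) I.
Proof.
have PE (w : word L) : [&& is_path L (pts w), ~~ horizontal (pts w) & ~~ vertical (pts w)] =
    reduced_path I (pts w) by rewrite is_path_full /reduced_path negb_or.
apply/setP => F; rewrite !inE.
have -> : [forall p in F, [&& is_path L (pts p), ~~ horizontal (pts p) & ~~ vertical (pts p)]] =
    [forall p in F, reduced_path I (pts p)] by apply: eq_forallb => w; rewrite PE.
case: (boolP [forall p in F, reduced_path I (pts p)]) => // /forall_inP FI.
apply: eq_forallb_in => p pF; apply: eq_forallb_in => q qF.
have /andP[pI _] := FI p pF; have /andP[qI _] := FI q qF.
by rewrite kiss_friend.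
Qed.

Lemma nonfriendly_complexE : nonfriendly_complex L = complex L (segment I) I.
Proof.
apply/setP => F; rewrite !inE.
have -> : [forall p in F, is_segment L (pts p)] = [forall p in F, segment I (pts p)].
  by apply: eq_forallb => w; rewrite is_segmentE.
case: (boolP [forall p in F, segment I (pts p)]) => // /forall_inP FI.
apply: eq_forallb_in => p pF; apply: eq_forallb_in => q qF.
have /and3P[_ sp _] := FI p pF; have /and3P[_ sq _] := FI q qF.
by rewrite friendly_friend.
Qed.

(** By [initial_path_unique] it suffices that the lift turns at [val a] only: at its other vertices
    it starts, ends, or has the same code, 2 or 0, on both sides. *)
Lemma pts_initial_path (a : L) : interior L (val a) -> pts (initial_path a) = lift I [:: val a].
Proof.
move=> aint; have aI : val a \in I by rewrite IP.
have [w wE] : exists w : word L, pts w = lift I [:: val a].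
  apply: word_ex; first exact: lift_sorted.
  by apply: (lift_sub all_interior) => // z; rewrite inE => /eqP->; apply: valP.
rewrite -wE; congr pts; apply: (@initial_path_unique L (val a)); first exact: initial_pathP.
have sw : sorted step (pts w) by rewrite wE; apply: lift_sorted.
have hw := west_tail_horizontal I (val a); have vs := south_tail_vertical I (val a).
have E : pts w = west_tail I (val a) ++ [:: val a] ++ south_tail I (val a) by rewrite wE.
have [x0 y0] : west_tail I (val a) != [::] /\ south_tail I (val a) != [::].
  have [z [s [-> _ _]]] := west_tail_inside aI; have [z' [s' [-> _ _]]] := south_tail_inside aI.
  by split=> //; rewrite -size_eq0 size_rcons.
have hw' : horizontal (west_tail I (val a) ++ [:: val a] ++ [::]) by rewrite cats1.
have [/(_ x0) cx _] := @horizontal_codes _ [:: val a] _ isT hw'.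
have [_ /(_ y0) cy] := @vertical_codes [::] [:: val a] _ isT vs.
rewrite /is_initial_path is_path_full; apply/and4P; split.
- by rewrite wE; case/andP: (lift_point_reduced aI).
- by rewrite E enters_west_in_code -?E // cx.
- by rewrite E leaves_south_out_code -?E // cy.
have turnE b p1 p2 : pts w = p1 ++ [:: b] ++ p2 -> turns_at b (pts w) =
    (in_code p1 [:: b] == 2) && (out_code [:: b] p2 == 0%N) ||
    (in_code p1 [:: b] == 0%N) && (out_code [:: b] p2 == 2).
  move=> wE'; have sw' := sw; rewrite wE' in sw'; rewrite /turns_at wE'.
  by rewrite enters_west_in_code // enters_north_in_code // leaves_south_out_code //
    leaves_east_out_code.
apply/forallP => b; apply/implyP; apply: contraTT => ba.
have [bw|bw] := boolP (val b \in pts w); last first.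
  rewrite /turns_at; apply/norP; split; apply: contra bw => /andP[+ _]; rewrite /enters_west /enters_north.
    by move/mem_infix; apply; rewrite !inE eqxx orbT.
  by move/mem_infix; apply; rewrite !inE eqxx orbT.
move: bw; rewrite {1}E !mem_cat inE (negPf ba) /= => /orP[] bt.
  case/splitPr: bt (E) hw => x1 x2 {}E h.
  have {}E : pts w = x1 ++ [:: val b] ++ (x2 ++ val a :: south_tail I (val a)) by rewrite E -!catA.
  have {}h : horizontal (x1 ++ [:: val b] ++ rcons x2 (val a)).
    by move: h; rewrite rcons_cat.
  have [ci co] := @horizontal_codes x1 [:: val b] _ isT h.
  rewrite (turnE _ _ _ E).
  have -> : out_code [:: val b] (x2 ++ val a :: south_tail I (val a)) = 2.
    by rewrite -cat_rcons out_code_cat ?co // -size_eq0 size_rcons.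
  have [x10|x10] := eqVneq x1 [::]; first by rewrite x10.
  by rewrite ci.
case/splitPr: bt (E) vs => y1 y2 {}E h.
have {}E : pts w = (west_tail I (val a) ++ rcons [::] (val a) ++ y1) ++ [:: val b] ++ y2.
  by rewrite E -!catA.
have {}h : vertical ((val a :: y1) ++ [:: val b] ++ y2) by [].
have [ci co] := @vertical_codes (val a :: y1) [:: val b] _ isT h.
rewrite (turnE _ _ _ E).
have -> : in_code (west_tail I (val a) ++ rcons [::] (val a) ++ y1) [:: val b] = 0%N.
  by rewrite in_code_cat // ci.
have [y20|y20] := eqVneq y2 [::]; first by rewrite y20.
by rewrite co.
Qed.

End Correspondence.

(** * The generating polynomials *)

Lemma prod_subset_split (K : comNzRingType) (I : finType) (P : pred I) (y : I -> K) :
  \prod_(i | P i) (1 + y i) = \sum_(S : {set I} | [forall i in S, P i]) \prod_(i in S) y i.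
Proof.
rewrite -big_set -subset_prod; apply: eq_bigl => S.
by apply/subsetP/forall_inP => h i /h; rewrite inE.
Qed.

Section FieldIdentity.
Variables (L : grid_shape) (r : nat) (v : 'I_r -> L).
Hypotheses (v_inj : injective v)
  (v_interior : forall w : L, interior L (val w) <-> exists i, v i = w).

Definition remaining (S : {set 'I_r}) : {fset point} := [fset val (v i) | i in ~: S]%fset.

Lemma val_v_inj : injective (fun i => val (v i)).
Proof. by move=> i j /val_inj/v_inj. Qed.

Lemma remainingP (S : {set 'I_r}) (z : point) : reflect (exists2 i, i \notin S & z = val (v i)) (z \in remaining S).
Proof.
apply: (iffP (imfsetP _ _ _ _)) => [[i /= iS ->]|[i iS ->]]; first by exists i; rewrite // -in_setC.
by exists i; rewrite //= in_setC.
Qed.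

Lemma card_remaining (S : {set 'I_r}) : (#|` remaining S| + #|S| = r)%N.
Proof.
rewrite /remaining card_imfset /=; last exact: val_v_inj.
have -> : size (enum_finmem (mem (~: S))) = #|~: S|.
  by rewrite -cardE.
by rewrite addnC cardsC card_ord.
Qed.

Lemma remaining_set0P z : (z \in remaining set0) = interior L z.
Proof.
apply/remainingP/idP => [[i _ ->]|zI]; first by apply/v_interior; exists i.
have zL : z \in L by case/and5P: zI.
have [i vi] := (v_interior [` zL]%fset).1 zI.
by exists i; rewrite ?inE // vi.
Qed.

Lemma remaining_sub (S : {set 'I_r}) : {subset remaining S <= remaining set0}.
Proof. by move=> z /remainingP[i _ ->]; apply/remainingP; exists i; rewrite ?inE. Qed.

Lemma v_notin_remaining (S : {set 'I_r}) i : i \in S -> val (v i) \notin remaining S.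
Proof. by move=> iS; apply/remainingP => -[j jS /val_v_inj ij]; rewrite -ij iS in jS. Qed.

Lemma removedP (S : {set 'I_r}) (z : point) : z \in remaining set0 -> z \notin remaining S ->
  exists2 i, i \in S & z = val (v i).
Proof.
case/remainingP => i _ -> zS; exists i => //.
by apply: contraR zS => iS; apply/remainingP; exists i.
Qed.

Local Notation inner := (remaining set0).

Lemma v_inner i : val (v i) \in inner.
Proof. by apply/remainingP; exists i; rewrite ?inE. Qed.

Lemma inner_interior : {in inner, forall z, interior L z}.
Proof. exact: all_interior remaining_set0P. Qed.

Lemma pts_initial_v i : pts (initial_path (v i)) = lift inner [:: val (v i)].
Proof. by apply: (pts_initial_path remaining_set0P); apply/v_interior; exists i. Qed.

Lemma initial_v_inj : injective (fun i => initial_path (v i)).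
Proof.
move=> i j E; have vint k : interior L (val (v k)) by apply/v_interior; exists k.
have /and4P[_ ew ls _] := initial_pathP (vint j).
have /and4P[_ _ _ /forallP/(_ (v j))] := initial_pathP (vint i).
by rewrite E /turns_at ew ls => /eqP/val_v_inj.
Qed.

Definition initial_paths (S : {set 'I_r}) : {set word L} := [set initial_path (v i) | i in S].
Definition lazy_segments (S : {set 'I_r}) : {set word L} := [set lazy (v i) | i in S].

Lemma lazy_v_inj : injective (fun i => lazy (v i)).
Proof. by move=> i j /(congr1 (@pts L)) [/val_v_inj]. Qed.

Lemma card_initial_paths S : #|initial_paths S| = #|S|.
Proof. by rewrite card_imset //; apply: initial_v_inj. Qed.

Lemma card_lazy_segments S : #|lazy_segments S| = #|S|.
Proof. by rewrite card_imset //; apply: lazy_v_inj. Qed.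

Lemma initial_pathsP S (w : word L) : w \in initial_paths S <->
  exists a, [/\ a \in inner, a \notin remaining S & pts w = lift inner [:: a]].
Proof.
split=> [/imsetP[i iS ->]|[a [aI aS wE]]].
  exists (val (v i)); split; [exact: v_inner|exact: v_notin_remaining|exact: pts_initial_v].
have [i iS aE] := removedP aI aS; apply/imsetP; exists i => //.
by apply: pts_inj; rewrite pts_initial_v wE aE.
Qed.

Lemma lazy_segmentsP S (w : word L) : w \in lazy_segments S <->
  exists a, [/\ a \in inner, a \notin remaining S & pts w = [:: a]].
Proof.
split=> [/imsetP[i iS ->]|[a [aI aS wE]]].
  by exists (val (v i)); split; [exact: v_inner|exact: v_notin_remaining|].
have [i iS aE] := removedP aI aS; apply/imsetP; exists i => //.
by apply: pts_inj; rewrite wE aE.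
Qed.

(** Expanding the factors [y i + 1] selects a set [S] of lazy segments in [epsilon G]; once the sums
    are exchanged, [segment_link_sum] evaluates the sum over the faces [G] for each [S]. *)
Lemma NFpoly_expand (K : comNzRingType) (X : K) (y : 'I_r -> K) :
  NFpoly v X (fun i => y i + 1) =
  \sum_(S : {set 'I_r}) \prod_(i in S) y i *
    (X ^+ #|S| * \sum_(G in complex L (segment (remaining S)) (remaining S)) X ^+ #|G|).
Proof.
rewrite /NFpoly (nonfriendly_complexE remaining_set0P).
under eq_bigr => G _.
  under eq_bigr => i _ do rewrite addrC.
  rewrite prod_subset_split mulr_sumr.
  over.
rewrite (exchange_big_dep predT) //=; apply: eq_bigr => S _.
rewrite -card_lazy_segments.
rewrite -(segment_link_sum inner_interior (@remaining_sub S) (lazy_segmentsP S)) mulr_sumr.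
apply: eq_big => [G|G _]; last exact: mulrC.
congr (_ && _); apply/forall_inP/subsetP => h.
  by move=> _ /imsetP[i iS ->]; apply: h.
by move=> i iS; apply/h/imset_f.
Qed.

(** The factor [u] in each substituted value makes up for the initial paths left out of the
    exponent, so that every face carries [u] to the power of its size. *)
Lemma NKpoly_expand (K : comNzRingType) (u : K) (y : 'I_r -> K) :
  NKpoly v u (fun i => u * (1 + y i)) =
  \sum_(S : {set 'I_r}) \prod_(i in S) y i *
    (u ^+ #|S| * \sum_(F in complex L (reduced_path (remaining S)) (remaining S)) u ^+ #|F|).
Proof.
rewrite /NKpoly (reduced_nonkissing_complexE remaining_set0P).
have FE (F : {set word L}) : u ^+ #|F :\: [set initial_path (v i) | i : 'I_r]| *
    \prod_(i < r | initial_path (v i) \in F) (u * (1 + y i)) =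
    u ^+ #|F| * \prod_(i < r | initial_path (v i) \in F) (1 + y i).
  rewrite big_split /= mulrA; congr (_ * _).
  rewrite -(cardsID [set initial_path (v i) | i : 'I_r] F) exprD mulrC; congr (_ * _).
  rewrite prodr_const; congr (_ ^+ _).
  have -> : F :&: [set initial_path (v i) | i : 'I_r] =
      [set initial_path (v i) | i in [pred i | initial_path (v i) \in F]].
    apply/setP => w; rewrite inE; apply/andP/imsetP => [[wF /imsetP[i _ wE]]|[i iF ->]].
      by exists i; rewrite // inE -wE.
    by split=> //; apply/imsetP; exists i.
  by rewrite card_imset //; apply: initial_v_inj.
under eq_bigr => F _.
  rewrite FE prod_subset_split mulr_sumr.
  over.
rewrite (exchange_big_dep predT) //=; apply: eq_bigr => S _.
rewrite -card_initial_paths.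
rewrite -(path_link_sum inner_interior (@remaining_sub S) (initial_pathsP S)) mulr_sumr.
apply: eq_big => [F|F _]; last exact: mulrC.
congr (_ && _); apply/forall_inP/subsetP => h.
  by move=> _ /imsetP[i iS ->]; apply: h.
by move=> i iS; apply/h/imset_f.
Qed.

Lemma NFpoly_NKpoly (K : fieldType) (x : K) (y : 'I_r -> K) : x != 0 -> x + 1 != 0 ->
  NFpoly v (x + 1) (fun i => y i + 1)
  = x ^+ r * NKpoly v (1 / x) (fun i => (1 + y i * (x + 1)) / x).
Proof.
move=> x0 x1; rewrite NFpoly_expand.
have -> : NKpoly v (1 / x) (fun i => (1 + y i * (x + 1)) / x) =
    NKpoly v (1 / x) (fun i => 1 / x * (1 + y i * (x + 1))).
  apply: eq_bigr => F _; congr (_ * _); apply: eq_bigr => i _.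
  by rewrite mulrC div1r.
rewrite NKpoly_expand mulr_sumr; apply: eq_bigr => S _.
have Xu : (x + 1) * (1 / x) = 1 + 1 / x by rewrite !div1r mulrDl mul1r divff.
have u1 : 1 + 1 / x != 0 by rewrite -Xu mulf_neq0 // div1r invr_neq0.
have Sint : {in remaining S, forall z, interior L z}.
  by move=> z /remaining_sub/inner_interior.
rewrite (reduced_path_sum Sint Xu u1) big_split /= prodr_const.
set N := \sum_(F in _) _.
have -> : x ^+ r = x ^+ #|` remaining S| * x ^+ #|S| by rewrite -exprD card_remaining.
have xu : x * (1 / x) = 1 by rewrite div1r divff.
have xn n : x ^+ n * (1 / x) ^+ n = 1 by rewrite -exprMn xu expr1n.
move: (xn #|S|) (xn #|` remaining S|).
move: (x ^+ _) (x ^+ _) ((1 / x) ^+ _) ((1 / x) ^+ _) ((x + 1) ^+ _) (\prod_(i in S) y i).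
(* [a * c] and [b * d] are the two parts of [x ^+ r * (1 / x) ^+ r], split by the size of [S]; [e]
   comes from the lazy segments on the left and from the factors [x + 1] next to the [y i] on the
   right. *)
move=> a b c d e P ac bd; transitivity (b * d * (a * c) * (P * (e * N))).
  by rewrite ac bd !mul1r.
by ring.
Qed.

End FieldIdentity.

Theorem theorem6p2 (L : grid_shape) (r : nat) (v : 'I_r -> L)
    (v_inj : injective v)
    (v_interior : forall w : L, interior L (val w) <-> exists i, v i = w) :
  let x := varx r in
  let y := @vary r in
  NFpoly v (x + 1) (fun i => y i + 1)
  = x ^+ r * NKpoly v (1 / x) (fun i => (1 + y i * (x + 1)) / x).
Proof.
move=> x y; apply: NFpoly_NKpoly => //; rewrite /x /varx.
  (* A polynomial with a nonzero value is nonzero: [x] is evaluated at 1, and [x + 1] at 0. *)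
  rewrite tofrac_eq0; apply/eqP => /(congr1 (meval (fun=> 1))).
  by rewrite mevalXU meval0 => /eqP; rewrite oner_eq0.
rewrite -tofrac1 -tofracD tofrac_eq0; apply/eqP => /(congr1 (meval (fun=> 0))).
by rewrite mevalD mevalXU meval1 meval0 add0r => /eqP; rewrite oner_eq0.
Qed.
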